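(* Let $\omega$ be a weight function on $\mathbb{R}^d$ satisfying the assumptions listed in the context. Let $\Omega\subseteq\mathbb{R}^d$ be open, let $\Lambda$ be a lattice in $\mathbb{R}^d$ with dual lattice $\Lambda^*$, $f\in\mathcal{D}_{(\omega)}'(\Omega)$, $v\in\mathscr{M}_{(\omega)}$, $q\in[1,\infty]$, and $(x_0,\xi_0)\in\Omega\times(\mathbb{R}^d\setminus\{0\})$. Suppose that $U$ is an open convex neighborhood of the origin such that $U\cap\Lambda^*=\{0\}$ and $x_0+U\subseteq\Omega$. Then the following statements are equivalent: (i) There are an open conic neighborhood $\Gamma$ of $\xi_0$ and $\varphi\in\mathcal{D}_{(\omega)}(x_0+U)$ with $\varphi(x_0)\neq0$ such that $$\left\|(\widehat{\varphi f}(\mu))_{\mu\in\Gamma\cap\Lambda}\right\|_{l^q_v(\Gamma\cap\Lambda)}<\infty.$$ (ii) $f$ is $\mathcal{F}L^q_v$-microlocally regular at $(x_0,\xi_0)$.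
   Context: Assumptions on $\omega$: $\omega:\mathbb{R}^d\to[0,\infty)$ is measurable, even, $\omega(0)=0$, and satisfies $(\alpha)$ $\omega(\xi_1+\xi_2)\le\omega(\xi_1)+\omega(\xi_2)$ for all $\xi_1,\xi_2$; $(\beta)$ $\int_{|\xi|>1}\omega(\xi)|\xi|^{-d-1}\,d\xi<\infty$; $(\gamma)$ there are $a\in\mathbb{R}$, $C>0$ with $\omega(\xi)\ge a+C\log(1+|\xi|)$ for all $\xi$; $(\alpha_0)$ $\omega(\xi)=\omega_0(|\xi|)$ with $\omega_0:[0,\infty)\to[0,\infty)$ non-decreasing. Fourier transform: $\widehat\varphi(\xi)=\int\varphi(x)e^{-2\pi i\xi\cdot x}\,dx$. For compact $K$ and $\lambda>0$, $\mathcal{D}^\lambda_\omega(K)$ is the Banach space of $\varphi\in L^1(\mathbb{R}^d)$ with support in $K$ and $\|\varphi\|_\lambda=\sup_\xi|\widehat\varphi(\xi)|e^{\lambda\omega(\xi)}<\infty$; $\mathcal{D}_{(\omega)}(\Omega)=\varinjlim_{K\Subset\Omega}\varprojlim_{\lambda\to\infty}\mathcal{D}^\lambda_\omega(K)$, and $\mathcal{D}'_{(\omega)}(\Omega)$ is its dual. $\mathcal{E}_{(\omega)}(\Omega)$ is the space of multipliers of $\mathcal{D}_{(\omega)}(\Omega)$ (functions $\varphi$ with $\varphi\psi\in\mathcal{D}_{(\omega)}(\Omega)$ for all $\psi\in\mathcal{D}_{(\omega)}(\Omega)$), with seminorms $\varphi\mapsto\|\varphi\psi\|_\lambda$; its dual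 $\mathcal{E}'_{(\omega)}(\Omega)$ is the space of compactly supported elements of $\mathcal{D}'_{(\omega)}(\Omega)$, and $\widehat g(\xi)=\langle g(x),e^{-2\pi i\xi\cdot x}\rangle$ for $g\in\mathcal{E}'_{(\omega)}$. A weight function $v$ (non-negative measurable function on $\mathbb{R}^d$) belongs to $\mathscr{M}_{(\omega)}$ if there are $C,\lambda>0$ with $v(\xi_1+\xi_2)\le Cv(\xi_1)e^{\lambda\omega(\xi_2)}$ for all $\xi_1,\xi_2\in\mathbb{R}^d$. A lattice is a discrete subgroup of $\mathbb{R}^d$ spanning $\mathbb{R}^d$; $\Lambda^*=\{\mu^*\in\mathbb{R}^d:\mu\cdot\mu^*\in\mathbb{Z}\ \forall\mu\in\Lambda\}$. An open conic neighborhood of $\xi_0\ne0$ is an open subset of $\mathbb{R}^d\setminus\{0\}$ containing $\xi_0$ and stable under positive dilations. $\|(c_\mu)_\mu\|_{l^q_v(\Gamma\cap\Lambda)}=\|(c_\mu v(\mu))_\mu\|_{l^q(\Gamma\cap\Lambda)}$. $f\in\mathcal{D}'_{(\omega)}(\Omega)$ is $\mathcal{F}L^q_v$-microlocally regular at $(x_0,\xi_0)$ if there are an open conic neighborhood $\Gamma$ of $\xi_0$ and $\varphi\in\mathcal{D}_{(\omega)}(\Omega)$ with $\varphi(x_0)\ne0$ such that $|\varphi f|_{\mathcal{F}L^{q,\Gamma}_v}:=\|\widehat{\varphi f}\,v\|_{L^q(\Gamma)}<\infty$. *)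

(* Defs.v *)
From HB Require Import structures.
From mathcomp Require Import all_boot all_order all_algebra.
From mathcomp Require Import complex.
From mathcomp Require Import all_classical all_reals all_analysis.

Set Implicit Arguments.
Unset Strict Implicit.
Unset Printing Implicit Defensive.

Import Order.TTheory GRing.Theory Num.Theory.
Import numFieldNormedType.Exports.
Import ComplexField.Normc.

Local Open Scope classical_set_scope.
Local Open Scope ring_scope.

Definition rV_display : measure_display.
Proof. exact: default_measure_display. Qed.

Section rV_measurable.
Context {R : realType} (n : nat).

Let coord (i : 'I_n) (x : 'rV[R]_n) : R := x 0 i.

Let rV_set0 : g_sigma_preimage coord set0.
Proof. exact: sigma_algebra0. Qed.

Let rV_setC A : g_sigma_preimage coord A -> g_sigma_preimage coord (~` A).
Proof. exact: sigma_algebraC. Qed.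

Let rV_bigcup (F : _^nat) : (forall i, g_sigma_preimage coord (F i)) ->
  g_sigma_preimage coord (\bigcup_i (F i)).
Proof. exact: sigma_algebra_bigcup. Qed.

(* The product sigma-algebra, i.e. the Borel one. *)
HB.instance Definition _ := @isMeasurable.Build rV_display
  'rV[R]_n (g_sigma_preimage coord) rV_set0 rV_setC rV_bigcup.

Lemma measurable_rV_coord (i : 'I_n) :
  measurable_fun [set: 'rV[R]_n] (fun x : 'rV[R]_n => x 0 i).
Proof.
move=> _ Y mY; rewrite setTI; apply: sub_sigma_algebra => /=.
rewrite -bigcup_seq/=; exists i => /=; first by rewrite mem_index_enum.
by exists Y => //; rewrite setTI.
Qed.

Lemma measurable_fun_rV d (T : measurableType d) (f : T -> 'rV[R]_n) :
  (forall i, measurable_fun [set: T] (fun x => f x 0 i)) ->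
  measurable_fun [set: T] f.
Proof.
move=> mf _ A mA; rewrite setTI.
have : g_sigma_preimage (fun i => coord i \o f) (f @^-1` A).
  by rewrite g_sigma_preimage_comp; exists A => //; rewrite setTI.
rewrite /g_sigma_preimage; apply: smallest_sub.
  exact: sigma_algebra_measurable.
rewrite -bigcup_seq => B -[i _] [C mC <-].
exact: mf.
Qed.

End rV_measurable.

Section lebesgue_rV.
Context {R : realType}.

Definition rV_cons n (p : R * 'rV[R]_n) : 'rV[R]_n.+1 :=
  row_mx (p.1)%:M p.2.

Definition rV_uncons n (x : 'rV[R]_n.+1) : R * 'rV[R]_n :=
  (x 0 0, \row_i x 0 (lift 0 i)).

Lemma rV_consK n : cancel (@rV_cons n) (@rV_uncons n).
Proof.
move=> [a x]; congr pair.
  rewrite -[LHS]/(row_mx a%:M x 0 _) (_ : 0 = lshift n (0 : 'I_1)).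
    by rewrite row_mxEl mxE.
  exact/val_inj.
apply/rowP => i; rewrite mxE -[LHS]/(row_mx a%:M x 0 _).
rewrite (_ : lift 0 i = rshift 1 i) ?row_mxEr//.
exact/val_inj.
Qed.

Lemma measurable_rV_cons n : measurable_fun setT (@rV_cons n).
Proof.
apply: measurable_fun_rV => i; case: (@split_ordP 1 n i) => j ->.
  rewrite [X in measurable_fun _ X](_ : _ = fst); first exact: measurable_fst.
  apply/funext => -[a x]; rewrite -[LHS]/(row_mx a%:M x 0 _).
  by rewrite row_mxEl mxE (ord1 j).
rewrite [X in measurable_fun _ X](_ : _ = (fun x : 'rV_n => x 0 j) \o snd).
  exact: (measurableT_comp (measurable_rV_coord j) measurable_snd).
apply/funext => -[a x]; rewrite -[LHS]/(row_mx a%:M x 0 _).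
by rewrite row_mxEr.
Qed.

Lemma measurable_rV_uncons n : measurable_fun setT (@rV_uncons n).
Proof.
apply: measurable_fun_pair; first exact: measurable_rV_coord.
apply: measurable_fun_rV => i; under eq_fun do rewrite mxE.
exact: measurable_rV_coord.
Qed.

Section lebesgue_step.
Variables (n : nat) (m : {sigma_finite_measure set 'rV[R]_n -> \bar R}).

Definition lebesgue_step : set 'rV[R]_n.+1 -> \bar R :=
  pushforward (lebesgue_measure \x m)%E (@rV_cons n).

Let lebesgue_step0 : lebesgue_step set0 = 0%E.
Proof. by rewrite /lebesgue_step /pushforward preimage_set0 measure0. Qed.

Let lebesgue_step_ge0 A : (0 <= lebesgue_step A)%E.
Proof. by rewrite /lebesgue_step /pushforward measure_ge0. Qed.

Let mcons A : measurable A -> measurable (@rV_cons n @^-1` A).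
Proof.
by move=> mA; rewrite -[X in measurable X]setTI; exact: measurable_rV_cons.
Qed.

Let lebesgue_step_sigma_additive : semi_sigma_additive lebesgue_step.
Proof.
move=> F mF tF mUF; rewrite /lebesgue_step /pushforward preimage_bigcup.
apply: measure_semi_sigma_additive.
- by move=> k; exact: mcons.
- apply/trivIsetP => /= i j _ _ ij; rewrite -preimage_setI.
  by move/trivIsetP : tF => /(_ _ _ _ _ ij) ->//; rewrite preimage_set0.
- by rewrite -preimage_bigcup; exact: mcons.
Qed.

HB.instance Definition _ := isMeasure.Build _ _ _ lebesgue_step
  lebesgue_step0 lebesgue_step_ge0 lebesgue_step_sigma_additive.

Let lebesgue_step_sigma_finite : sigma_finite setT lebesgue_step.
Proof.
have /sigma_finiteP[F [TF ndF Foo]] := sigma_finiteT (@lebesgue_measure R).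
have /sigma_finiteP[G [TG ndG Goo]] := sigma_finiteT m.
exists (fun k => @rV_uncons n @^-1` (F k `*` G k)).
  rewrite -preimage_bigcup (_ : \bigcup_k _ = setT) ?preimage_setT//.
  apply/seteqP; split => // -[x y] _.
  have [i _ Fix] : (\bigcup_k F k) x by rewrite -TF.
  have [j _ Gjy] : (\bigcup_k G k) y by rewrite -TG.
  exists (maxn i j) => //; split => /=.
    by move: x Fix; exact/subsetPset/ndF/leq_maxl.
  by move: y Gjy; exact/subsetPset/ndG/leq_maxr.
move=> k; have [mF Fk] := Foo k; have [mG Gk] := Goo k; split.
  rewrite -[X in measurable X]setTI; apply: measurable_rV_uncons => //.
  exact: measurableX.
rewrite /lebesgue_step /pushforward -comp_preimage.
rewrite (_ : @rV_uncons n \o @rV_cons n = id).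
  by rewrite preimage_id product_measure1E// lte_mul_pinfty// ge0_fin_numE.
by apply/funext => x /=; rewrite rV_consK.
Qed.

HB.instance Definition _ := Measure_isSigmaFinite.Build _ _ _ lebesgue_step
  lebesgue_step_sigma_finite.

End lebesgue_step.

Fixpoint borel_lebesgue n : {sigma_finite_measure set 'rV[R]_n -> \bar R} :=
  match n with
  | 0 => @dirac _ 'rV[R]_0 0 R
  | n'.+1 => lebesgue_step (borel_lebesgue n')
  end.

End lebesgue_rV.

(** Lebesgue measurable sets are the Caratheodory measurable ones, so that
    [leb d] is complete; [lebT R d] is ['rV[R]_d] with that sigma-algebra. *)
Definition lebT (R : realType) (d : nat) : measurableType _ :=
  caratheodory_type ((@borel_lebesgue R d)^*)%mu.

Definition leb (R : realType) (d : nat) : {measure set (lebT R d) -> \bar R} :=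
  @completed_measure_extension _ _ _ (@borel_lebesgue R d).

Section definitions.
Context {R : realType} {d : nat}.
Local Notation V := 'rV[R]_d.
Local Notation C := R[i].
Implicit Types (x y xi : V) (phi psi : V -> C) (K Om Gam Lam : set V).

Definition dotp x y : R := \sum_i x 0 i * y 0 i.

(* The norm carried by ['rV[R]_d] in the library is the sup norm. *)
Definition enorm x : R := Num.sqrt (dotp x x).

Record weight_assumptions (om : V -> R) : Prop := WeightAssumptions {
  om_measurable : measurable_fun [set: lebT R d] om ;
  om_ge0 : forall xi, 0 <= om xi ;
  om_even : forall xi, om (- xi) = om xi ;
  om0 : om 0 = 0 ;
  om_alpha : forall xi1 xi2, om (xi1 + xi2) <= om xi1 + om xi2 ;
  om_beta : (\int[leb R d]_(xi in [set xi : V | (1 < enorm xi)%R])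
     (om xi / enorm xi ^+ d.+1)%:E < +oo)%E ;
  om_gamma : exists a c : R, 0 < c /\
    forall xi, a + c * ln (1 + enorm xi) <= om xi ;
  om_alpha0 : exists w : R -> R,
    [/\ forall r, 0 <= r -> 0 <= w r,
        forall r s, 0 <= r -> r <= s -> w r <= w s &
        forall xi, om xi = w (enorm xi)] }.

Definition integrableC phi : Prop :=
  (leb R d).-integrable [set: lebT R d] (fun x => (complex.Re (phi x))%:E) /\
  (leb R d).-integrable [set: lebT R d] (fun x => (complex.Im (phi x))%:E).

Definition integralC phi : C :=
  ((\int[leb R d]_x complex.Re (phi x)) +i* (\int[leb R d]_x complex.Im (phi x)))%C.

(* exp (- 2 pi i xi . x) *)
Definition fchar xi x : C :=
  (cos (2 * pi * dotp xi x) -i* sin (2 * pi * dotp xi x))%C.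

Definition fourier phi xi : C := integralC (fun x => phi x * fchar xi x).

Definition lnorm (om : V -> R) (lam : R) phi : \bar R :=
  ereal_sup [set (normc (fourier phi xi) * expR (lam * om xi))%:E | xi in setT].

Definition Dlambda (om : V -> R) (lam : R) K : set (V -> C) :=
  [set phi | [/\ integrableC phi, closure [set x | phi x != 0] `<=` K &
                 (lnorm om lam phi < +oo)%E]].

(* The elements of the projective limit are L^1 classes; by assumption gamma
   each of them has an integrable Fourier transform, hence a unique continuous
   representative, which is the one that is evaluated and multiplied. *)
Definition DK (om : V -> R) K : set (V -> C) :=
  [set phi | continuous (phi : V -> C^o) /\
             forall lam, 0 < lam -> Dlambda om lam K phi].

Definition testfun (om : V -> R) Om : set (V -> C) :=
  [set phi | exists K, [/\ compact K, K `<=` Om & DK om K phi]].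

(* The basic 0-neighbourhoods of the locally convex inductive limit: the
   absolutely convex sets that meet every step [DK om K] in a
   0-neighbourhood. The seminorms of [DK om K] increase with [lam], so a single
   one bounds a 0-neighbourhood of the projective limit. *)
Definition testfun_nbhs0 (om : V -> R) Om (W : set (V -> C)) : Prop :=
  [/\ W `<=` testfun om Om,
      forall phi psi (a b : C), W phi -> W psi -> normc a + normc b <= 1 ->
        W (fun x => a * phi x + b * psi x) &
      forall K, compact K -> K `<=` Om ->
        exists lam e : R, [/\ 0 < lam, 0 < e &
          forall phi, DK om K phi -> (lnorm om lam phi < e%:E)%E -> W phi]].

(* Functionals are total functions; only their values on [testfun om Om]
   matter. *)
Definition ultradistribution (om : V -> R) Om (f : (V -> C) -> C) : Prop :=
  (forall phi psi (a b : C), testfun om Om phi -> testfun om Om psi ->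
     f (fun x => a * phi x + b * psi x) = a * f phi + b * f psi) /\
  (forall e : R, 0 < e -> exists2 W, testfun_nbhs0 om Om W &
     forall phi, W phi -> normc (f phi) < e).

(* The product [phi f] as a functional on the multipliers of the space of test
   functions: for such a multiplier [psi], [phi psi] is a test function. *)
Definition mulD phi (f : (V -> C) -> C) : (V -> C) -> C :=
  fun psi => f (fun x => phi x * psi x).

Definition fourierD (g : (V -> C) -> C) xi : C := g (fchar xi).

Definition moderate_weight (om v : V -> R) : Prop :=
  [/\ measurable_fun [set: lebT R d] v,
      forall xi, 0 <= v xi &
      exists c lam : R, [/\ 0 < c, 0 < lam &
        forall xi1 xi2, v (xi1 + xi2) <= c * v xi1 * expR (lam * om xi2)]].

Definition lattice Lam : Prop :=
  [/\ Lam 0 /\ (forall x y, Lam x -> Lam y -> Lam (x - y)),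
      Lam `<=` isolated Lam &
      forall x, exists m (B : 'M[R]_(m, d)),
        (forall i, Lam (row i B)) /\ (x <= B)%MS].

Definition dual_lattice Lam : set V :=
  [set y | forall x, Lam x -> dotp x y \is a Num.int].

Definition open_conic_nbhd xi0 Gam : Prop :=
  [/\ open Gam, ~ Gam 0, Gam xi0 &
      forall (t : R) xi, 0 < t -> Gam xi -> Gam (t *: xi)].

(* Norms of [c * v] restricted to a set, as norms of its extension by zero. *)
Definition LqNorm (q : \bar R) (v : V -> R) Gam (c : V -> C) : \bar R :=
  Lnorm (leb R d) q ((fun xi : V => (normc (c xi) * v xi)%:E) \_ Gam).

Definition lqNorm (q : \bar R) (v : V -> R) (I : set V) (c : V -> C) : \bar R :=
  Lnorm (@counting V R) q ((fun mu : V => (normc (c mu) * v mu)%:E) \_ I).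

Definition microlocally_regular (om : V -> R) Om (q : \bar R) (v : V -> R)
    (f : (V -> C) -> C) x0 xi0 : Prop :=
  exists Gam phi,
    [/\ open_conic_nbhd xi0 Gam, testfun om Om phi, phi x0 != 0 &
        (LqNorm q v Gam (fourierD (mulD phi f)) < +oo)%E].

End definitions.

(* Main.v *)
From HB Require Import structures.
Require Import Defs.
From mathcomp Require Import all_boot all_order all_algebra.
From mathcomp Require Import complex ring lra zify.
From mathcomp Require Import all_classical all_reals all_analysis.
From mathcomp Require Import measurable_realfun ess_sup_inf.

Import Order.TTheory GRing.Theory Num.Theory.
Import numFieldNormedType.Exports.
Import ComplexField.Normc.

Local Open Scope classical_set_scope.
Local Open Scope ring_scope.

Set Implicit Arguments.
Unset Strict Implicit.
Unset Printing Implicit Defensive.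

(** For a lattice P with basis B, whose rows are b_1, ..., b_d, the functions
    prod_j cos(pi b_j . y)^(2n) are nonnegative, have their frequencies in P
    and, once normalised, tend to the Dirac comb of the dual lattice of P. Hence,
    if no x in supp phi and y in supp chi differ by a nonzero dual vector, the
    transform of phi chi f at xi is a limit of sums over p in P of
    chi^(xi - p) (phi f)^(p) with bounded nonnegative weights, and likewise for
    the translates P + eta. For xi in a smaller cone the p outside the given cone
    satisfy |xi|, |p| <= M |xi - p|, so by the decay of chi^ they contribute at
    most a multiple of (1 + |xi|)^(-2d). The samples inside the cone are
    multiplied by at most a multiple of (1 + |xi - p|)^(-2d), which is summable
    in p and integrable in xi; this compares l^q norms with L^q norms.

    From (i) to (ii), P is the given lattice and the hypothesis on U separates
    supp phi from a small ball around x0. From (ii) to (i), P is a translate by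
    eta of a refinement of the given lattice, and averaging over eta yields an
    eta for which the samples on P are in l^q. The cutoff chi near x0 is made
    from phi itself, so that no existence theorem for test functions is needed. *)

(** * Lebesgue measure on row vectors *)

(** The functional [f] accepts test functions only, so infinite sums of characters cannot be
    inserted into it. Trigonometric polynomials give finite sums, through which [f] passes by
    linearity, and leave one limit to be taken inside [f]. There, dominated pointwise convergence
    makes the transforms converge uniformly, and interpolating this with decay bounds uniform along
    the sequence gives convergence of the values of [f]. The same expansion shows that a product of
    two test functions is a test function, with a lattice so fine that its dual separates the two
    supports. The power n is taken to be a square m^2: the coefficients are then at most m^-d, the
    mass of the kernel near 0 is at least of order m^-d, and the normalised weights stay bounded.
    All exponents q are handled at once, because the estimate in the cone bounds the transform by a
    weighted supremum of samples. For weights in [0, 1] the r-th power of such a supremum is at most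
    the weighted sum of r-th powers. In the second implication the lattice is refined because [phi]
    may have any compact support in [Om], and translated because an L^q bound says nothing about the
    values at prescribed points. *)

Section shift.
Context {R : realType}.

Lemma lebesgue_measure_shift (a : R) (A : set R) : measurable A ->
  lebesgue_measure ((fun x => x + a) @^-1` A) = lebesgue_measure A.
Proof.
move=> mA; have ma : measurable_fun [set: R] (fun x : R => x + a).
  exact: measurable_funD.
pose f : measurableTypeR R -> measurableTypeR R := fun x => x + a.
have mf : measurable_fun setT f by exact: ma.
pose mu : {measure set (measurableTypeR R) -> \bar R} :=
  measure_function_pushforward__canonical__measure_function_Measure lebesgue_measure mf.
apply/esym/(@lebesgue_measure_unique R mu) => //= _ [[x y]] _ <-.
rewrite /pushforward (_ : _ @^-1` _ = `]x - a, y - a]%classic).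
  rewrite !lebesgue_measure_itv/= !lte_fin ltrD2r; case: ifPn => // _.
  by rewrite -!EFinD; congr EFin; ring.
by apply/seteqP; split => z /=; rewrite !in_itv/= ltrBlDr lerBrDr.
Qed.

Lemma rV_consD n (p q : R * 'rV[R]_n) :
  rV_cons p + rV_cons q = rV_cons (p.1 + q.1, p.2 + q.2).
Proof.
rewrite /rV_cons /= raddfD/=; exact: (@add_row_mx _ 1 1 n).
Qed.

Lemma rV_unconsK n : cancel (@rV_uncons R n) (@rV_cons R n).
Proof.
move=> x; apply/rowP => i; rewrite /rV_cons /rV_uncons /=.
case: (@split_ordP 1 n i) => j ->.
  rewrite -[LHS]/(row_mx _ _ 0 _) row_mxEl mxE (ord1 j) mulr1n.
  by congr (x _ _); exact/val_inj.
rewrite -[LHS]/(row_mx _ _ 0 _) row_mxEr mxE.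
by congr (x _ _); exact/val_inj.
Qed.

Lemma measurable_rV_shift n (a : 'rV[R]_n) :
  measurable_fun [set: 'rV[R]_n] (fun x : 'rV[R]_n => x + a).
Proof.
apply: measurable_fun_rV => i; under eq_fun do rewrite mxE.
by apply: measurable_funD => //; exact: measurable_rV_coord.
Qed.

(** Induction on the dimension: a product measure is determined by its values on rectangles, and a
    translation acts on the two factors separately. *)
Lemma borel_lebesgue_shift n (a : 'rV[R]_n) (A : set 'rV[R]_n) :
  measurable A ->
  borel_lebesgue n ((fun x => x + a) @^-1` A) = borel_lebesgue n A.
Proof.
elim: n a A => [|n IH] a A mA.
  by congr (borel_lebesgue 0 _); apply/seteqP; split => x /=;
    rewrite (thinmx0 (x + a)) (thinmx0 x).
have mcons (B : set 'rV[R]_n.+1) : measurable B ->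
    measurable (@rV_cons R n @^-1` B).
  by move=> mB; rewrite -[X in measurable X]setTI; exact: measurable_rV_cons.
pose m : {sigma_finite_measure set 'rV[R]_n -> \bar R} := borel_lebesgue n.
pose b := rV_uncons a.
pose t (p : measurableTypeR R * 'rV[R]_n) : measurableTypeR R * 'rV[R]_n :=
  (p.1 + b.1, p.2 + b.2).
have mt : measurable_fun setT t.
  apply: measurable_fun_pair => /=.
    by apply: measurable_funD => //; exact: measurable_fst.
  exact: (measurableT_comp (@measurable_rV_shift n _) measurable_snd).
rewrite -[LHS]/((lebesgue_measure \x m)%E (@rV_cons R n @^-1` _)).
rewrite -[RHS]/((lebesgue_measure \x m)%E (@rV_cons R n @^-1` A)).
rewrite -comp_preimage.
have -> : (fun x => x + a) \o (@rV_cons R n) = @rV_cons R n \o t.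
  by apply/funext => p /=; rewrite -{1}(rV_unconsK a) rV_consD.
rewrite comp_preimage.
pose mu : {measure set _ -> \bar R} :=
  measure_function_pushforward__canonical__measure_function_Measure
    (lebesgue_measure \x m)%E mt.
apply/esym/(@product_measure_unique _ _ _ _ _ lebesgue_measure m mu) => //;
  last exact: mcons.
move=> X Y mX mY.
have mX' : measurable ((fun x : measurableTypeR R => x + b.1) @^-1` X).
  by rewrite -[X in measurable X]setTI; apply: measurable_funD.
have mY' : measurable ((fun x : 'rV[R]_n => x + b.2) @^-1` Y).
  by rewrite -[X in measurable X]setTI; apply: measurable_rV_shift.
transitivity ((lebesgue_measure \x m)%E
  (((fun x : measurableTypeR R => x + b.1) @^-1` X) `*`
   ((fun x => x + b.2) @^-1` Y))).
  by [].
rewrite product_measure1E//; congr (_ * _)%E.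
  exact: lebesgue_measure_shift.
exact: IH.
Qed.

End shift.

Lemma integral_measure_preserving d (T : measurableType d) (R : realType)
    (mu : {measure set T -> \bar R}) (t : T -> T) :
  measurable_fun setT t ->
  (forall A, measurable A -> mu (t @^-1` A) = mu A) ->
  forall f : T -> \bar R, measurable_fun setT f ->
  (\int[mu]_x f (t x) = \int[mu]_x f x)%E.
Proof.
move=> mt tmu; have ge0 (g : T -> \bar R) : measurable_fun setT g ->
    (forall x, 0 <= g x)%E -> (\int[mu]_x g (t x) = \int[mu]_x g x)%E.
  move=> mg g0; transitivity (\int[mu]_(x in t @^-1` setT) (g \o t) x)%E => //.
  rewrite -ge0_integral_pushforward//; apply: eq_measure_integral => //= A mA _.
  exact: tmu.
move=> f mf; rewrite integralE [RHS]integralE; congr (_ - _)%E.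
  rewrite -(ge0 _ (measurable_funepos mf))//.
  by apply: eq_integral => x _; rewrite !funeposE.
rewrite -(ge0 _ (measurable_funeneg mf))//.
by apply: eq_integral => x _; rewrite !funenegE.
Qed.

Section leb_shift.
Context {R : realType} (n : nat).
Local Notation V := 'rV[R]_n.
Local Open Scope measure_scope.

Lemma preimage_shiftK (a : V) (A : set V) :
  (fun x => x + a) @^-1` ((fun x => x - a) @^-1` A) = A.
Proof. by apply/seteqP; split => x /=; rewrite addrK. Qed.

(** Covers of a set by measurable sets can be translated. All sets are needed here, since
    Caratheodory measurability of a translate is tested against arbitrary sets. *)
Lemma mu_ext_shift (a : V) (A : set V) :
  (@borel_lebesgue R n)^* ((fun x => x + a) @^-1` A) =
  (@borel_lebesgue R n)^* A.
Proof.
have le (b : V) (B : set V) : ((@borel_lebesgue R n)^* ((fun x => (x + b)%R) @^-1` B) <=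
    (@borel_lebesgue R n)^* B)%E.
  apply: le_ereal_inf_tmp => _ [F [mF BF] <-].
  apply: ereal_inf_lbound; exists (fun k => (fun x => x + b) @^-1` F k).
    split=> [k|x /BF[k _ Fk]]; last by exists k.
    by rewrite -[X in measurable X]setTI; exact: measurable_rV_shift.
  by apply: eq_eseriesr => k _; exact: borel_lebesgue_shift.
apply/eqP; rewrite eq_le le/= -{1}(preimage_shiftK (- a) A) opprK.
exact: le.
Qed.

Lemma measurable_leb_shift (a : V) :
  measurable_fun [set: lebT R n] ((fun x : V => x + a) : lebT R n -> lebT R n).
Proof.
move=> _ A mA; rewrite setTI.
have cA : caratheodory_measurable ((@borel_lebesgue R n)^*) A := mA.
suff : caratheodory_measurable ((@borel_lebesgue R n)^*)
  ((fun x : V => x + a) @^-1` A) by [].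
move=> X; rewrite -(mu_ext_shift (- a) X) cA.
have e Y : (fun x : V => x - a) @^-1` (X `&` ((fun x : V => x + a) @^-1` Y)) =
    ((fun x : V => x - a) @^-1` X) `&` Y.
  by apply/seteqP; split => x /=; rewrite subrK.
by rewrite -!e !mu_ext_shift.
Qed.

Lemma leb_shift (a : V) (A : set V) :
  leb R n ((fun x => x + a) @^-1` A) = leb R n A.
Proof. exact: mu_ext_shift. Qed.

Lemma integral_leb_shift (a : V) (f : lebT R n -> \bar R) :
  measurable_fun setT f ->
  (\int[leb R n]_x f (x + a)%R = \int[leb R n]_x f x)%E.
Proof.
exact: (@integral_measure_preserving _ _ R (leb R n) _
  (measurable_leb_shift a) (fun A _ => leb_shift a A) f).
Qed.

End leb_shift.

Section boxes.
Context {R : realType}.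

Lemma rV_norm_ler n (x : 'rV[R]_n) (s : R) : 0 <= s ->
  (`|x| <= s) <-> (forall i, `|x 0 i| <= s).
Proof.
move=> s0; rewrite [`|x|]/Num.norm/= mx_normrE; split.
  by move=> /bigmax_leP[_ h] i; exact: (h (0, i) isT).
by move=> h; apply/bigmax_leP; split => // -[j i] _ /=; rewrite (ord1 j).
Qed.

Lemma rV_norm_ltr n (x : 'rV[R]_n) (s : R) : 0 < s ->
  (`|x| < s) <-> (forall i, `|x 0 i| < s).
Proof.
move=> s0; rewrite [`|x|]/Num.norm/= mx_normrE; split.
  by move=> /bigmax_ltP[_ h] i; exact: (h (0, i) isT).
by move=> h; apply/bigmax_ltP; split => // -[j i] _ /=; rewrite (ord1 j).
Qed.

Lemma rV_norm_coord n (x : 'rV[R]_n) i : `|x 0 i| <= `|x|.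
Proof. by move: i; apply/rV_norm_ler. Qed.

(** Balls of the sup norm are cubes of side 2s, hence products of a one-dimensional ball and a
    lower-dimensional cube. *)
Lemma borel_lebesgue_ball n (c : 'rV[R]_n) (s : R) : 0 < s ->
  borel_lebesgue n [set x | `|x - c| < s] = ((s *+ 2) ^+ n)%:E.
Proof.
move=> s0; elim: n c => [|n IH] c.
  rewrite /= diracE mem_set ?expr0//=.
  by apply/rV_norm_ltr => // -[].
pose m : {sigma_finite_measure set 'rV[R]_n -> \bar R} := borel_lebesgue n.
transitivity ((lebesgue_measure \x m)%E
  ((ball (c 0 0) s : set (measurableTypeR R)) `*`
   [set x | `|x - (rV_uncons c).2| < s])).
  congr (lebesgue_measure \x m)%E; apply/seteqP; split => -[a x].
    move=> h0; have /(rV_norm_ltr _ s0) h : `|rV_cons (a, x) - c| < s := h0.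
    split => /=.
      have := h 0; rewrite !mxE distrC; case: splitP => // j _.
      by rewrite (ord1 j) mxE eqxx mulr1n.
    apply/(rV_norm_ltr _ s0) => i; have := h (lift 0 i); rewrite !mxE.
    case: splitP => [j|j /= /eqP]; first by rewrite (ord1 j).
    by rewrite /bump/= add1n => /eqP[/val_inj ->].
  move=> [/= ha /(rV_norm_ltr _ s0) hx].
  suff : `|rV_cons (a, x) - c| < s by [].
  apply/(rV_norm_ltr _ s0) => i; rewrite !mxE.
  case: splitP => j ij.
    rewrite (ord1 j) mxE eqxx mulr1n distrC (_ : i = 0)//.
    by apply/val_inj; rewrite /= ij (ord1 j).
  by have := hx j; rewrite !mxE (_ : lift 0 j = i)//; exact/val_inj.
have mb : measurable ([set x | `|x - (rV_uncons c).2| < s] : set 'rV[R]_n).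
  rewrite (_ : [set x | _] = \bigcap_(i in [set: 'I_n])
     ((fun x : 'rV[R]_n => x 0 i) @^-1` ball ((rV_uncons c).2 0 i) s)).
    apply: fin_bigcap_measurable => // i _; rewrite -[X in measurable X]setTI.
    by apply: measurable_rV_coord => //; exact: measurable_ball.
  apply/seteqP; split => x /=.
    move=> /(rV_norm_ltr _ s0) h i _; have := h i.
    by rewrite !mxE /= /ball/= distrC.
  move=> h; apply/(rV_norm_ltr _ s0) => i; have := h i I.
  by rewrite !mxE /= /ball/= distrC.
rewrite product_measure1E//; last exact: measurable_ball.
rewrite exprS EFinM; congr (_ * _)%E; last exact: IH.
exact: (lebesgue_measure_ball _ (ltW s0)).
Qed.

End boxes.

(** * Complex-valued integrals *)

Section complex_numbers.
Context {R : realType}.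
Implicit Types z w : R[i].

Lemma normc_ge0 z : 0 <= normc z.
Proof. by case: z => a b; exact: sqrtr_ge0. Qed.

Lemma Re_le_normc z : `|complex.Re z| <= normc z.
Proof.
case: z => a b /=; rewrite -sqrtr_sqr ler_sqrt ?addr_ge0 ?sqr_ge0//.
by rewrite lerDl sqr_ge0.
Qed.

Lemma Im_le_normc z : `|complex.Im z| <= normc z.
Proof.
case: z => a b /=; rewrite -sqrtr_sqr ler_sqrt ?addr_ge0 ?sqr_ge0//.
by rewrite lerDr sqr_ge0.
Qed.

Lemma normc_le_ReIm z : normc z <= `|complex.Re z| + `|complex.Im z|.
Proof.
case: z => a b /=; rewrite -[leRHS]ger0_norm ?addr_ge0//.
rewrite -sqrtr_sqr ler_sqrt ?sqr_ge0// sqrrD !real_normK ?num_real//.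
by rewrite lerD2r lerDl mulrn_wge0// mulr_ge0.
Qed.

Lemma normc_real (r : R) : normc (r%:C)%C = `|r|.
Proof. by rewrite /= expr0n addr0 sqrtr_sqr. Qed.

Lemma normcB z w : normc (z - w) = normc (w - z).
Proof. by rewrite -normcN opprB. Qed.

Lemma normc_sum I (s : seq I) (P : pred I) (F : I -> R[i]) :
  normc (\sum_(i <- s | P i) F i) <= \sum_(i <- s | P i) normc (F i).
Proof.
elim/big_ind2 : _ => //; first by rewrite normc0.
by move=> z r w t zr wt; apply: le_trans (le_normcD _ _) _; exact: lerD.
Qed.

Lemma ReD z w : complex.Re (z + w) = complex.Re z + complex.Re w.
Proof. by case: z; case: w. Qed.

Lemma ImD z w : complex.Im (z + w) = complex.Im z + complex.Im w.
Proof. by case: z; case: w. Qed.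

Lemma ReM z w : complex.Re (z * w) =
  complex.Re z * complex.Re w - complex.Im z * complex.Im w.
Proof. by case: z; case: w. Qed.

Lemma ImM z w : complex.Im (z * w) =
  complex.Re z * complex.Im w + complex.Im z * complex.Re w.
Proof. by case: z => a b; case: w. Qed.

End complex_numbers.

Section complex_integral.
Context d (T : measurableType d) (R : realType).
Variable mu : {measure set T -> \bar R}.
Implicit Types (phi psi : T -> R[i]).

(** For the measure [leb R d], [cintegrable] and [cintegral] are convertible to [integrableC] and
    [integralC]. *)
Definition cintegrable phi : Prop :=
  mu.-integrable [set: T] (fun x => (complex.Re (phi x))%:E) /\
  mu.-integrable [set: T] (fun x => (complex.Im (phi x))%:E).

Definition cintegral phi : R[i] :=
  ((\int[mu]_x complex.Re (phi x)) +i* (\int[mu]_x complex.Im (phi x)))%C.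

Lemma cintegrableD phi psi : cintegrable phi -> cintegrable psi ->
  cintegrable (fun x => phi x + psi x).
Proof.
move=> [rp ip] [rq iq]; split.
  by under eq_fun do rewrite ReD EFinD; exact: integrableD.
by under eq_fun do rewrite ImD EFinD; exact: integrableD.
Qed.

Lemma cintegralD phi psi : cintegrable phi -> cintegrable psi ->
  cintegral (fun x => phi x + psi x) = cintegral phi + cintegral psi.
Proof.
move=> [rp ip] [rq iq]; apply/eqP; rewrite eq_complex ReD ImD /=.
rewrite -RintegralD// -RintegralD//.
by apply/andP; split; apply/eqP; apply: eq_Rintegral => x _;
  rewrite ?ReD ?ImD.
Qed.

Lemma cintegrableZ (c : R[i]) phi : cintegrable phi ->
  cintegrable (fun x => c * phi x).
Proof.
move=> [rp ip]; split.
  under eq_fun do rewrite ReM EFinB 2!EFinM.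
  by apply: integrableB => //; exact: integrableZl.
under eq_fun do rewrite ImM EFinD 2!EFinM.
by apply: integrableD => //; exact: integrableZl.
Qed.

Lemma cintegralZ (c : R[i]) phi : cintegrable phi ->
  cintegral (fun x => c * phi x) = c * cintegral phi.
Proof.
move=> [rp ip]; have iZ (k : R) (f : T -> R) :
    mu.-integrable [set: T] (EFin \o f) ->
    mu.-integrable [set: T] (EFin \o (fun x => k * f x)).
  by move=> fi; rewrite /comp; under eq_fun do rewrite EFinM; exact: integrableZl.
apply/eqP; rewrite eq_complex ReM ImM /=.
rewrite -!RintegralZl//; rewrite -RintegralB//; try exact: iZ.
rewrite -RintegralD//; try exact: iZ.
by apply/andP; split; apply/eqP; apply: eq_Rintegral => x _;
  rewrite ?ReM ?ImM.
Qed.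

Lemma cintegrable_sum I (s : seq I) (F : I -> T -> R[i]) :
  (forall i, cintegrable (F i)) -> cintegrable (fun x => \sum_(i <- s) F i x).
Proof.
move=> iF; elim: s => [|i s IH].
  by split; under eq_fun do rewrite big_nil; exact: integrable0.
under eq_fun do rewrite big_cons; exact: cintegrableD.
Qed.

Lemma cintegral_sum I (s : seq I) (F : I -> T -> R[i]) :
  (forall i, cintegrable (F i)) ->
  cintegral (fun x => \sum_(i <- s) F i x) = \sum_(i <- s) cintegral (F i).
Proof.
move=> iF; elim: s => [|i s IH].
  rewrite big_nil /cintegral; apply/eqP; rewrite eq_complex /=.
  have h : \int[mu]_(x in setT) (0 : R) = 0 by rewrite Rintegral_cst// mul0r.
  by rewrite -[in X in X && _]h -[in X in _ && X]h; apply/andP; split;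
    apply/eqP; apply: eq_Rintegral => x _; rewrite big_nil.
rewrite big_cons -IH -cintegralD//; last exact: cintegrable_sum.
by congr cintegral; apply/funext => x; rewrite big_cons.
Qed.

(** The factor 2 comes from bounding the real and imaginary parts separately. *)
Lemma normc_cintegral_le phi (G : T -> R) : cintegrable phi ->
  mu.-integrable [set: T] (EFin \o G) ->
  (forall x, normc (phi x) <= G x) ->
  normc (cintegral phi) <= 2 * \int[mu]_x G x.
Proof.
move=> [rp ip] iG pG; apply: le_trans (normc_le_ReIm _) _ => /=.
rewrite mulrDl !mul1r; apply: lerD.
  apply: le_trans (le_normr_Rintegral _ rp) _ => //.
  apply: le_Rintegral => //; first exact: integrable_norm rp.
  by move=> x _; exact: le_trans (Re_le_normc _) (pG x).
apply: le_trans (le_normr_Rintegral _ ip) _ => //.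
apply: le_Rintegral => //; first exact: integrable_norm ip.
by move=> x _; exact: le_trans (Im_le_normc _) (pG x).
Qed.

Lemma integrable_indic_fin (D : set T) : measurable D -> (mu D < +oo)%E ->
  mu.-integrable [set: T] (fun x => (\1_D x)%:E).
Proof.
move=> mD Dfin; apply/integrableP; split; first exact/measurable_EFinP.
under eq_integral do rewrite gee0_abs ?lee_fin//.
by rewrite integral_indic// setIT.
Qed.

Lemma integrable_bounded (F : T -> R) (D : set T) (M : R) :
  measurable D -> (mu D < +oo)%E -> measurable_fun setT F ->
  (forall x, `|F x| <= M * \1_D x) -> mu.-integrable [set: T] (EFin \o F).
Proof.
move=> mD Dfin mF FM.
apply: (@le_integrable _ _ _ mu setT measurableT _ (fun x => (M * \1_D x)%:E)).
- exact/measurable_EFinP.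
- by move=> x _ /=; rewrite lee_fin (le_trans (FM x))// ler_norm.
- by under eq_fun do rewrite EFinM; exact/integrableZl/integrable_indic_fin.
Qed.

Lemma Rintegral_cvg0 (G : nat -> T -> R) (D : set T) (M : R) :
  measurable D -> (mu D < +oo)%E -> (forall n, measurable_fun setT (G n)) ->
  (forall n x, 0 <= G n x <= M * \1_D x) ->
  (forall x, G ^~ x @ \oo --> (0 : R)) ->
  (fun n => \int[mu]_x G n x) @ \oo --> (0 : R).
Proof.
move=> mD Dfin mG G0 Gc.
have [|||||_ _] := @dominated_convergence _ _ _ mu setT measurableT
  (fun n x => (G n x)%:E) (cst 0%E) (fun x => (M * \1_D x)%:E).
- by move=> n; exact/measurable_EFinP.
- exact: measurable_cst.
- by apply: aeW => x _; apply/fine_cvgP; split;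
    [exact: nearW|exact: Gc].
- by under eq_fun do rewrite EFinM; exact/integrableZl/integrable_indic_fin.
- apply: aeW => x n _ /=; have /andP[h1 h2] := G0 n x.
  by rewrite lee_fin ger0_norm.
by rewrite integral0 => /fine_cvgP[_].
Qed.

End complex_integral.

(** * Open sets and continuous functions *)

Section rV_borel.
Context {R : realType} (n : nat).
Local Notation V := 'rV[R]_n.

Lemma open_ball_norm (A : set V) (x : V) : open A -> A x ->
  exists2 e : R, 0 < e & forall y, `|y - x| < e -> A y.
Proof.
move=> oA Ax.
have /nbhs_ballP[e /= e0 eA] : nbhs x A by exact: open_nbhs_nbhs.
by exists e => // y yx; apply: eA; rewrite -ball_normE /= distrC.
Qed.

Lemma openP_norm (A : set V) :
  (forall x, A x -> exists2 e : R, 0 < e & forall y, `|y - x| < e -> A y) ->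
  open A.
Proof.
move=> h; rewrite openE => x /h[e e0 eA]; apply/nbhs_ballP; exists e => // y.
by rewrite -ball_normE /= distrC => /eA.
Qed.

Lemma measurable_rV_ball (c : V) (s : R) :
  measurable ([set x : V | `|x - c| < s] : set V).
Proof.
have [s0|s0] := leP s 0.
  rewrite (_ : mkset _ = set0)//; apply/seteqP; split => // x /=.
  by rewrite ltNge (le_trans s0).
rewrite (_ : [set x | _] = \bigcap_(i in [set: 'I_n])
   ((fun x : V => x 0 i) @^-1` ball (c 0 i) s)).
  apply: fin_bigcap_measurable => // i _; rewrite -[X in measurable X]setTI.
  by apply: measurable_rV_coord => //; exact: measurable_ball.
apply/seteqP; split => x /=.
  move=> /(rV_norm_ltr _ s0) h i _; have := h i.
  by rewrite !mxE /= /ball/= distrC.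
move=> h; apply/(rV_norm_ltr _ s0) => i; have := h i I.
by rewrite !mxE /= /ball/= distrC.
Qed.

(* Boxes centred at the points of the grids (k + 1)^-1 Z^n form a countable
   base of the topology. *)
Lemma open_measurable_rV (A : set V) : open A -> measurable (A : set V).
Proof.
move=> oA; pose c (p : nat * 'rV[int]_n) : V :=
  p.1.+1%:R^-1 *: map_mx intr p.2.
pose r (p : nat * 'rV[int]_n) : R := 2 / p.1.+1%:R.
pose B p : set V := [set x | `|x - c p| < r p].
pose F p := if `[< B p `<=` A >] then B p else set0.
rewrite (_ : A = \bigcup_p F p).
  apply: countable_bigcupT_measurable => //.
  move=> p; rewrite /F; case: ifPn => _; last exact: measurable0.
  exact: measurable_rV_ball.
apply/seteqP; split => x; last first.
  by move=> [p _]; rewrite /F; case: asboolP => // BA /BA.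
move=> Ax; have [e e0 eA] := open_ball_norm oA Ax.
pose k := Num.truncn (4 / e).
have ke : 4 / k.+1%:R < e.
  by rewrite ltr_pdivrMr// mulrC -ltr_pdivrMr// truncnS_gt.
pose q : 'rV[int]_n := \row_i Num.floor (x 0 i * k.+1%:R).
have k0 : 0 < k.+1%:R :> R by rewrite ltr0n.
have xq : `|x - c (k, q)| <= k.+1%:R^-1.
  apply/rV_norm_ler; first by rewrite invr_ge0 ltW.
  move=> i; rewrite !mxE /=; set fl := Num.floor _.
  have -> : x 0 i - k.+1%:R^-1 * fl%:~R = k.+1%:R^-1 * (x 0 i * k.+1%:R - fl%:~R).
    by rewrite mulrBr mulrCA mulVf ?mulr1// lt0r_neq0.
  have f1 : fl%:~R <= x 0 i * k.+1%:R by exact: floor_le.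
  have f2 : x 0 i * k.+1%:R < (fl + 1)%:~R by exact: floorD1_gt.
  rewrite normrM ger0_norm ?invr_ge0 ?(ltW k0)// ler_piMr ?invr_ge0 ?(ltW k0)//.
  by rewrite ger0_norm ?subr_ge0// lerBlDl -[X in _ + X]/(1%:~R) -intrD ltW.
exists (k, q) => //; rewrite /F asboolT; last first.
  move=> y; rewrite /B /r /= => yq; apply: eA.
  apply: le_lt_trans ke; rewrite -(subrKA (c (k, q))).
  apply: le_trans (ler_normD _ _) _; rewrite [X in _ + X]distrC.
  apply: (le_trans (lerD (ltW yq) xq)).
  by rewrite -[X in _ + X]mul1r -mulrDl ler_pM2r ?invr_gt0//; lra.
by rewrite /B /r /=; apply: le_lt_trans xq _; rewrite ltr_pMl ?invr_gt0// ltr1n.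
Qed.

Lemma borel_leb_measurable (A : set V) :
  measurable (A : set V) -> measurable (A : set (lebT R n)).
Proof. exact: caratheodory_measurable_mu_ext. Qed.

Lemma leb_borelE (A : set V) : measurable (A : set V) ->
  leb R n A = borel_lebesgue n A.
Proof. exact: measurable_mu_extE. Qed.

Lemma open_leb_measurable (A : set V) :
  open A -> measurable (A : set (lebT R n)).
Proof. by move=> /open_measurable_rV/borel_leb_measurable. Qed.

Lemma continuous_borel (F : V -> R) : continuous F -> measurable_fun setT F.
Proof.
move=> cF; apply: (measurability _ (RGenOInfty.measurableE R)) => //.
move=> _ [_ [a ->] <-]; rewrite setTI; apply: open_measurable_rV.
by apply: open_comp => // x _; exact: cF.
Qed.

Lemma continuous_leb (F : V -> R) : continuous F ->
  measurable_fun [set: lebT R n] (F : lebT R n -> R).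
Proof.
move=> /continuous_borel mF _ A mA.
by apply: borel_leb_measurable; exact: mF.
Qed.

Lemma leb_ball (c : V) (s : R) : 0 < s ->
  leb R n [set x | `|x - c| < s] = ((s *+ 2) ^+ n)%:E.
Proof.
move=> s0; rewrite leb_borelE; first exact: borel_lebesgue_ball.
exact: measurable_rV_ball.
Qed.

Lemma leb_ball_measurable (c : V) (s : R) :
  measurable ([set x : V | `|x - c| < s] : set (lebT R n)).
Proof. by apply: borel_leb_measurable; exact: measurable_rV_ball. Qed.

Lemma leb_ball0 (s : R) : 0 < s ->
  leb R n [set x | `|x| < s] = ((s *+ 2) ^+ n)%:E.
Proof. by move=> /(leb_ball 0); under eq_set do rewrite subr0. Qed.

Lemma leb_ball0_measurable (s : R) :
  measurable ([set x : V | `|x| < s] : set (lebT R n)).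
Proof. by have := leb_ball_measurable 0 s; under eq_set do rewrite subr0. Qed.

Lemma leb_ball0_fin (s : R) : 0 < s -> (leb R n [set x | (`|x| < s)%R] < +oo)%E.
Proof. by move=> s0; rewrite leb_ball0// ltry. Qed.

Lemma compact_norm_bounded (K : set V) : compact K ->
  exists2 r : R, 0 < r & forall x, K x -> `|x| < r.
Proof.
move=> /compact_bounded[M [_ hM]]; exists (`|M| + 2) => [|x Kx].
  by rewrite ltr_wpDl.
apply: (@le_lt_trans _ _ (`|M| + 1)); last by rewrite ltrD2l ltr1n.
by apply: hM => //; rewrite (le_lt_trans (ler_norm M))// ltrDl.
Qed.

(** Continuity into [R[i]^o] in real terms: the norm of that space takes values in the partially
    ordered [R[i]], whereas [normc] is real. *)
Definition ccont (phi : V -> R[i]) := forall x (e : R), 0 < e ->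
  exists2 r : R, 0 < r & forall y, `|y - x| < r -> normc (phi y - phi x) < e.

Lemma ccontP (phi : V -> R[i]) : continuous (phi : V -> R[i]^o) <-> ccont phi.
Proof.
split=> [cphi x e e0|cphi x].
  have /cvgrPdist_lt/(_ (e%:C)%C) := cphi x.
  rewrite ltcR => /(_ e0)/nbhs_ballP[r /= r0 hr]; exists r => // y yx.
  have := hr y; rewrite -ball_normE /= distrC => /(_ yx).
  by rewrite [`|_|]/Num.norm/= ltcR normcB.
apply/cvgrPdist_lt; first exact: (@nbhs_filter V x).
move=> -[e1 e2]; rewrite ltcE /= => /andP[/eqP -> e0].
have [r r0 hr] := cphi x _ e0.
apply: (@filterS V (nbhs x) _ (ball x r)); last exact: nbhsx_ballx.
move=> y.
rewrite -ball_normE /= distrC => /hr.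
by rewrite [`|_|]/Num.norm/= ltcE /= eqxx normcB.
Qed.

Lemma realcontP (F : V -> R) : (forall x (e : R), 0 < e ->
  exists2 r : R, 0 < r & forall y, `|y - x| < r -> `|F y - F x| < e) ->
  continuous F.
Proof.
move=> h x; apply/cvgrPdist_lt; first exact: (@nbhs_filter V x).
move=> e e0; have [r r0 hr] := h x e e0.
apply: (@filterS V (nbhs x) _ (ball x r)); last exact: nbhsx_ballx.
by move=> y; rewrite -ball_normE /= distrC => /hr; rewrite distrC.
Qed.

Lemma ccont_Re phi : ccont phi -> continuous (fun x => complex.Re (phi x)).
Proof.
move=> cphi; apply: realcontP => x e e0; have [r r0 hr] := cphi x e e0.
exists r => // y /hr; apply: le_lt_trans; apply: le_trans (Re_le_normc _).
by case: (phi y) (phi x) => [a b] [c d].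
Qed.

Lemma ccont_Im phi : ccont phi -> continuous (fun x => complex.Im (phi x)).
Proof.
move=> cphi; apply: realcontP => x e e0; have [r r0 hr] := cphi x e e0.
exists r => // y /hr; apply: le_lt_trans; apply: le_trans (Im_le_normc _).
by case: (phi y) (phi x) => [a b] [c d].
Qed.

Lemma ler_dist_normc (z w : R[i]) : `|normc z - normc w| <= normc (z - w).
Proof.
rewrite ler_norml lerBrDr lerBlDr; apply/andP; split.
  rewrite addrC lerBlDr -normcB -{1}(subrK z w) addrC.
  exact: le_normcD.
by rewrite -{1}(subrK w z); exact: le_normcD.
Qed.

Lemma ccont_normc phi : ccont phi -> continuous (fun x => normc (phi x)).
Proof.
move=> cphi; apply: realcontP => x e e0; have [r r0 hr] := cphi x e e0.
by exists r => // y /hr; apply: le_lt_trans; exact: ler_dist_normc.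
Qed.

Lemma ccont_cst c : ccont (fun=> c).
Proof. by move=> x e e0; exists 1 => // y _; rewrite subrr normc0. Qed.

Lemma ccontD phi psi : ccont phi -> ccont psi ->
  ccont (fun x => phi x + psi x).
Proof.
move=> cp cq x e e0; have [e2 e20] : {e2 | e2 = e / 2} by exists (e / 2).
have e2p : 0 < e2 by rewrite e20 divr_gt0.
have [r1 r10 h1] := cp x _ e2p; have [r2 r20 h2] := cq x _ e2p.
exists (Num.min r1 r2); first by rewrite lt_min r10.
move=> y; rewrite lt_min => /andP[/h1 y1 /h2 y2].
rewrite opprD addrACA (le_lt_trans (le_normcD _ _))//.
by rewrite (splitr e) -e20 ltrD.
Qed.

Lemma ccontM phi psi : ccont phi -> ccont psi ->
  ccont (fun x => phi x * psi x).
Proof.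
move=> cp cq x e e0.
pose M := 1 + normc (phi x) + normc (psi x).
have M1 : 1 <= M by rewrite /M -addrA lerDl addr_ge0// normc_ge0.
have M0 : 0 < M by exact: lt_le_trans M1.
pose e2 := Num.min 1 (e / (2 * M)).
have e2p : 0 < e2 by rewrite lt_min ltr01 divr_gt0// mulr_gt0.
have [r1 r10 h1] := cp x _ e2p; have [r2 r20 h2] := cq x _ e2p.
exists (Num.min r1 r2); first by rewrite lt_min r10.
move=> y; rewrite lt_min => /andP[/h1 y1 /h2 y2].
have -> : phi y * psi y - phi x * psi x =
  (phi y - phi x) * psi y + phi x * (psi y - psi x) by ring.
apply: le_lt_trans (le_normcD _ _) _; rewrite !normcM.
have py : normc (psi y) <= 1 + normc (psi x).
  rewrite -{1}(subrK (psi x) (psi y)) (le_trans (le_normcD _ _))// lerD2r.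
  by rewrite (le_trans (ltW y2))// ge_min lexx.
have eM : e2 * (2 * M) <= e.
  by rewrite -ler_pdivlMr ?mulr_gt0// ge_min lexx orbT.
have := normc_ge0 (phi x); have := normc_ge0 (psi x).
have := normc_ge0 (phi y - phi x); have := normc_ge0 (psi y - psi x).
have := normc_ge0 (psi y); rewrite /M in M0 eM *.
move: (normc (phi y - phi x)) (normc (psi y - psi x)) y1 y2 => a b y1 y2.
move: (normc (phi x)) (normc (psi x)) (normc (psi y)) py M0 eM => p q t py M0 eM.
by move=> *; nra.
Qed.

Lemma ccont_sum I (s : seq I) (F : I -> V -> R[i]) : (forall i, ccont (F i)) ->
  ccont (fun x => \sum_(i <- s) F i x).
Proof.
move=> cF; elim: s => [|i s IH].
  by under eq_fun do rewrite big_nil; exact: ccont_cst.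
by under eq_fun do rewrite big_cons; exact: ccontD.
Qed.

Lemma ccont_shift phi a : ccont phi -> ccont (fun x => phi (x + a)).
Proof.
move=> cp x e e0; have [r r0 h] := cp (x + a) e e0; exists r => // y yx.
by apply: h; rewrite opprD addrACA subrr addr0.
Qed.

Lemma ccont_bounded phi (K : set V) : ccont phi -> compact K ->
  exists2 M : R, 0 <= M & forall x, K x -> normc (phi x) <= M.
Proof.
move=> cp cK; have cn := ccont_normc cp.
have /compact_bounded[M [_ hM]] :
  compact ((fun x => normc (phi x)) @` K).
  by apply: continuous_compact => //; exact: continuous_subspaceT.
exists (`|M| + 1) => [|x Kx]; first by rewrite addr_ge0.
have := hM (`|M| + 1); rewrite (le_lt_trans (ler_norm M)) ?ltrDl//.
move=> /(_ isT (normc (phi x))) /=; rewrite ger0_norm ?normc_ge0//.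
by apply; exists x.
Qed.

Lemma ccont_leb_integrable phi (r M : R) : ccont phi -> 0 < r ->
  (forall x, normc (phi x) <= M * \1_[set x : V | `|x| < r] x) ->
  cintegrable (leb R n) phi.
Proof.
move=> cp r0 h; have rfin := leb_ball0_fin r0.
have mr := leb_ball0_measurable r; split.
  apply: (integrable_bounded mr rfin); first exact: (continuous_leb (ccont_Re cp)).
  by move=> x; exact: le_trans (Re_le_normc _) (h x).
apply: (integrable_bounded mr rfin); first exact: (continuous_leb (ccont_Im cp)).
by move=> x; exact: le_trans (Im_le_normc _) (h x).
Qed.

End rV_borel.

(** * Characters and Fourier transforms *)

Section characters.
Context {R : realType} {d : nat}.
Local Notation V := 'rV[R]_d.
Implicit Types x y xi eta : V.

Lemma dotpC x y : dotp x y = dotp y x.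
Proof. by apply: eq_bigr => i _; rewrite mulrC. Qed.

Lemma dotpDl x y xi : dotp (x + y) xi = dotp x xi + dotp y xi.
Proof. by rewrite /dotp -big_split; apply: eq_bigr => i _; rewrite mxE mulrDl. Qed.

Lemma dotpDr x y xi : dotp xi (x + y) = dotp xi x + dotp xi y.
Proof. by rewrite dotpC dotpDl !(dotpC xi). Qed.

Lemma dotpZl a x y : dotp (a *: x) y = a * dotp x y.
Proof. by rewrite /dotp mulr_sumr; apply: eq_bigr => i _; rewrite mxE mulrA. Qed.

Lemma dotpZr a x y : dotp x (a *: y) = a * dotp x y.
Proof. by rewrite dotpC dotpZl dotpC. Qed.

Lemma dotpNl x y : dotp (- x) y = - dotp x y.
Proof. by rewrite -scaleN1r dotpZl mulN1r. Qed.

Lemma dotpNr x y : dotp x (- y) = - dotp x y.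
Proof. by rewrite dotpC dotpNl dotpC. Qed.

Lemma dotp0l x : dotp 0 x = 0.
Proof. by rewrite -(scale0r x) dotpZl mul0r. Qed.

Lemma dotp_norm_le x y : `|dotp x y| <= d%:R * (`|x| * `|y|).
Proof.
rewrite (le_trans (ler_norm_sum _ _ _))//.
rewrite (@le_trans _ _ (\sum_(i < d) `|x| * `|y|))//.
  by apply: ler_sum => i _; rewrite normrM ler_pM// rV_norm_coord.
by rewrite sumr_const card_ord mulr_natl.
Qed.

Lemma fcharD xi eta x : fchar (xi + eta) x = fchar xi x * fchar eta x.
Proof.
apply/eqP; rewrite eq_complex ReM ImM /= dotpDl mulrDr cosD sinD.
by apply/andP; split; apply/eqP; [ring|rewrite opprD mulrN mulNr addrC].
Qed.

Lemma fchar0 x : fchar 0 x = 1.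
Proof. by rewrite /fchar dotp0l mulr0 cos0 sin0 oppr0. Qed.

Lemma fcharC x xi : fchar xi x = fchar x xi.
Proof. by rewrite /fchar dotpC. Qed.

Lemma fcharDr xi x y : fchar xi (x + y) = fchar xi x * fchar xi y.
Proof. by rewrite fcharC fcharD !(fcharC _ xi). Qed.

Lemma normc_fchar xi x : normc (fchar xi x) = 1.
Proof. by rewrite /= sqrrN cos2Dsin2 sqrtr1. Qed.

(** Phrased through [dotp xi x], so that it yields both continuity in the variable and, on bounded
    sets, uniform continuity in the frequency. *)
Lemma fchar_near1 (e : R) : 0 < e -> exists2 r : R, 0 < r &
  forall xi x, `|dotp xi x| < r -> normc (fchar xi x - 1) < e.
Proof.
move=> e0; have e2 : 0 < e / 2 by rewrite divr_gt0.
have /cvgrPdist_lt/(_ _ e2)/nbhs_ballP[r1 r10 h1] := @continuous_cos R 0.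
have /cvgrPdist_lt/(_ _ e2)/nbhs_ballP[r2 r20 h2] := @continuous_sin R 0.
have p0 : 0 < 2 * pi :> R by rewrite mulr_gt0// pi_gt0.
exists (Num.min r1 r2 / (2 * pi)); first by rewrite divr_gt0// lt_min; apply/andP.
move=> xi x xr.
have /andP[t1 t2] : (`|2 * pi * dotp xi x| < r1) && (`|2 * pi * dotp xi x| < r2).
  by rewrite -lt_min normrM (ger0_norm (ltW p0)) mulrC -ltr_pdivlMr.
apply: le_lt_trans (normc_le_ReIm _) _; rewrite (splitr e) /= oppr0 addr0 normrN.
have b1 : `|cos 0 - cos (2 * pi * dotp xi x)| < e / 2.
  by apply: h1; rewrite /ball/= sub0r normrN.
have b2 : `|sin 0 - sin (2 * pi * dotp xi x)| < e / 2.
  by apply: h2; rewrite /ball/= sub0r normrN.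
by move: b1 b2; rewrite cos0 sin0 sub0r normrN distrC; exact: ltrD.
Qed.

Lemma ccont_fchar xi : ccont (fchar xi).
Proof.
move=> x e e0; have [r r0 hr] := fchar_near1 e0.
exists (r / (d%:R * `|xi| + 1)) => [|y]; first by rewrite divr_gt0// ltr_wpDl// mulr_ge0.
rewrite ltr_pdivlMr ?ltr_wpDl ?mulr_ge0// => yx.
have -> : fchar xi y - fchar xi x = fchar xi x * (fchar xi (y - x) - 1).
  by rewrite mulrBr mulr1 -fcharDr [x + _]addrC subrK.
rewrite normcM normc_fchar mul1r; apply: hr.
rewrite (le_lt_trans (dotp_norm_le _ _))// (le_lt_trans _ yx)//.
by rewrite mulrA mulrC ler_wpM2l// lerDl.
Qed.

End characters.

Section fourier_transform.
Context {R : realType} {d : nat}.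
Local Notation V := 'rV[R]_d.
Implicit Types (phi psi : V -> R[i]) (K : set V).

Definition ccsupp K phi := ccont phi /\ (forall x, phi x != 0 -> K x).

Lemma ccsupp_bound K phi : compact K -> ccsupp K phi ->
  exists r M : R, [/\ 0 < r, 0 <= M, forall x, K x -> `|x| < r &
    forall x, normc (phi x) <= M * \1_[set x : V | `|x| < r] x].
Proof.
move=> cK [cp sp]; have [r r0 Kr] := compact_norm_bounded cK.
have [M M0 KM] := ccont_bounded cp cK; exists r, M; split => // x.
have [->|/sp Kx] := eqVneq (phi x) 0; first by rewrite normc0 mulr_ge0.
by rewrite indicE mem_set/= ?mulr1; [exact: KM|exact: Kr].
Qed.

Lemma ccsupp_integrable K phi : compact K -> ccsupp K phi ->
  cintegrable (leb R d) phi.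
Proof.
move=> cK sp; have [r [M [r0 M0 Kr pM]]] := ccsupp_bound cK sp.
exact: ccont_leb_integrable (proj1 sp) r0 pM.
Qed.

Lemma ccsuppM K phi psi : ccsupp K phi -> ccont psi ->
  ccsupp K (fun x => phi x * psi x).
Proof.
move=> [cp sp] cq; split; first exact: ccontM.
by move=> x; rewrite mulf_eq0 negb_or => /andP[/sp].
Qed.

Lemma ccsuppMl K phi psi : ccsupp K phi -> ccont psi ->
  ccsupp K (fun x => psi x * phi x).
Proof. by move=> sp cq; under eq_fun do rewrite mulrC; exact: ccsuppM. Qed.

Lemma ccsuppD K phi psi : ccsupp K phi -> ccsupp K psi ->
  ccsupp K (fun x => phi x + psi x).
Proof.
move=> [cp sp] [cq sq]; split; first exact: ccontD.
by move=> x; have [->|/sp//] := eqVneq (phi x) 0; rewrite add0r => /sq.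
Qed.

Lemma ccsupp_sum K I (s : seq I) (F : I -> V -> R[i]) :
  (forall i, ccsupp K (F i)) -> ccsupp K (fun x => \sum_(i <- s) F i x).
Proof.
move=> cF; elim: s => [|i s IH].
  by under eq_fun do rewrite big_nil; split => [|x]; rewrite ?eqxx//; exact: ccont_cst.
by under eq_fun do rewrite big_cons; exact: ccsuppD.
Qed.

Lemma fourier_add K phi psi xi : compact K -> ccsupp K phi -> ccsupp K psi ->
  fourier (fun x => phi x + psi x) xi = fourier phi xi + fourier psi xi.
Proof.
move=> cK sp sq; have cf := @ccont_fchar R d xi.
have := cintegralD (ccsupp_integrable cK (ccsuppM sp cf))
  (ccsupp_integrable cK (ccsuppM sq cf)).
move=> <-; congr integralC; apply/funext => x; exact: mulrDl.
Qed.

Lemma fourier_scale K c phi xi : compact K -> ccsupp K phi ->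
  fourier (fun x => c * phi x) xi = c * fourier phi xi.
Proof.
move=> cK sp; have cf := @ccont_fchar R d xi.
have <- := cintegralZ c (ccsupp_integrable cK (ccsuppM sp cf)).
by congr integralC; apply/funext => x; rewrite mulrA.
Qed.

Lemma fourier_sum K I (s : seq I) (F : I -> V -> R[i]) xi : compact K ->
  (forall i, ccsupp K (F i)) ->
  fourier (fun x => \sum_(i <- s) F i x) xi = \sum_(i <- s) fourier (F i) xi.
Proof.
move=> cK cF; have cf := @ccont_fchar R d xi.
have <- := cintegral_sum s (fun i => ccsupp_integrable cK (ccsuppM (cF i) cf)).
by congr integralC; apply/funext => x; rewrite mulr_suml.
Qed.

Lemma fourier_modulation phi xi eta :
  fourier (fun x => phi x * fchar xi x) eta = fourier phi (xi + eta).
Proof. by congr integralC; apply/funext => x; rewrite fcharD mulrA. Qed.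

Lemma integralC_shift phi a : ccont phi ->
  integralC (fun x => phi (x + a)) = integralC phi.
Proof.
move=> cp; apply/eqP; rewrite eq_complex /=; apply/andP; split; apply/eqP;
  congr fine.
  apply: (integral_leb_shift a (f := fun x => (complex.Re (phi x))%:E)).
  by apply/measurable_EFinP; exact: (continuous_leb (ccont_Re cp)).
apply: (integral_leb_shift a (f := fun x => (complex.Im (phi x))%:E)).
by apply/measurable_EFinP; exact: (continuous_leb (ccont_Im cp)).
Qed.

(** A translation multiplies the transform by a character value, which has modulus 1. *)
Lemma normc_fourier_shift K phi a xi : compact K -> ccsupp K phi ->
  normc (fourier (fun x => phi (x + a)) xi) = normc (fourier phi xi).
Proof.
move=> cK sp; have cf := @ccont_fchar R d xi.
rewrite /fourier -(integralC_shift a (proj1 (ccsuppM sp cf))).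
transitivity (normc (fchar xi (- a) *
  integralC (fun x => phi (x + a) * fchar xi (x + a)))); last first.
  by rewrite normcM normc_fchar mul1r.
congr normc; rewrite -[RHS]cintegralZ.
  congr integralC; apply/funext => x.
  by rewrite mulrCA -fcharDr [- a + _]addrC addrK.
have [r [M [r0 M0 Kr pM]]] := ccsupp_bound cK sp.
apply: (@ccont_leb_integrable _ _ _ (r + `|a|) M).
- exact: (ccont_shift a (proj1 (ccsuppM sp cf))).
- by rewrite ltr_pwDl.
- move=> x; rewrite normcM normc_fchar mulr1; apply: le_trans (pM _) _.
  rewrite ler_wpM2l// !indicE ler_nat; have [xr|]// := boolP (x + a \in _).
  rewrite mem_set//=; rewrite inE/= in xr.
  by rewrite -(addrK a x) (le_lt_trans (ler_normB _ _))// ltrD2r.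
Qed.

(* A pointwise limit dominated on a fixed compact set is an L^1 limit, hence a
   uniform one on the Fourier side. *)
Lemma fourier_cvg K (psi_ : nat -> V -> R[i]) psi (M : R) : compact K ->
  (forall n, ccsupp K (psi_ n)) -> ccsupp K psi ->
  (forall n x, normc (psi_ n x) <= M) ->
  (forall x, (fun n => normc (psi_ n x - psi x)) @ \oo --> (0 : R)) ->
  forall e : R, 0 < e -> exists N, forall n, (N <= n)%N -> forall xi,
    normc (fourier (psi_ n) xi - fourier psi xi) < e.
Proof.
move=> cK sp_ sp pM pc e e0.
have M0 : 0 <= M by exact: le_trans (normc_ge0 _) (pM 0%N 0).
have sd n : ccsupp K (fun x => psi_ n x + (-1) * psi x).
  by apply: ccsuppD => //; apply: ccsuppMl => //; exact: ccont_cst.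
have [r [M' [r0 M'0 Kr pM']]] := ccsupp_bound cK sp.
pose G n x := normc (psi_ n x + (-1) * psi x).
have mr := @leb_ball0_measurable R d r.
have rfin := @leb_ball0_fin R d r r0.
have G0 n x : 0 <= G n x <= (M + M') * \1_[set x : V | `|x| < r] x.
  rewrite normc_ge0/= /G.
  have [->|/(proj2 (sd n)) Kx] := eqVneq (psi_ n x + (-1) * psi x) 0.
    by rewrite normc0 mulr_ge0// addr_ge0.
  rewrite indicE mem_set/= ?mulr1; last exact: Kr.
  apply: le_trans (le_normcD _ _) _; rewrite lerD// mulN1r normcN.
  by rewrite (le_trans (pM' x))// ler_piMr// indicE lern1 leq_b1.
have mG n : measurable_fun [set: lebT R d] (G n : lebT R d -> R).
  exact: (continuous_leb (ccont_normc (proj1 (sd n)))).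
have Gc x : G ^~ x @ \oo --> (0 : R).
  by apply: cvg_trans (pc x); apply: near_eq_cvg; apply: nearW => n;
    rewrite /G mulN1r.
have := @Rintegral_cvg0 _ (lebT R d) R (leb R d) G _ _ mr rfin mG G0 Gc.
have e4 : 0 < e / 4 by rewrite divr_gt0.
move=> /cvgrPdist_lt/(_ _ e4)[N _ hN]; exists N => n Nn xi.
have iG : (leb R d).-integrable setT (EFin \o (G n : lebT R d -> R)).
  apply: (integrable_bounded mr rfin (mG n) (M := M + M')) => x.
  by have /andP[h1 h2] := G0 n x; rewrite ger0_norm.
have -> : fourier (psi_ n) xi - fourier psi xi =
    fourier (fun x => psi_ n x + (-1) * psi x) xi.
  rewrite (fourier_add _ cK) ?(fourier_scale _ _ cK) ?mulN1r//.
  by apply: ccsuppMl => //; exact: ccont_cst.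
have cf := @ccont_fchar R d xi.
have := normc_cintegral_le (ccsupp_integrable cK (ccsuppM (sd n) cf)) iG.
move=> /(_ _)/le_lt_trans; apply.
  by move=> x; rewrite normcM normc_fchar mulr1.
have := hN n Nn; rewrite /= sub0r normrN => /(le_lt_trans (ler_norm _)).
by move: (\int[_]_x _) => I; lra.
Qed.

End fourier_transform.

(** * Test functions and ultradistributions *)

Section test_functions.
Context {R : realType} {d : nat}.
Local Notation V := 'rV[R]_d.
Variable om : V -> R.
Hypothesis hom : weight_assumptions om.
Implicit Types (phi psi : V -> R[i]) (K W Om : set V).

(** For compact [K] this is [DK om K] (see [DKP]), with finite suprema replaced by explicit
    constants so that bounds uniform along a sequence can be expressed. *)
Definition tf K phi := ccsupp K phi /\ forall lam, 0 < lam ->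
  exists2 C : R, 0 < C &
    forall xi, normc (fourier phi xi) <= C * expR (- (lam * om xi)).

Lemma lnorm_le lam phi (C : R) :
  (forall xi, normc (fourier phi xi) <= C * expR (- (lam * om xi))) ->
  (lnorm om lam phi <= C%:E)%E.
Proof.
move=> h; apply: ge_ereal_sup => _ [xi _ <-]; rewrite lee_fin.
by rewrite -ler_pdivlMr ?expR_gt0// -expRN.
Qed.

Lemma DKP K phi : compact K -> DK om K phi <-> tf K phi.
Proof.
move=> cK; have clK : closed K by apply: compact_closed => //; exact: norm_hausdorff.
split=> [[/ccontP cp h]|[[cp sp] h]].
  split; first split => //.
    move=> x px; have [_ KK _] := h 1 ltr01.
    by apply: KK; exact: subset_closure.
  move=> lam lam0; have [_ _] := h lam lam0.
  rewrite /lnorm; set S := ereal_sup _ => Sfin.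
  have Sge xi : ((normc (fourier phi xi) * expR (lam * om xi))%:E <= S :> \bar R)%E.
    by apply: ereal_sup_ubound; exists xi.
  have S0 : (0 <= S :> \bar R)%E.
    by apply: le_trans (Sge 0); rewrite lee_fin mulr_ge0 ?normc_ge0 ?expR_ge0.
  exists (fine S + 1) => [|xi].
    by rewrite ltr_wpDl// fine_ge0.
  rewrite expRN ler_pdivlMr ?expR_gt0//.
  rewrite -lee_fin; apply: le_trans (Sge xi) _.
  by rewrite EFinD fineK ?leeDl// ge0_fin_numE.
split; first exact/ccontP.
move=> lam lam0; have [C C0 hC] := h lam lam0; split.
- exact: (@ccsupp_integrable _ _ K).
- by apply: subset_trans (closure_subset sp) _; rewrite -(closure_id K).1.
- by apply: le_lt_trans (lnorm_le hC) _; rewrite ltry.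
Qed.

Lemma tf_testfun K Om phi : compact K -> K `<=` Om -> tf K phi ->
  testfun om Om phi.
Proof. by move=> cK KOm tp; exists K; split => //; apply/DKP. Qed.

Lemma tfD K phi psi : compact K -> tf K phi -> tf K psi ->
  tf K (fun x => phi x + psi x).
Proof.
move=> cK [sp hp] [sq hq]; split; first exact: ccsuppD.
move=> lam l0; have [C1 C10 h1] := hp lam l0; have [C2 C20 h2] := hq lam l0.
exists (C1 + C2) => [|xi]; first exact: addr_gt0.
by rewrite (fourier_add _ cK)// mulrDl (le_trans (le_normcD _ _))// lerD.
Qed.

Lemma tfZ K c phi : compact K -> tf K phi -> tf K (fun x => c * phi x).
Proof.
move=> cK [sp hp]; split; first by apply: ccsuppMl => //; exact: ccont_cst.
move=> lam l0; have [C C0 h] := hp lam l0.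
exists ((normc c + 1) * C) => [|xi]; first by rewrite mulr_gt0// ltr_wpDl ?normc_ge0.
rewrite (fourier_scale _ _ cK)// normcM -mulrA ler_pM ?normc_ge0//.
by rewrite lerDl.
Qed.

Lemma tf0 K : compact K -> tf K (fun=> 0).
Proof.
move=> cK; have s0 : ccsupp K (fun=> 0).
  by split => [|x]; [exact: ccont_cst|rewrite eqxx].
split => // lam l0; exists 1 => // xi; rewrite mul1r.
have := fourier_scale 0 xi cK s0; under eq_fun do rewrite mul0r.
by move=> ->; rewrite mul0r normc0 expR_ge0.
Qed.

Lemma tf_sum K I (s : seq I) (F : I -> V -> R[i]) : compact K ->
  (forall i, tf K (F i)) -> tf K (fun x => \sum_(i <- s) F i x).
Proof.
move=> cK tF; elim: s => [|i s IH].
  by under eq_fun do rewrite big_nil; exact: tf0.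
by under eq_fun do rewrite big_cons; exact: tfD.
Qed.

(** Subadditivity and evenness give om eta <= om (xi + eta) + om xi. *)
Lemma om_modulation lam xi eta : 0 < lam ->
  expR (- (lam * om (xi + eta))) <= expR (lam * om xi) * expR (- (lam * om eta)).
Proof.
move=> l0; rewrite -expRD ler_expR.
have := om_alpha hom (xi + eta) (- xi); rewrite (om_even hom) addrAC subrr add0r.
by rewrite -(ler_pM2l l0) mulrDr; lra.
Qed.

Lemma tf_modulation K phi xi : tf K phi -> tf K (fun x => phi x * fchar xi x).
Proof.
move=> [sp hp]; split; first by apply: ccsuppM => //; exact: ccont_fchar.
move=> lam l0; have [C C0 h] := hp lam l0.
exists (C * expR (lam * om xi)) => [|eta]; first by rewrite mulr_gt0 ?expR_gt0.
rewrite fourier_modulation; apply: le_trans (h _) _.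
by rewrite -mulrA ler_pM2l// om_modulation.
Qed.

Lemma tf_shift K phi a : compact K -> tf K phi ->
  tf ((fun x => x + a) @^-1` K) (fun x => phi (x + a)).
Proof.
move=> cK [sp hp]; split.
  by split=> [|x /(proj2 sp)//]; apply: ccont_shift; exact: proj1 sp.
move=> lam l0; have [C C0 h] := hp lam l0; exists C => // xi.
by rewrite (normc_fourier_shift _ _ cK sp).
Qed.

Lemma tf_sub K W phi : K `<=` W -> tf K phi -> tf W phi.
Proof. by move=> KW [[cp sp] h]; split => //; split => // x /sp/KW. Qed.

(** By [fourier_cvg] the transforms converge uniformly, so decay bounds that do not depend on n
    survive in the limit. *)
Lemma tf_limit K (psi_ : nat -> V -> R[i]) psi (M : R) : compact K ->
  (forall n, ccsupp K (psi_ n)) -> ccsupp K psi ->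
  (forall lam, 0 < lam -> exists2 C : R, 0 < C & forall n xi,
    normc (fourier (psi_ n) xi) <= C * expR (- (lam * om xi))) ->
  (forall n x, normc (psi_ n x) <= M) ->
  (forall x, (fun n => normc (psi_ n x - psi x)) @ \oo --> (0 : R)) ->
  tf K psi.
Proof.
move=> cK sp_ sp hp pM pc; split => // lam l0.
have [C C0 hC] := hp lam l0; exists C => // xi.
apply/ler_addgt0Pr => e e0.
have [N hN] := fourier_cvg cK sp_ sp pM pc e0.
rewrite -(subrK (fourier (psi_ N) xi) (fourier psi xi)).
apply: le_trans (le_normcD _ _) _; rewrite addrC lerD//.
by rewrite normcB ltW// hN.
Qed.

Lemma enorm_le (x : V) : enorm x <= d%:R * `|x|.
Proof.
rewrite -[leRHS]ger0_norm ?mulr_ge0// -sqrtr_sqr ler_sqrt ?sqr_ge0//.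
apply: le_trans (ler_norm _) _; apply: le_trans (dotp_norm_le _ _) _.
rewrite exprMn -!expr2 ler_wpM2r ?sqr_ge0// expr2 -natrM ler_nat.
by case: (d) => // n; rewrite leq_pmulr.
Qed.

Lemma norm_le_enorm (x : V) : `|x| <= enorm x.
Proof.
apply/rV_norm_ler => [|i]; first exact: sqrtr_ge0.
rewrite -sqrtr_sqr ler_sqrt; last by apply: sumr_ge0 => j _; rewrite -expr2 sqr_ge0.
rewrite /dotp (bigD1 i)//= -expr2 lerDl.
by apply: sumr_ge0 => j _; rewrite -expr2 sqr_ge0.
Qed.

(** Measurability alone would not give this; it comes from [om] being a nondecreasing function of
    [enorm]. *)
Lemma om_locally_bounded (r : R) : exists B : R, forall xi, `|xi| <= r -> om xi <= B.
Proof.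
have [w [w0 wm omw]] := om_alpha0 hom.
exists (w (d%:R * r)) => xi xr; rewrite omw; apply: wm; first exact: sqrtr_ge0.
by apply: le_trans (enorm_le _) _; rewrite ler_wpM2l.
Qed.

Section functional.
Variables (Om : set V) (f : (V -> R[i]) -> R[i]).
Hypothesis hf : ultradistribution om Om f.

Lemma ultradistributionZ K c phi : compact K -> K `<=` Om -> tf K phi ->
  f (fun x => c * phi x) = c * f phi.
Proof.
move=> cK KOm tp; have h := proj1 hf phi phi c 0.
have tp' := tf_testfun cK KOm tp.
have := h tp' tp'; rewrite mul0r addr0 => <-; congr f.
by apply/funext => x; rewrite mul0r addr0.
Qed.

Lemma ultradistributionD K phi psi : compact K -> K `<=` Om ->
  tf K phi -> tf K psi -> f (fun x => phi x + psi x) = f phi + f psi.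
Proof.
move=> cK KOm tp tq; have h := proj1 hf phi psi 1 1.
have := h (tf_testfun cK KOm tp) (tf_testfun cK KOm tq).
rewrite !mul1r => <-; congr f.
by apply/funext => x; rewrite !mul1r.
Qed.

Lemma ultradistribution_sum K I (s : seq I) (F : I -> V -> R[i]) :
  compact K -> K `<=` Om -> (forall i, tf K (F i)) ->
  f (fun x => \sum_(i <- s) F i x) = \sum_(i <- s) f (F i).
Proof.
move=> cK KOm tF; elim: s => [|i s IH].
  under eq_fun do rewrite big_nil.
  rewrite big_nil; have := ultradistributionZ 0 cK KOm (tf0 cK).
  by rewrite !mul0r.
under eq_fun do rewrite big_cons.
by rewrite (ultradistributionD cK KOm) ?IH ?big_cons//; exact: tf_sum.
Qed.

Lemma ultradistribution_bound K : compact K -> K `<=` Om ->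
  exists lam A : R, [/\ 0 < lam, 0 < A & forall phi (C : R), tf K phi -> 0 < C ->
    (forall xi, normc (fourier phi xi) <= C * expR (- (lam * om xi))) ->
    normc (f phi) <= A * C].
Proof.
move=> cK KOm; have [W [_ _ hW] Wf] := proj2 hf 1 ltr01.
have [lam [e [l0 e0 hK]]] := hW K cK KOm.
exists lam, (2 / e); split => //; first exact: divr_gt0.
(* This multiple brings the norm of [phi] down to at most e / 2, strictly below the radius e of the
   neighbourhood. *)
move=> phi C tp C0 hC; set c := e / (2 * C).
have c0 : 0 < c by rewrite divr_gt0// mulr_gt0.
have tc := tfZ (c%:C)%C cK tp.
have : W (fun x => (c%:C)%C * phi x).
  apply: hK; first exact/DKP.
  apply: (@le_lt_trans _ _ (e / 2)%:E); last by rewrite lte_fin; lra.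
  apply: lnorm_le => xi; rewrite (fourier_scale _ _ cK) ?normcM ?normc_real; last exact: proj1 tp.
  rewrite ger0_norm ?(ltW c0)//.
  have := hC xi; rewrite -(ler_pM2l c0) mulrA => /le_trans; apply.
  rewrite le_eqVlt; apply/orP; left; apply/eqP; congr (_ * _).
  by rewrite /c; field; rewrite gt_eqF.
move=> /Wf; rewrite (ultradistributionZ _ cK KOm tp) normcM normc_real.
rewrite ger0_norm ?(ltW c0)// /c mulrC -ltr_pdivlMr ?divr_gt0 ?mulr_gt0//.
by rewrite div1r invf_div => /ltW/le_trans; apply; rewrite mulrAC.
Qed.

(** The geometric mean of a decay bound at rate 2 lam and a uniform bound s is a decay bound at rate
    lam. Thus uniform smallness of the transform makes the value of [f] small, as long as the decay
    constants stay bounded. *)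
Lemma ultradistribution_interp K : compact K -> K `<=` Om ->
  exists lam A : R, [/\ 0 < lam, 0 < A & forall phi (C s : R), tf K phi ->
    0 < C -> 0 < s ->
    (forall xi, normc (fourier phi xi) <= C * expR (- (lam * om xi))) ->
    (forall xi, normc (fourier phi xi) <= s) ->
    normc (f phi) <= A * Num.sqrt (C * s)].
Proof.
move=> cK KOm; have [lam [A [l0 A0 h]]] := ultradistribution_bound cK KOm.
exists (2 * lam), A; split => //; first exact: mulr_gt0.
move=> phi C s tp C0 s0 hC hs; apply: h => //; first by rewrite sqrtr_gt0 mulr_gt0.
move=> xi; rewrite -ler_sqr ?nnegrE ?mulr_ge0 ?normc_ge0 ?sqrtr_ge0 ?expR_ge0//.
rewrite exprMn (sqr_sqrtr (mulr_ge0 (ltW C0) (ltW s0))).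
have -> : expR (- (lam * om xi)) ^+ 2 = expR (- (2 * lam * om xi)).
  by rewrite expr2 -expRD; congr expR; ring.
by rewrite expr2 mulrAC; apply: ler_pM; rewrite ?normc_ge0.
Qed.

Lemma ultradistribution_limit K (psi_ : nat -> V -> R[i]) psi (M B : R) :
  compact K -> K `<=` Om ->
  (forall n, tf K (psi_ n)) -> tf K psi ->
  (forall lam, 0 < lam -> exists2 C : R, 0 < C & forall n xi,
    normc (fourier (psi_ n) xi) <= C * expR (- (lam * om xi))) ->
  (forall n x, normc (psi_ n x) <= M) ->
  (forall x, (fun n => normc (psi_ n x - psi x)) @ \oo --> (0 : R)) ->
  (forall n, normc (f (psi_ n)) <= B) -> normc (f psi) <= B.
Proof.
move=> cK KOm tp_ tp hp pM pc fB; apply/ler_addgt0Pr => e e0.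
have [lam [A [l0 A0 h]]] := ultradistribution_interp cK KOm.
have [C1 C10 hC1] := hp lam l0; have [C2 C20 hC2] := proj2 tp lam l0.
pose C := C1 + C2; have C0 : 0 < C by exact: addr_gt0.
(* Chosen so that A * sqrt (C * s) = e. *)
pose s := (e / A) ^+ 2 / C; have s0 : 0 < s by rewrite divr_gt0// exprn_gt0// divr_gt0.
have [N hN] := fourier_cvg cK (fun n => proj1 (tp_ n)) (proj1 tp) pM pc s0.
have tm : tf K (fun x => (-1) * psi_ N x) by exact: tfZ.
have td : tf K (fun x => psi x + (-1) * psi_ N x) by exact: tfD.
have Fd xi : fourier (fun x => psi x + (-1) * psi_ N x) xi =
    fourier psi xi - fourier (psi_ N) xi.
  rewrite (fourier_add _ cK) ?(fourier_scale _ _ cK) ?mulN1r//;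
    by [exact: proj1 (tp_ N)|exact: proj1 tp|exact: proj1 tm].
have := h _ C s td C0 s0; rewrite (ultradistributionD cK KOm)//.
rewrite (ultradistributionZ _ cK KOm)// mulN1r => hd.
rewrite -(subrK (f (psi_ N)) (f psi)) (le_trans (le_normcD _ _))// addrC lerD//.
apply: le_trans (hd _ _) _.
- move=> xi; rewrite Fd (le_trans (le_normcD _ _))// normcN addrC mulrDl lerD//.
- by move=> xi; rewrite Fd normcB ltW// hN.
- rewrite /s [C * _]mulrC mulfVK ?gt_eqF// sqrtr_sqr ger0_norm ?divr_ge0 ?(ltW e0) ?(ltW A0)//.
  by rewrite mulrC mulfVK ?gt_eqF.
Qed.

(** The easy half of a Paley-Wiener theorem: modulation by [xi] enlarges the decay constant of rate
    lam by at most exp (lam om xi). *)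
Lemma fourierD_bound K phi : compact K -> K `<=` Om -> tf K phi ->
  exists lam C : R, [/\ 0 < lam, 0 < C & forall xi,
    normc (fourierD (mulD phi f) xi) <= C * expR (lam * om xi)].
Proof.
move=> cK KOm tp; have [lam [A [l0 A0 h]]] := ultradistribution_bound cK KOm.
have [C C0 hC] := proj2 tp lam l0.
exists lam, (A * C); split => //; first exact: mulr_gt0.
move=> xi; rewrite -mulrA; apply: h; [exact: tf_modulation|by rewrite mulr_gt0 ?expR_gt0|].
move=> eta; rewrite fourier_modulation -mulrA; apply: le_trans (hC _) _.
by rewrite ler_pM2l// om_modulation.
Qed.

(** On the bounded support, characters of close frequencies are uniformly close. The variable [zeta]
    is the argument of the transforms of the two modulated functions. *)
Lemma ccsupp_fourier_unif K phi : compact K -> ccsupp K phi ->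
  forall e : R, 0 < e -> exists2 r : R, 0 < r & forall xi eta zeta,
    `|xi - eta| < r ->
    normc (fourier phi (xi + zeta) - fourier phi (eta + zeta)) < e.
Proof.
move=> cK sp e e0; have [r [M [r0 M0 Kr pM]]] := ccsupp_bound cK sp.
pose vol := \int[leb R d]_x (M * \1_[set x : V | `|x| < r] x).
have vol0 : 0 <= vol.
  by apply: Rintegral_ge0 => x _; rewrite mulr_ge0.
have e'0 : 0 < e / (2 * (vol + 1)) by rewrite divr_gt0// mulr_gt0// ltr_wpDl.
have [r1 r10 h1] := fchar_near1 e'0 (d := d).
exists (r1 / (d%:R * r + 1)); first by rewrite divr_gt0// ltr_wpDl// mulr_ge0 ?ler0n ?(ltW r0).
move=> xi eta zeta; rewrite ltr_pdivlMr ?ltr_wpDl ?mulr_ge0 ?ler0n ?(ltW r0)// => xe.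
have cp := proj1 sp.
have s1 : ccsupp K (fun x => phi x * (fchar xi x + (-1) * fchar eta x)).
  apply: ccsuppM => //; apply: ccontD; first exact: ccont_fchar.
  by apply: ccontM; [exact: ccont_cst|exact: ccont_fchar].
have E : fourier phi (xi + zeta) - fourier phi (eta + zeta) =
    fourier (fun x => phi x * (fchar xi x + (-1) * fchar eta x)) zeta.
  rewrite -!fourier_modulation.
  have -> : (fun x => phi x * (fchar xi x + (-1) * fchar eta x)) =
    (fun x => phi x * fchar xi x + (-1) * (phi x * fchar eta x)).
    by apply/funext => x; ring.
  have se : ccsupp K (fun x => phi x * fchar eta x).
    by apply: ccsuppM => //; exact: ccont_fchar.
  rewrite (fourier_add _ cK) ?(fourier_scale _ _ cK) ?mulN1r//.
    by apply: ccsuppM => //; exact: ccont_fchar.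
  by apply: ccsuppMl => //; exact: ccont_cst.
have e2 : e / (2 * (vol + 1)) * (2 * (vol + 1)) = e.
  by rewrite mulfVK// gt_eqF// mulr_gt0// ltr_wpDl.
rewrite E; set e' := e / _ in e2 h1 e'0.
have mr := @leb_ball0_measurable R d r.
have rfin := @leb_ball0_fin R d r r0.
have iG : (leb R d).-integrable setT
   (fun x => (M * \1_[set x : V | `|x| < r] x)%:E).
  by under eq_fun do rewrite EFinM; apply: integrableZl => //; exact: integrable_indic_fin.
have iG' : (leb R d).-integrable setT
   (fun x => (e' * (M * \1_[set x : V | `|x| < r] x))%:E).
  by under eq_fun do rewrite EFinM; exact: integrableZl.
have := normc_cintegral_le (ccsupp_integrable cK
  (ccsuppM s1 (ccont_fchar zeta))) iG'.
move=> /(_ _)/le_lt_trans; apply; last first.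
  rewrite RintegralZl// -/vol.
  by have := e'0; nra.
move=> x; rewrite !normcM normc_fchar mulr1 mulrC.
have [->|px] := eqVneq (phi x) 0.
  by rewrite normc0 mulr0 (mulr_ge0 (ltW e'0))// mulr_ge0.
rewrite ler_pM ?normc_ge0//.
have -> : fchar xi x + -1 * fchar eta x = fchar eta x * (fchar (xi - eta) x - 1).
  by rewrite mulrBr mulr1 -fcharD [eta + _]addrC subrK mulN1r.
rewrite normcM normc_fchar mul1r ltW// h1//.
apply: le_lt_trans (dotp_norm_le _ _) _; apply: le_lt_trans xe.
have := Kr _ (proj2 sp _ px); have := normr_ge0 x; have := normr_ge0 (xi - eta).
have := ler0n R d.
move: (d%:R) (`|x|) (`|xi - eta|) => n a b n0 b0 a0 ar.
have : n * (b * a) <= n * (b * r) by rewrite !ler_wpM2l// ltW.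
by nra.
Qed.

(** Modulations by nearby frequencies share a decay constant, [om] being locally bounded, and have
    uniformly close transforms, so interpolation applies. Continuity provides the measurability
    needed to average samples over translates. *)
Lemma fourierD_continuous K phi : compact K -> K `<=` Om -> tf K phi ->
  ccont (fourierD (mulD phi f)).
Proof.
move=> cK KOm tp xi e e0.
have [lam [A [l0 A0 h]]] := ultradistribution_interp cK KOm.
have [C1 C10 hC1] := proj2 tp lam l0.
have [B hB] := om_locally_bounded (`|xi| + 1).
pose C := C1 * expR (lam * B); have C0 : 0 < C by rewrite mulr_gt0 ?expR_gt0.
have hC eta : `|eta| <= `|xi| + 1 -> forall zeta,
    normc (fourier phi (eta + zeta)) <= C * expR (- (lam * om zeta)).
  move=> eB zeta; apply: le_trans (hC1 _) _; rewrite /C -mulrA ler_pM2l//.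
  apply: le_trans (om_modulation _ _ l0) _.
  by rewrite ler_pM2r ?expR_gt0// ler_expR ler_pM2l// hB.
(* Chosen so that A * sqrt (2 * C * s) = e / 2, where 2 * C is the decay constant of the
   difference. *)
pose s := (e / 2 / A) ^+ 2 / (2 * C).
have s0 : 0 < s by rewrite divr_gt0// ?exprn_gt0 ?divr_gt0// mulr_gt0.
have [r r0 hr] := ccsupp_fourier_unif cK (proj1 tp) s0.
exists (Num.min 1 r) => [|eta]; first by rewrite lt_min ltr01.
rewrite lt_min => /andP[e1 er].
have te := tf_modulation eta tp; have tx := tf_modulation xi tp.
have tm : tf K (fun x => (-1) * (phi x * fchar xi x)) by exact: tfZ.
have td : tf K (fun x => phi x * fchar eta x + (-1) * (phi x * fchar xi x)).
  exact: tfD.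
have Fd zeta : fourier (fun x => phi x * fchar eta x +
    (-1) * (phi x * fchar xi x)) zeta =
    fourier phi (eta + zeta) - fourier phi (xi + zeta).
  rewrite (fourier_add _ cK (proj1 te) (proj1 tm)) (fourier_scale _ _ cK (proj1 tx)).
  by rewrite mulN1r !fourier_modulation.
have C20 : 0 < 2 * C by rewrite mulr_gt0.
have := h _ (2 * C) s td C20 s0.
rewrite (ultradistributionD cK KOm)// (ultradistributionZ _ cK KOm)// mulN1r.
rewrite -/(fourierD (mulD phi f) eta) -/(fourierD (mulD phi f) xi) => hd.
apply: le_lt_trans (hd _ _) _.
- move=> zeta; rewrite Fd (le_trans (le_normcD _ _))// normcN -mulrA mulr_natl.
  rewrite mulr2n lerD// hC ?lerDl//.
  rewrite -(subrK xi eta) (le_trans (ler_normD _ _))// addrC lerD2l.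
  exact: ltW.
- by move=> zeta; rewrite Fd ltW// hr.
- have -> : 2 * C * s = (e / 2 / A) ^+ 2.
    by rewrite /s [2 * C * _]mulrC mulfVK// gt_eqF.
  rewrite sqrtr_sqr.
  rewrite ger0_norm ?divr_ge0 ?ltW//.
  by rewrite mulrC mulfVK ?gt_eqF//; lra.
Qed.

End functional.

End test_functions.

(** * Powers of cosines as approximate Dirac combs *)

Section kernel_1d.
Context {R : realType}.
Implicit Types s t : R.

Lemma sqr_sin_le t : sin t ^+ 2 <= t ^+ 2.
Proof.
wlog t0 : t / 0 <= t => [h|].
  have [/h//|/ltW t0] := leP 0 t.
  by rewrite -(sqrrN (sin t)) -sinN -(sqrrN t); apply: h; rewrite oppr_ge0.
have [c _] := @MVT_segment R sin cos 0 t t0 (fun x _ => is_derive_sin x)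
  (continuous_subspaceT (@continuous_sin R)).
rewrite sin0 !subr0 => ->; rewrite exprMn ler_piMl ?sqr_ge0//.
Qed.

(** A Bernoulli inequality for cos^2 >= 1 - t^2. It keeps the kernel away from 0 at distances of
    order n^(-1/2). *)
Lemma cos_pow_ge n t : 1 - n%:R * t ^+ 2 <= cos t ^+ (2 * n).
Proof.
have c2 : 1 - t ^+ 2 <= cos t ^+ 2.
  by rewrite cos2sin2 lerD2l lerN2 sqr_sin_le.
have c0 := sqr_ge0 (cos t); have c1 : cos t ^+ 2 <= 1.
  by rewrite -real_normK ?num_real// expr_le1// cos_max.
rewrite exprM; elim: n => [|n IH]; first by rewrite mul0r subr0 expr0.
rewrite -natr1; set T := t ^+ 2 in c2 IH *.
set C := cos t ^+ 2 in c0 c1 c2 IH *; rewrite exprSr.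
have p1 : C ^+ n <= 1 by exact: exprn_ile1.
have p0 : C ^+ n * (1 - C) <= 1 - C by rewrite ler_piMl ?subr_ge0.
by lra.
Qed.

Lemma sin_pi_eq0 s : sin (pi * s) = 0 -> s \is a Num.int.
Proof.
move=> h; pose t := s - (Num.floor s)%:~R.
have t0 : 0 <= t by rewrite subr_ge0 floor_le.
have t1 : t < 1 by rewrite ltrBlDl -[X in _ + X]/(1%:~R) -intrD floorD1_gt.
have : sin (pi * t) = 0.
  rewrite /t mulrBr sinB h mul0r sub0r; suff -> : sin (pi * (Num.floor s)%:~R) = 0 :> R.
    by rewrite mulr0 oppr0.
  have nat0 (k : nat) : sin (pi * k%:R) = 0 :> R.
    elim: k => [|k IH]; first by rewrite mulr0 sin0.
    by rewrite -natr1 mulrDr mulr1 sinDpi IH oppr0.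
  case: (Num.floor s) => k; first exact: nat0.
  by rewrite NegzE intrN mulrN sinN nat0 oppr0.
have [t00|/eqP tn0] := eqVneq t 0.
  by move=> _; rewrite -(subrK (Num.floor s)%:~R s) -/t t00 add0r intr_int.
move=> st; have := @sin_gt0_pi R (pi * t).
rewrite st ltxx mulr_gt0 ?pi_gt0//=; last by rewrite lt_neqAle eq_sym t0 andbT; apply/eqP.
by rewrite -[X in _ < X]mulr1 ltr_pM2l ?pi_gt0// t1 => /(_ isT).
Qed.

Lemma cos_pi_eq1 s : cos (pi * s) ^+ 2 = 1 -> s \is a Num.int.
Proof.
move=> h; apply: sin_pi_eq0; apply/eqP; rewrite -sqrf_eq0.
by rewrite sin2cos2 h subrr.
Qed.

(** This is exp (- 2 pi i s), with the sign of [fchar]: [fchar xi y] is convertible to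
    [cis (dotp xi y)]. *)
Definition cis s : R[i] := (cos (2 * pi * s) -i* sin (2 * pi * s))%C.

Lemma cisD s t : cis (s + t) = cis s * cis t.
Proof.
apply/eqP; rewrite eq_complex ReM ImM /= mulrDr cosD sinD.
by apply/andP; split; apply/eqP; [ring|rewrite opprD mulrN mulNr addrC].
Qed.

Lemma cis0 : cis 0 = 1.
Proof. by rewrite /cis mulr0 cos0 sin0 oppr0. Qed.

Lemma cis_pow s n : cis s ^+ n = cis (n%:R * s).
Proof.
elim: n => [|n IH]; first by rewrite mul0r cis0 expr0.
by rewrite exprS IH -cisD -[in RHS]natr1 mulrDl mul1r addrC.
Qed.

Definition bincoef n i : R := 'C(2 * n, i)%:R / 4 ^+ n.

(** Binomial expansion of the 2n-th power of (cis (s / 2) + cis (- s / 2)) / 2; the power being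
    even, the half-integer frequencies combine to the integers n - i. *)
Lemma cos_pow_cis n s : ((cos (pi * s) ^+ (2 * n))%:C)%C =
  \sum_(i < (2 * n).+1) ((bincoef n i)%:C)%C * cis ((n%:R - i%:R) * s).
Proof.
have -> : ((cos (pi * s) ^+ (2 * n))%:C)%C =
    (((2%:R^-1 : R)%:C)%C * (cis (s / 2) + cis (- s / 2))) ^+ (2 * n).
  rewrite rmorphXn; congr (_ ^+ _); apply/eqP; rewrite eq_complex ReM ImM /=.
  have -> : 2 * pi * (s / 2) = pi * s by field.
  have -> : 2 * pi * (- s / 2) = - (pi * s) by field.
  by rewrite cosN sinN; apply/andP; split; apply/eqP; field.
rewrite exprMn exprDn mulr_sumr; apply: eq_bigr => i _.
rewrite !cis_pow -cisD -[cis _ *+ _]mulr_natl.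
have -> : (2 * n - i)%N%:R * (s / 2) + i%:R * (- s / 2) = (n%:R - i%:R) * s.
  by rewrite natrB; [rewrite natrM; field|rewrite -ltnS].
rewrite mulrA; congr (_ * _); rewrite /bincoef -rmorphXn -(rmorph_nat (real_complex R)) -rmorphM /=.
by congr (_%:C)%C; rewrite exprVn mulrC exprM; congr (_ / _ ^+ _); ring.
Qed.

Lemma bin_center_max n i : ('C(2 * n, i) <= 'C(2 * n, n))%N.
Proof.
have half k : (k <= n)%N -> ('C(2 * n, n - k) <= 'C(2 * n, n))%N.
  elim: k => [|k IH] kn; first by rewrite subn0.
  apply: leq_trans (IH (ltnW kn)).
  have := mul_bin_left (2 * n) (n - k.+1).
  have -> : (n - k.+1).+1 = (n - k)%N by lia.
  have -> : (2 * n - (n - k.+1) = n + k.+1)%N by lia.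
  move=> h; rewrite -(@leq_pmul2l (n - k)) ?subn_gt0// h leq_mul2r.
  by apply/orP; right; lia.
have [i_le|i_gt] := leqP i n.
  by rewrite -(subKn i_le); apply: half; rewrite leq_subr.
have [i2|i2] := leqP i (2 * n); last by rewrite bin_small.
rewrite -bin_sub//; have -> : (2 * n - i = n - (i - n))%N by lia.
by apply: half; lia.
Qed.

(** An integer form of C(2n, n) / 4^n <= (2n + 1)^(-1/2). In the induction the central coefficient
    is multiplied by 2(2n + 1)/(n + 1), and (2n + 1)(2n + 3) <= (2n + 2)^2. *)
Lemma bin_center_sqr n : ('C(2 * n, n) ^ 2 * (2 * n).+1 <= 16 ^ n)%N.
Proof.
elim: n => [|n IH]; first by rewrite bin0.
have e1 := mul_bin_diag (2 * n).+2 n.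
have e2 := mul_bin_down (2 * n).+1 n.
have -> : (2 * n.+1 = (2 * n).+2)%N by lia.
rewrite /= in e1 e2.
have {}e2 : (n.+1 * 'C((2 * n).+1, n) = (2 * n).+1 * 'C(2 * n, n))%N.
  by rewrite e2; congr (_ * _)%N; lia.
have : (n.+1 ^ 2 * 'C((2 * n).+2, n.+1) = (2 * n).+2 * (2 * n).+1 * 'C(2 * n, n))%N.
  by rewrite expnS expn1 -mulnA -e1 mulnCA e2 mulnA.
move: IH; rewrite (expnS 16); move: ('C(2 * n, n)) ('C((2 * n).+2, n.+1)) => a b IH h.
have {}h : (n.+1 * b = 2 * (2 * n).+1 * a)%N.
  apply/eqP; rewrite -(@eqn_pmul2l n.+1)//; apply/eqP.
  rewrite mulnA mulnn h; have -> : ((2 * n).+2 = 2 * n.+1)%N by lia.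
  by rewrite -!mulnA mulnCA.
rewrite -(@leq_pmul2l (n.+1 ^ 2)) ?expn_gt0// mulnA -expnMn h.
have -> : ((2 * (2 * n).+1 * a) ^ 2 * (2 * n).+3 =
  4 * ((2 * n).+1 * (2 * n).+3) * (a ^ 2 * (2 * n).+1))%N by ring.
have -> : (n.+1 ^ 2 * (16 * 16 ^ n) = 4 * (4 * n.+1 ^ 2) * 16 ^ n)%N by ring.
by apply: leq_mul => //; rewrite leq_mul2l /=; nia.
Qed.

Lemma bincoef_ge0 n i : 0 <= bincoef n i.
Proof. by rewrite divr_ge0// exprn_ge0. Qed.

(** The square exponent turns the decay n^(-1/2) of the largest coefficient into the rational
    1/m. *)
Lemma bincoef_le m i : (0 < m)%N -> bincoef (m ^ 2) i <= m%:R^-1.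
Proof.
move=> m0; have mp : 0 < m%:R :> R by rewrite ltr0n.
rewrite -[leRHS]mul1r ler_pdivlMr//.
apply: (@le_trans _ _ (bincoef (m ^ 2) (m ^ 2) * m%:R)).
  rewrite ler_pM2r// ler_pM2r ?invr_gt0 ?exprn_gt0// ler_nat.
  exact: bin_center_max.
rewrite -ler_sqr ?nnegrE ?mulr_ge0 ?bincoef_ge0// expr1n exprMn /bincoef.
rewrite expr_div_n mulrAC ler_pdivrMr ?exprn_gt0 ?exprn_gt0// mul1r.
rewrite -!natrX -natrM ler_nat.
have -> : ((4 ^ m ^ 2) ^ 2 = 16 ^ m ^ 2)%N by rewrite -expnM mulnC expnM.
apply: leq_trans (bin_center_sqr (m ^ 2)).
by rewrite leq_mul2l; apply/orP; right; lia.
Qed.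

End kernel_1d.

Section kernel.
Context {R : realType} {d : nat}.
Local Notation V := 'rV[R]_d.
Variable B : 'M[R]_d.
Hypothesis Bu : B \in unitmx.
Implicit Types (x y z xi : V) (u : V).

Lemma dotp_mulmx u y : dotp (u *m B) y = \sum_j u 0 j * dotp (row j B) y.
Proof.
rewrite /dotp; under eq_bigr do rewrite mxE mulr_suml.
rewrite exchange_big /=; apply: eq_bigr => j _; rewrite mulr_sumr.
by apply: eq_bigr => i _; rewrite mxE mulrA.
Qed.

Lemma fchar_mulmx u y : fchar (u *m B) y = \prod_j cis (u 0 j * dotp (row j B) y).
Proof.
transitivity (cis (dotp (u *m B) y)) => //.
by rewrite dotp_mulmx (big_morph _ cisD cis0).
Qed.

Lemma fcharNr xi y : fchar xi (- y) = fchar (- xi) y.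
Proof. by rewrite /fchar dotpNr dotpNl. Qed.

(* [kerb ^+ n] is a trigonometric polynomial with frequencies [kpt n k] and
   positive coefficients [kw n k]. *)
Definition kerb y : R := \prod_j cos (pi * dotp (row j B) y) ^+ 2.
Definition kw n (k : {ffun 'I_d -> 'I_(2 * n).+1}) : R :=
  \prod_j bincoef n (k j).
Definition kpt n (k : {ffun 'I_d -> 'I_(2 * n).+1}) : V :=
  (\row_j (n%:R - (k j)%:R)) *m B.

Lemma kerb_expand n y : (((kerb y ^+ n)%:C)%C : R[i]) =
  \sum_k ((kw k)%:C)%C * fchar (@kpt n k) y.
Proof.
transitivity (\prod_(j < d)
    ((cos (pi * dotp (row j B) y) ^+ (2 * n))%:C)%C : R[i]).
  rewrite /kerb -prodrXl rmorph_prod; apply: eq_bigr => j _.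
  by rewrite exprM.
under eq_bigr do rewrite cos_pow_cis.
rewrite bigA_distr_bigA; apply: eq_bigr => k _.
rewrite big_split /= /kw (rmorph_prod (real_complex R)) fchar_mulmx.
by congr (_ * _); apply: eq_bigr => j _; rewrite mxE.
Qed.

Lemma cos_sqr01 (t : R) : 0 <= cos t ^+ 2 <= 1.
Proof. by rewrite sqr_ge0 -real_normK ?num_real// expr_le1// cos_max. Qed.

Lemma kerb_ge0 y : 0 <= kerb y.
Proof. by apply: prodr_ge0 => j _; rewrite sqr_ge0. Qed.

Lemma kerb_le1 y : kerb y <= 1.
Proof. by apply: prodr_ile1 => j _; exact: cos_sqr01. Qed.

Lemma kerbN y : kerb (- y) = kerb y.
Proof. by apply: eq_bigr => j _; rewrite dotpNr mulrN cosN. Qed.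

Lemma kerb_eq1 y : kerb y = 1 -> forall j, dotp (row j B) y \is a Num.int.
Proof.
move=> k1 j; apply: cos_pi_eq1; apply/eqP; rewrite eq_le (andP (cos_sqr01 _)).2 /=.
rewrite -[leLHS]k1 /kerb (bigD1 j)//= ler_piMr ?sqr_ge0//.
by apply: prodr_ile1 => i _; exact: cos_sqr01.
Qed.

Lemma ccont_kerb n : ccont (fun y => ((kerb y ^+ n)%:C)%C).
Proof.
under eq_fun do rewrite kerb_expand; apply: ccont_sum => k.
by apply: ccontM; [exact: ccont_cst|exact: ccont_fchar].
Qed.

Lemma continuous_kerb n : continuous (fun y => kerb y ^+ n).
Proof. exact: (ccont_Re (ccont_kerb n)). Qed.

(** A character of x - y splits into one in x and one in y; the latter shifts the frequency at which
    the transform of [chi] is taken. *)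
Lemma kernel_convolution n W chi xi x : compact W -> ccsupp W chi ->
  integralC (fun y => chi y * fchar xi y * ((kerb (x - y) ^+ n)%:C)%C) =
  \sum_k ((kw k)%:C)%C * fourier chi (xi - @kpt n k) * fchar (@kpt n k) x.
Proof.
move=> cW sc; pose F (k : {ffun 'I_d -> 'I_(2 * n).+1}) y :=
  (((kw k)%:C)%C * fchar (kpt k) x) * (chi y * fchar (xi - kpt k) y).
have iF k : cintegrable (leb R d) (F k).
  apply: cintegrableZ; apply: (ccsupp_integrable cW).
  by apply: ccsuppM => //; exact: ccont_fchar.
transitivity (integralC (fun y => \sum_(k <- index_enum _) F k y)).
  congr integralC; apply/funext => y; rewrite kerb_expand mulr_sumr.
  apply: eq_bigr => k _; rewrite /F fcharDr fcharNr fcharD; ring.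
rewrite [LHS](cintegral_sum _ iF); apply: eq_bigr => k _.
rewrite [LHS]cintegralZ; last first.
  by apply: (ccsupp_integrable cW); apply: ccsuppM => //; exact: ccont_fchar.
by rewrite mulrAC.
Qed.

End kernel.

Section decay.
Context {R : realType}.

(** Each of the m terms q^i with i < m is at least q^m, and their geometric sum is at most 1 / (1 -
    q). *)
Lemma mulrn_exp_le (q : R) (m : nat) : 0 <= q -> q < 1 ->
  m%:R * q ^+ m <= (1 - q)^-1.
Proof.
move=> q0 q1; have q10 : 0 < 1 - q by rewrite subr_gt0.
rewrite -[leRHS]mul1r ler_pdivlMr// mulrC.
have h : m%:R * q ^+ m <= \sum_(i < m) q ^+ i.
  rewrite mulr_natl -[X in _ *+ X](card_ord m) -sumr_const.
  by apply: ler_sum => i _; apply: ler_wiXn2l => //; [exact: ltW|exact: ltnW].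
apply: (@le_trans _ _ ((1 - q) * \sum_(i < m) q ^+ i)).
  by rewrite ler_pM2l.
rewrite -opprB mulNr -subrX1 opprB lerBlDr lerDl; exact: exprn_ge0.
Qed.

(** Compares the kernel away from the dual vectors, at most q^n for some q < 1, with its mass, at
    least of order n^(-d/2); here n = (m + 1)^2. *)
Lemma pow_sqr_decay (q : R) (d : nat) : 0 <= q -> q < 1 ->
  forall e : R, 0 < e -> exists N, forall m, (N <= m)%N ->
  q ^+ (m.+1 ^ 2) * m.+1%:R ^+ d <= e.
Proof.
move=> q0 q1 e e0; have q10 : 0 < (1 - q)^-1 by rewrite invr_gt0 subr_gt0.
have q1n : `|q| < 1 by rewrite ger0_norm.
have /cvgrPdist_lt/(_ (e / (1 - q)^-1 ^+ d)) := cvg_expr q1n.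
rewrite divr_gt0// ?exprn_gt0// => /(_ isT)[N _ hN].
exists (maxn N d) => m; rewrite geq_max => /andP[Nm dm].
have := hN m.+1 (leqW Nm); rewrite /= sub0r normrN ger0_norm ?exprn_ge0// => qm.
(* For m >= d the exponent (m + 1)^2 contains d + 1 copies of m + 1: d of them absorb the power of m
   + 1, the last one tends to 0. *)
apply: (@le_trans _ _ ((m.+1%:R * q ^+ m.+1) ^+ d * q ^+ m.+1)).
  rewrite exprMn -mulrA mulrC ler_pM2l ?exprn_gt0// -exprM -exprD.
  by apply: ler_wiXn2l => //; [exact: ltW|nia].
apply: (@le_trans _ _ ((1 - q)^-1 ^+ d * q ^+ m.+1)).
  rewrite ler_wpM2r ?exprn_ge0// lerXn2r ?nnegrE ?mulr_ge0 ?exprn_ge0 ?(ltW q10)//.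
  exact: mulrn_exp_le.
by rewrite mulrC -ler_pdivlMr ?exprn_gt0// ltW.
Qed.

End decay.

(** * Mass and concentration of the kernel *)

Section kernel_mass.
Context {R : realType} {d : nat}.
Local Notation V := 'rV[R]_d.
Variable B : 'M[R]_d.
Hypothesis Bu : B \in unitmx.
Implicit Types (x y z xi : V) (W : set V).
Local Notation kerb := (kerb B).

(* [kbeta] bounds the maps [y -> b_j . y], so that 0 is the only dual vector in
   the ball of radius [krad]. *)
Definition kbeta : R := 1 + \sum_(j < d) d%:R * `|row j B|.
Definition krad : R := (2 * kbeta)^-1.
Definition krho : R := (8 * kbeta)^-1.

Lemma kbeta_gt0 : 0 < kbeta.
Proof. by rewrite ltr_wpDr// sumr_ge0// => j _; rewrite mulr_ge0. Qed.

Lemma dotp_row_le j y : `|dotp (row j B) y| <= kbeta * `|y|.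
Proof.
apply: le_trans (dotp_norm_le _ _) _; rewrite mulrA ler_wpM2r//.
rewrite /kbeta (bigD1 j)//= addrCA lerDl addr_ge0// sumr_ge0// => i _.
Qed.

Lemma krad_gt0 : 0 < krad.
Proof. by rewrite invr_gt0 mulr_gt0// kbeta_gt0. Qed.

Lemma krho_gt0 : 0 < krho.
Proof. by rewrite invr_gt0 mulr_gt0// kbeta_gt0. Qed.

Lemma dotp_rows_eq0 z : (forall j, dotp (row j B) z = 0) -> z = 0.
Proof.
move=> z0; apply/trmx_inj; rewrite trmx0 -(mulKmx Bu z^T); suff -> : B *m z^T = 0.
  by rewrite mulmx0.
apply/colP => j; rewrite !mxE -[RHS](z0 j); apply: eq_bigr => i _.
by rewrite !mxE.
Qed.

Lemma krad_sep z : `|z| <= krad ->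
  (forall j, dotp (row j B) z \is a Num.int) -> z = 0.
Proof.
move=> zr zint; have z0 j : dotp (row j B) z = 0.
  apply/eqP; move: (zint j) => /intrP[k E]; move: (dotp_row_le j z); rewrite E.
  move=> kz; have : `|k%:~R| < 1 :> R.
    apply: le_lt_trans kz _; apply: (@le_lt_trans _ _ (kbeta * krad)).
      by rewrite ler_pM2l// kbeta_gt0.
    rewrite /krad invfM mulrCA mulfV ?gt_eqF ?kbeta_gt0//; lra.
  by rewrite -intr_norm -[X in _ < X]/(1%:~R) ltr_int intr_eq0; lia.
exact: dotp_rows_eq0.
Qed.

(** The kernel is periodic under the dual lattice, so it is normalised by its mass near the single
    dual vector 0. *)
Definition kA n : R :=
  \int[leb R d]_y (kerb y ^+ n * \1_[set y : V | `|y| < krad] y).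

Lemma kerbX01 n y : 0 <= kerb y ^+ n <= 1.
Proof. by rewrite exprn_ge0 ?kerb_ge0//= exprn_ile1 ?kerb_ge0 ?kerb_le1. Qed.

Lemma measurable_ball_indic (s : R) :
  measurable_fun [set: lebT R d] (\1_[set y : V | `|y| < s] : lebT R d -> R).
Proof. by apply: measurable_indic; exact: leb_ball0_measurable. Qed.

Lemma integrable_kerb n (s : R) : 0 < s ->
  (leb R d).-integrable setT
    (EFin \o (fun y => kerb y ^+ n * \1_[set y : V | `|y| < s] y)).
Proof.
move=> s0; have mr := @leb_ball0_measurable R d s.
have rfin := @leb_ball0_fin R d s s0.
apply: (integrable_bounded (M := 1) mr rfin).
  apply: measurable_funM; last exact: measurable_ball_indic.
  exact: (continuous_leb (@continuous_kerb R d B n)).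
move=> x; have /andP[k0 k1] := kerbX01 n x.
by rewrite normrM !ger0_norm// ler_wpM2r.
Qed.

Lemma kA_shift n x :
  \int[leb R d]_y (kerb (x - y) ^+ n * \1_[set y : V | `|y - x| < krad] y) =
  kA n.
Proof.
pose F y : \bar R := (kerb y ^+ n * \1_[set y : V | `|y| < krad] y)%:E.
have mF : measurable_fun [set: lebT R d] (F : lebT R d -> \bar R).
  exact: (measurable_int _ (integrable_kerb n krad_gt0)).
congr fine; rewrite -[RHS](integral_leb_shift (- x) mF); apply: eq_integral => y _.
by rewrite /F -(opprB y x) kerbN.
Qed.

(** On the cube of radius krho / m each of the d factors of the kernel is at least 1/2, and the
    volume (2 krho / m)^d compensates 2^-d. *)
Lemma kA_ge m : (0 < m)%N -> (krho / m%:R) ^+ d <= kA (m ^ 2).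
Proof.
move=> m0; have mp : 0 < m%:R :> R by rewrite ltr0n.
have s0 : 0 < krho / m%:R by rewrite divr_gt0// krho_gt0.
set s := krho / m%:R in s0 *.
have sr : s <= krad.
  rewrite ler_pdivrMr// (@le_trans _ _ krad)//.
    by rewrite lef_pV2 ?posrE ?mulr_gt0 ?kbeta_gt0// ler_pM2r ?kbeta_gt0//; lra.
  by rewrite ler_peMr ?(ltW krad_gt0)// ler1n.
have := leb_ball0 d s0 => vs.
have -> : s ^+ d = \int[leb R d]_y (2^-1 ^+ d * \1_[set y : V | `|y| < s] y).
  rewrite RintegralZl//; last exact: integrable_indic_fin (leb_ball0_measurable s) (leb_ball0_fin d s0).
  rewrite /Rintegral integral_indic ?setIT//; last exact: leb_ball0_measurable.
  by rewrite vs /= -exprMn -[s *+ 2]mulr_natl mulKf.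
apply: le_Rintegral => //.
- apply: (@integrable_bounded _ (lebT R d) R (leb R d) _ _ (2^-1 ^+ d)
    (leb_ball0_measurable s) (leb_ball0_fin d s0)).
    by apply: measurable_funM; [exact: measurable_cst|exact: measurable_ball_indic].
  by move=> x; rewrite ger0_norm ?mulr_ge0 ?exprn_ge0// invr_ge0.
- exact: integrable_kerb krad_gt0.
move=> y _; rewrite !indicE; have [ys|ys] := boolP (y \in [set y : V | `|y| < s]).
  have ys' : `|y| < s by rewrite inE in ys.
  rewrite [y \in _]mem_set /= ?mulr1; last exact: lt_le_trans sr.
  rewrite /kerb -prodrXl -[X in _ ^+ X]card_ord -prodr_const; apply: ler_prod => j _.
  rewrite invr_ge0 ler0n /= -exprM; apply: le_trans (cos_pow_ge _ _).
  (* The 8 in [krho] is used here: with pi < 4 the angle is at most 1 / (2 m), so the factor is at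
     least 1 - 1/4. *)
  have bs : `|dotp (row j B) y| <= (8 * m%:R)^-1.
    apply: le_trans (dotp_row_le j y) _.
    apply: (@le_trans _ _ (kbeta * s)); first by rewrite ler_pM2l ?kbeta_gt0// ltW.
    rewrite /s /krho !invfM mulrA mulrCA mulfV ?gt_eqF ?kbeta_gt0// mulr1.
    by [].
  have p4 : pi < 4 :> R by have := @pihalf_lt2 R; lra.
  have p0 := @pi_gt0 R.
  have : (pi * dotp (row j B) y) ^+ 2 <= (4 * (8 * m%:R)^-1) ^+ 2.
    rewrite -real_normK ?num_real// ler_sqr ?nnegrE ?mulr_ge0 ?invr_ge0//.
    rewrite normrM (ger0_norm (ltW p0)); apply: ler_pM => //; exact: ltW.
  set T := (pi * _) ^+ 2 => hT.
  have : (m ^ 2)%:R * T <= (m ^ 2)%:R * (4 * (8 * m%:R)^-1) ^+ 2 by rewrite ler_wpM2l.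
  rewrite natrX; have -> : m%:R ^+ 2 * (4 * (8 * m%:R)^-1) ^+ 2 = 4^-1 :> R.
    by field; rewrite gt_eqF.
  by lra.
by rewrite mulr0 mulr_ge0//; have /andP[] := kerbX01 (m ^ 2) y.
Qed.

Lemma kA_gt0 m : 0 < kA (m.+1 ^ 2).
Proof. by apply: lt_le_trans (kA_ge (ltn0Sn m)); rewrite exprn_gt0// divr_gt0// krho_gt0. Qed.

Lemma kw_ge0 n k : 0 <= @kw R d n k.
Proof. by apply: prodr_ge0 => j _; exact: bincoef_ge0. Qed.

(** Coefficients and mass are both compared with (m + 1)^-d, so the dependence on m cancels. *)
Lemma kw_kA_le m k : @kw R d (m.+1 ^ 2) k / kA (m.+1 ^ 2) <= krho^-1 ^+ d.
Proof.
rewrite ler_pdivrMr ?kA_gt0//.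
have mp : 0 < m.+1%:R :> R by rewrite ltr0n.
apply: (@le_trans _ _ (krho^-1 ^+ d * (krho / m.+1%:R) ^+ d)); last first.
  have r0 : 0 <= krho^-1 ^+ d by rewrite exprn_ge0// invr_ge0 ltW// krho_gt0.
  by rewrite ler_wpM2l// (kA_ge (ltn0Sn m)).
rewrite -exprMn mulKf ?gt_eqF ?krho_gt0// /kw.
rewrite -[X in _ ^+ X]card_ord -prodr_const; apply: ler_prod => j _.
by rewrite bincoef_ge0 bincoef_le.
Qed.

(** The kernel base attains its maximum on the compact set of these z. The value 1 would make z pair
    integrally with all rows of [B], which [sepx] excludes on x - W and [krad_sep] in the
    normalising ball. *)
Lemma compact_separation W x (r1 : R) : compact W ->
  (forall y, W y -> (forall j, dotp (row j B) (x - y) \is a Num.int) -> x = y) ->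
  0 < r1 -> exists q : R, [/\ 0 <= q, q < 1 & forall z, r1 <= `|z| ->
    W (x - z) \/ `|z| <= krad -> kerb z <= q].
Proof.
move=> cW sepx r10.
have clW : closed W by apply: compact_closed => //; exact: norm_hausdorff.
have [rW rW0 WrW] := compact_norm_bounded cW.
pose Z := [set z : V | r1 <= `|z| /\ (W (x - z) \/ `|z| <= krad)].
have Zc : compact Z.
  apply: bounded_closed_compact.
    exists (`|x| + rW + krad); split; first exact: num_real.
    move=> M hM z [_ [Wz|zr]]; apply: ltW; apply: le_lt_trans hM.
      rewrite -(subKr x z) (le_trans (ler_normB _ _))// -addrA lerD2l.
      by rewrite ler_wpDr ?(ltW krad_gt0)// ltW// WrW.
    by rewrite ler_wpDl// addr_ge0// ltW.
  rewrite -[Z]setCK; apply: open_closedC; apply: openP_norm => z /= Zz.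
  have [zr1|zr1] := ltP `|z| r1.
    exists (r1 - `|z|); first by rewrite subr_gt0.
    move=> y yz [yr _]; move: yz; apply/negP; rewrite -leNgt.
    by rewrite (le_trans _ (lerB_dist _ _))// lerD2r.
  have zW : ~ W (x - z) by move=> Wz; apply: Zz; split => //; left.
  have zr : krad < `|z| by rewrite ltNge; apply/negP => zr; apply: Zz; split => //; right.
  have [e1 e10 he1] := open_ball_norm (closed_openC clW) zW.
  exists (Num.min e1 (`|z| - krad)); first by rewrite lt_min e10 subr_gt0.
  move=> y; rewrite lt_min => /andP[ye1 yr] [_ [Wy|yr']].
    apply: (he1 (x - y) _ Wy).
    by rewrite opprB addrC addrA subrK distrC.
  move: yr; apply/negP; rewrite -leNgt distrC (le_trans _ (lerB_dist _ _))//.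
  by rewrite lerD2l lerN2.
have [Z0|/set0P Z0] := eqVneq Z set0.
  exists 0; split=> // z zr hz; exfalso.
  have : Z z by []. by rewrite Z0.
have cf : {within Z, continuous (fun y => kerb y ^+ 1)}.
  by apply: continuous_subspaceT; exact: continuous_kerb.
have [c cZ hc] := EVT_max_rV Z0 Zc cf.
exists (kerb c); split; first exact: kerb_ge0.
  rewrite lt_neqAle kerb_le1 andbT; apply/negP => /eqP /kerb_eq1 cint.
  rewrite inE in cZ; case: cZ => cr [Wc|cr'].
    have xc : x = x - c by apply: sepx => // j; rewrite subKr; exact: cint.
    have c0 : c = 0 by rewrite -[LHS](subKr x) -xc subrr.
    by move: cr; rewrite c0 normr0 leNgt r10.
  by move: cr; rewrite (krad_sep cr' cint) normr0 leNgt r10.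
move=> z zr hz; have := hc z; rewrite !expr1; apply.
by rewrite inE.
Qed.

End kernel_mass.

(** * The kernel as an approximate identity *)

Section kernel_limit.
Context {R : realType} {d : nat}.
Local Notation V := 'rV[R]_d.
Variable B : 'M[R]_d.
Hypothesis Bu : B \in unitmx.
Implicit Types (x y z xi : V) (W K : set V).
Local Notation kerb := (kerb B).
Local Notation kA := (kA B).
Local Notation krad := (krad B).
Local Notation krho := (krho B).

Lemma cintegral_real (F : V -> R) :
  cintegral (leb R d) (fun y => ((F y)%:C)%C) = ((\int[leb R d]_y F y)%:C)%C.
Proof. by rewrite /cintegral /=; congr Complex; rewrite Rintegral_cst ?mul0r. Qed.

Lemma ccont_kerb_reflect n x :
  ccont (fun y => ((kerb (x - y) ^+ n)%:C)%C).
Proof.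
under eq_fun do rewrite -opprB kerbN.
exact: (ccont_shift (- x) (ccont_kerb B n)).
Qed.

(** The integral is compared with g(x) times the mass on the ball of radius [krad] around x. Within
    r1 of x continuity of [g] controls the difference; elsewhere it is at most 2 M q^n on a set of
    bounded volume, negligible against the mass. *)
Lemma kernel_limit W x (g : V -> R[i]) : compact W -> ccsupp W g ->
  (forall y, W y -> (forall j, dotp (row j B) (x - y) \is a Num.int) -> x = y) ->
  forall e : R, 0 < e -> exists N, forall m, (N <= m)%N ->
  normc ((((kA (m.+1 ^ 2))^-1)%:C)%C *
    integralC (fun y => g y * ((kerb (x - y) ^+ (m.+1 ^ 2))%:C)%C) - g x) <= e.
Proof.
move=> cW sg sepx e e0.
have [rW [M [rW0 M0 WrW gM1]]] := ccsupp_bound cW sg.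
have gM y : normc (g y) <= M.
  by apply: le_trans (gM1 y) _; rewrite ler_piMr// indicE lern1 leq_b1.
have e4 : 0 < e / 4 by rewrite divr_gt0.
have [r0 r00 hr0] := proj1 sg x _ e4.
have kr0 : 0 < krad by exact: krad_gt0.
pose r1 := Num.min r0 krad; have r10 : 0 < r1 by rewrite lt_min r00 kr0.
have [q [q0 q1 hq]] := compact_separation Bu cW sepx r10.
pose R1 := rW + `|x| + krad.
have R10 : 0 < R1 by rewrite ltr_wpDl// addr_ge0// ltW.
pose vol := ((R1 *+ 2) ^+ d).
have vol0 : 0 <= vol by rewrite exprn_ge0// mulrn_wge0// ltW.
pose D := krho^-1 ^+ d; have D0 : 0 <= D by rewrite exprn_ge0// invr_ge0 ltW// krho_gt0.
(* With q^n <= e' * D * kA n, the far part 4 * M * vol * q^n is at most (e / 2) * kA n; the added 1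
   keeps the denominator positive. *)
pose e' := (e / 2) / (4 * M * vol * D + 1).
have den : 0 < 4 * M * vol * D + 1 by rewrite ltr_wpDl// !mulr_ge0.
have e'0 : 0 < e' by rewrite !divr_gt0.
have [N hN] := pow_sqr_decay d q0 q1 e'0; exists N => m /hN.
set n := (m.+1 ^ 2)%N => qn.
have A0 : 0 < kA n by exact: kA_gt0.
pose k y := kerb (x - y) ^+ n.
have k01 y : 0 <= k y <= 1 by exact: kerbX01.
pose Dx := [set y : V | `|y - x| < krad].
have mDx : measurable (Dx : set (lebT R d)) by exact: leb_ball_measurable.
have Dxfin : (leb R d Dx < +oo)%E by rewrite leb_ball// ltry.
have mR1 := @leb_ball0_measurable R d R1; have R1fin := leb_ball0_fin d R10.
have ckx := ccont_kerb_reflect n x.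
have ikI : (leb R d).-integrable setT (EFin \o (fun y => k y * \1_Dx y)).
  apply: (integrable_bounded (M := 1) mDx Dxfin).
    apply: measurable_funM; last exact: measurable_indic.
    exact: (continuous_leb (ccont_Re ckx)).
  move=> y; have /andP[k0 k1] := k01 y.
  by rewrite normrM !ger0_norm// ler_wpM2r.
have i1 : cintegrable (leb R d) (fun y => g y * ((k y)%:C)%C).
  exact: (ccsupp_integrable cW (ccsuppM sg ckx)).
have i2 : cintegrable (leb R d) (fun y => ((k y * \1_Dx y)%:C)%C).
  by split => //=; exact: integrable0.
have i3 := cintegrableZ (- g x) i2.
have ih := cintegrableD i1 i3.
have hE : cintegral (leb R d) (fun y => g y * ((k y)%:C)%C +
    - g x * ((k y * \1_Dx y)%:C)%C) =
    integralC (fun y => g y * ((k y)%:C)%C) - g x * ((kA n)%:C)%C.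
  by rewrite cintegralD// cintegralZ// cintegral_real kA_shift mulNr.
pose G y := e / 4 * (k y * \1_Dx y) + 2 * M * q ^+ n * \1_[set y : V | `|y| < R1] y.
have iG1 : (leb R d).-integrable setT (EFin \o (fun y => e / 4 * (k y * \1_Dx y))).
  by rewrite /comp; under eq_fun do rewrite EFinM; exact: integrableZl.
have iR1 := integrable_indic_fin mR1 R1fin.
have iG2 : (leb R d).-integrable setT (EFin \o
    (fun y => 2 * M * q ^+ n * \1_[set y : V | `|y| < R1] y)).
  by rewrite /comp; under eq_fun do rewrite EFinM; exact: integrableZl.
have iG : (leb R d).-integrable setT (EFin \o G).
  by rewrite /comp /G; under eq_fun do rewrite EFinD; exact: integrableD.
have GE : \int[leb R d]_y G y = e / 4 * kA n + 2 * M * q ^+ n * vol.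
  rewrite /G RintegralD// RintegralZl// RintegralZl// kA_shift.
  congr (_ + _ * _); rewrite /Rintegral integral_indic ?setIT//.
  by rewrite leb_ball0.
have hG y : normc (g y * ((k y)%:C)%C + - g x * ((k y * \1_Dx y)%:C)%C) <= G y.
  have /andP[k0 k1] := k01 y.
  have -> : g y * ((k y)%:C)%C + - g x * ((k y * \1_Dx y)%:C)%C =
      (g y - g x * ((\1_Dx y)%:C)%C) * ((k y)%:C)%C.
    by rewrite rmorphM /=; ring.
  rewrite normcM normc_real (ger0_norm k0) /G.
  have G20 : 0 <= 2 * M * q ^+ n * \1_[set y : V | `|y| < R1] y.
    by rewrite !mulr_ge0// exprn_ge0.
  have G10 : 0 <= e / 4 * (k y * \1_Dx y) by rewrite !mulr_ge0// ltW.
  have [yr|yr] := ltP `|y - x| r1.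
    have yD : Dx y by rewrite /Dx /=; apply: lt_le_trans yr _; rewrite ge_min lexx orbT.
    have I1 : \1_Dx y = 1 :> R by rewrite indicE mem_set.
    rewrite I1 !mulr1.
    rewrite -[leLHS]addr0 lerD// ler_wpM2r// ltW// hr0//.
    by apply: lt_le_trans yr _; rewrite ge_min lexx.
  have [WD|WD] := pselect (W y \/ `|y - x| <= krad).
    have yR1 : [set y : V | `|y| < R1] y.
      rewrite /= /R1; case: WD => [/WrW Wy|yk].
        by rewrite (lt_le_trans Wy)// -addrA lerDl addr_ge0// ltW.
      rewrite -(subrK x y) (le_lt_trans (ler_normD _ _))//.
      by have := yk; lra.
    rewrite (@le_trans _ _ (2 * M * q ^+ n * \1_[set y : V | `|y| < R1] y))//; last first.
      by rewrite lerDr.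
    rewrite [X in _ <= _ * X]indicE (mem_set yR1) mulr1 ler_pM ?normc_ge0//.
      apply: le_trans (le_normcD _ _) _; rewrite normcN normcM normc_real mulr_natl mulr2n.
      have I1 : `|\1_Dx y : R| <= 1 by rewrite ger0_norm// indicE lern1 leq_b1.
      apply: lerD; first exact: gM.
      by rewrite (le_trans _ (gM x))// ler_piMr ?normc_ge0.
    rewrite /k lerXn2r ?nnegrE ?kerb_ge0//; apply: hq; first by rewrite distrC.
    by rewrite subKr distrC.
  have gy : g y = 0.
    by apply/eqP; apply: contra_notT WD => /(proj2 sg) Wy; left.
  have I0 : \1_Dx y = 0 :> R.
    rewrite indicE memNset//; rewrite /Dx /= => yD; apply: WD; right; exact: ltW.
  rewrite gy I0 (_ : (0%:C)%C = 0 :> R[i])// mulr0 subr0 normc0 mul0r.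
  by rewrite mulr0 mulr0 add0r.
have := normc_cintegral_le ih iG hG; rewrite hE GE => hfin.
have -> : (((kA n)^-1)%:C)%C * integralC (fun y => g y * ((k y)%:C)%C) - g x =
    (((kA n)^-1)%:C)%C * (integralC (fun y => g y * ((k y)%:C)%C) - g x * ((kA n)%:C)%C).
  rewrite mulrBr; congr (_ - _); rewrite mulrCA -(rmorphM (real_complex R)) mulVf ?gt_eqF//.
  by rewrite (rmorph1 (real_complex R)) mulr1.
rewrite normcM normc_real ger0_norm ?invr_ge0 ?(ltW A0)//.
rewrite mulrC ler_pdivrMr//; apply: le_trans hfin _.
have Age : (krho / m.+1%:R) ^+ d <= kA n by exact: (kA_ge B (ltn0Sn m)).
have qA : q ^+ n <= e' * D * kA n.
  apply: (@le_trans _ _ (e' * (D * (krho / m.+1%:R) ^+ d))); last first.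
    by rewrite -mulrA ler_pM2l// ler_wpM2l.
  rewrite /D -exprMn mulKf ?gt_eqF ?krho_gt0// exprVn ler_pdivlMr//.
have : 4 * M * vol * q ^+ n <= 4 * M * vol * (e' * D * kA n).
  by rewrite ler_wpM2l// !mulr_ge0.
have : e' * (4 * M * vol * D + 1) = e / 2 by rewrite /e' mulfVK// gt_eqF.
have : 0 <= e' * kA n by rewrite mulr_ge0 ?ltW.
move: (kA n) (q ^+ n) => A Q p1 p2 p3.
have p4 : e' * (4 * M * vol * D + 1) * A = e / 2 * A by rewrite p2.
by lra.
Qed.

End kernel_limit.

(** * Lattice sums *)

Section lattice_sums.
Context {R : realType}.

(** The bounded function u / (1 + |u|) is a primitive of (1 + |u|)^-2; the factor 2 pays for
    replacing the derivative by an increment over a unit step. *)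
Lemma inv_sqr_telescope (u : R) :
  (1 + `|u|) ^- 2 <= 2 * ((u + 1) / (1 + `|u + 1|) - u / (1 + `|u|)).
Proof.
have a0 : 0 < 1 + `|u| by rewrite ltr_pwDl.
have b0 : 0 < 1 + `|u + 1| by rewrite ltr_pwDl.
have -> : (u + 1) / (1 + `|u + 1|) - u / (1 + `|u|) =
  ((u + 1) * (1 + `|u|) - u * (1 + `|u + 1|)) / ((1 + `|u + 1|) * (1 + `|u|)).
  by field; rewrite !gt_eqF.
rewrite mulrA ler_pdivlMr ?mulr_gt0// mulrC ler_pdivrMr ?exprn_gt0//.
have [u0|u0] := leP 0 u.
  rewrite !ger0_norm//; last lra.
  by nra.
have [u1|u1] := leP u (-1).
  rewrite !ler0_norm//; [by nra|lra|lra].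
have -> : `|u + 1| = u + 1 by rewrite gtr0_norm//; lra.
have uE : `|u| = - u by rewrite ltr0_norm.
rewrite uE in a0 *.
have key : 1 + (u + 1) <= 2 * ((u + 1) * (1 + - u) - u * (1 + (u + 1))) * (1 + - u).
  have : 0 <= (- u) * (1 - u ^+ 2) by rewrite mulr_ge0 ?oppr_ge0 ?(ltW u0)//; nra.
  by lra.
by have := ler_wpM2r (ltW a0) key; lra.
Qed.

Lemma inv_sqr_sum (u : R) (N : nat) :
  \sum_(i < N) (1 + `|u + i%:R|) ^- 2 <= 4.
Proof.
pose G (v : R) := v / (1 + `|v|).
have G1 v : `|G v| <= 1.
  rewrite /G normrM normfV (@ger0_norm _ (1 + `|v|)) ?addr_ge0//.
  by rewrite ler_pdivrMr ?ltr_pwDl// mul1r lerDr.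
have h : \sum_(i < N) (1 + `|u + i%:R|) ^- 2 <= 2 * (G (u + N%:R) - G u).
  elim: N => [|N IH]; first by rewrite big_ord0 addr0 subrr mulr0.
  rewrite big_ord_recr /=; have := inv_sqr_telescope (u + N%:R).
  by rewrite -(natr1 N) addrA -/(G _) -/(G _); lra.
apply: le_trans h _; have := G1 (u + N%:R); have := G1 u.
by rewrite !ler_norml => /andP[a b] /andP[c e]; lra.
Qed.

Context {d : nat}.
Local Notation V := 'rV[R]_d.

(** The exponent 2d leaves one summable factor (1 + |z_j|)^-2 for each of the d coordinates in any
    basis, see [wt_lattice]. *)
Definition wt (z : V) : R := (1 + `|z|) ^- (2 * d).

Lemma wt_gt0 z : 0 < wt z.
Proof. by rewrite invr_gt0 exprn_gt0// ltr_pwDl. Qed.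

Lemma wt_le1 z : wt z <= 1.
Proof. by rewrite invf_le1 ?exprn_gt0 ?ltr_pwDl// exprn_ege1// lerDl. Qed.

Lemma wt_lattice (B : 'M[R]_d) : B \in unitmx -> exists2 C : R, 0 < C &
  forall z, wt z <= C * \prod_j (1 + `|(z *m invmx B) 0 j|) ^- 2.
Proof.
move=> Bu; pose c : R := 1 + \sum_i \sum_j `|invmx B i j|.
have c1 : 1 <= c by rewrite lerDl sumr_ge0// => i _; rewrite sumr_ge0.
have c0 : 0 < c by exact: lt_le_trans c1.
have h (z : V) j : `|(z *m invmx B) 0 j| <= c * `|z|.
  rewrite mxE (le_trans (ler_norm_sum _ _ _))//.
  apply: (@le_trans _ _ (\sum_i `|invmx B i j| * `|z|)).
    apply: ler_sum => i _; rewrite normrM [leRHS]mulrC.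
    by apply: ler_wpM2r => //; exact: rV_norm_coord.
  rewrite -mulr_suml ler_wpM2r// (@le_trans _ _ (\sum_i \sum_j `|invmx B i j|))//.
    by apply: ler_sum => i _; rewrite (bigD1 j)//= lerDl sumr_ge0.
  by rewrite lerDr.
exists (c ^+ (2 * d)) => [|z]; first exact: exprn_gt0.
have -> : \prod_j (1 + `|(z *m invmx B) 0 j|) ^- 2 =
    (\prod_j (1 + `|(z *m invmx B) 0 j|) ^+ 2)^-1.
  by rewrite (big_morph _ (@invfM R) (@invr1 R)).
have p0 : 0 < \prod_j (1 + `|(z *m invmx B) 0 j|) ^+ 2.
  by apply: prodr_gt0 => j _; rewrite exprn_gt0// ltr_pwDl.
rewrite ler_pdivlMr// /wt mulrC ler_pdivrMr ?exprn_gt0 ?ltr_pwDl//.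
rewrite -exprMn exprM -[X in _ ^+ X]card_ord -prodr_const.
apply: ler_prod => j _; rewrite exprn_ge0 ?addr_ge0//=.
rewrite lerXn2r ?nnegrE ?addr_ge0 ?mulr_ge0 ?(ltW c0)//.
by rewrite mulrDr mulr1 lerD.
Qed.

(** Over a box of indices, the sum of products is a product of d one-dimensional sums, each at most
    4 whatever the offset. *)
Lemma wt_box_sum (B : 'M[R]_d) : B \in unitmx -> exists2 S : R, 0 < S &
  forall n z, \sum_k wt (z - @kpt R d B n k) <= S.
Proof.
move=> Bu; have [C C0 hC] := wt_lattice Bu.
exists (C * 4 ^+ d) => [|n z]; first by rewrite mulr_gt0// exprn_gt0.
pose t := z *m invmx B.
apply: (@le_trans _ _ (\sum_(k : {ffun 'I_d -> 'I_(2 * n).+1})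
   C * \prod_j (1 + `|(t 0 j - n%:R) + (k j)%:R|) ^- 2)).
  apply: ler_sum => k _; apply: le_trans (hC _) _; rewrite ler_pM2l//.
  rewrite le_eqVlt; apply/orP; left; apply/eqP; apply: eq_bigr => j _.
  rewrite mulmxBl /kpt mulmxK// !mxE -/t.
  by rewrite opprB addrCA addrA [(k j)%:R + _]addrC addrAC.
rewrite -mulr_sumr ler_pM2l//.
rewrite -(bigA_distr_bigA (fun j (i : 'I_(2 * n).+1) =>
  (1 + `|(t 0 j - n%:R) + i%:R|) ^- 2)).
rewrite -[X in _ <= _ ^+ X]card_ord -prodr_const; apply: ler_prod => j _.
rewrite inv_sqr_sum andbT sumr_ge0// => i _.
Qed.

End lattice_sums.

Section weight_decay.
Context {R : realType} {d : nat}.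
Local Notation V := 'rV[R]_d.
Variable om : V -> R.
Hypothesis hom : weight_assumptions om.

Lemma om_decay : exists kap C : R, [/\ 0 < kap, 0 < C &
  forall z, expR (- (kap * om z)) <= C * wt z].
Proof.
(* The rate N / c turns the logarithmic lower bound into the power -N of 1 + |z|; the extra 1 keeps
   the rate positive for d = 0. *)
have [a [c [c0 hac]]] := om_gamma hom; pose N := (2 * d).+1.
exists (N%:R / c), (expR (- (N%:R / c * a))).
split; [by rewrite divr_gt0// ltr0n|exact: expR_gt0|move=> z].
have z1 : 0 < 1 + enorm z by rewrite ltr_pwDl// sqrtr_ge0.
apply: (@le_trans _ _ (expR (- (N%:R / c * a)) * (1 + enorm z) ^- N)).
  rewrite -[X in X ^- N]lnK ?posrE// -expRM_natl -expRN -expRD ler_expR.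
  rewrite -opprD lerN2; apply: (@le_trans _ _ (N%:R / c * (a + c * ln (1 + enorm z)))).
    by rewrite mulrDr lerD2l mulrA mulfVK// gt_eqF.
  by rewrite ler_pM2l ?divr_gt0 ?ltr0n.
rewrite ler_pM2l ?expR_gt0// /wt lef_pV2 ?posrE ?exprn_gt0// ?ltr_pwDl//.
apply: (@le_trans _ _ ((1 + enorm z) ^+ (2 * d))).
  rewrite lerXn2r ?nnegrE ?addr_ge0 ?sqrtr_ge0// lerD2l; exact: norm_le_enorm.
by rewrite ler_weXn2l// lerDl sqrtr_ge0.
Qed.

End weight_decay.

(** * Products as limits of sums over a lattice *)

Section poisson.
Context {R : realType} {d : nat}.
Local Notation V := 'rV[R]_d.
Variable om : V -> R.
Hypothesis hom : weight_assumptions om.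
Implicit Types (phi chi : V -> R[i]) (K W Om : set V).

Section expansion.
Variable B : 'M[R]_d.
Hypothesis Bu : B \in unitmx.

Definition separated K W := forall x y, K x -> W y ->
  (forall j, dotp (row j B) (x - y) \is a Num.int) -> x = y.

Definition rho m (k : {ffun 'I_d -> 'I_(2 * m.+1 ^ 2).+1}) : R :=
  kw k / kA B (m.+1 ^ 2).

Lemma rho_ge0 m k : 0 <= @rho m k.
Proof. by rewrite divr_ge0 ?kw_ge0// ltW// kA_gt0. Qed.

(* By [kernel_convolution] this is [phi] times the convolution of [chi e_xi]
   with the normalised kernel, [e_xi] the character of frequency [xi]. *)
Definition poisson_sum phi chi xi m : V -> R[i] := fun x =>
  \sum_(k <- index_enum {ffun 'I_d -> 'I_(2 * m.+1 ^ 2).+1})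
    (((rho k)%:C)%C * fourier chi (xi - kpt B k)) * (phi x * fchar (kpt B k) x).

(** Both terms vanish where [phi] does; elsewhere x lies in [K], and separation is the hypothesis of
    [kernel_limit]. *)
Lemma poisson_sum_cvg K W phi chi xi : compact W -> separated K W ->
  ccsupp K phi -> ccsupp W chi -> forall x,
  (fun m => normc (poisson_sum phi chi xi m x - phi x * (chi x * fchar xi x)))
    @ \oo --> (0 : R).
Proof.
move=> cW sep sp sc x.
have sg : ccsupp W (fun y => chi y * fchar xi y).
  by apply: ccsuppM => //; exact: ccont_fchar.
have E m : poisson_sum phi chi xi m x - phi x * (chi x * fchar xi x) =
    phi x * ((((kA B (m.+1 ^ 2))^-1)%:C)%C * integralC (fun y =>
      chi y * fchar xi y * ((kerb B (x - y) ^+ (m.+1 ^ 2))%:C)%C) -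
      chi x * fchar xi x).
  rewrite (kernel_convolution _ _ _ _ cW sc) mulrBr; congr (_ - _).
  rewrite mulr_sumr mulr_sumr; apply: eq_bigr => k _.
  by rewrite /rho rmorphM /=; ring.
have [px|px] := eqVneq (phi x) 0.
  rewrite (_ : (fun m => _) = cst 0); first exact: cvg_cst.
  by apply/funext => m; rewrite E px mul0r normc0.
apply/cvgrPdist_le => e e0.
have p0 : 0 < normc (phi x).
  by rewrite lt_neqAle normc_ge0 andbT eq_sym; apply/eqP => /eq0_normc/eqP; apply/negP.
have [N hN] := kernel_limit Bu cW sg (fun y Wy => sep x y (proj2 sp _ px) Wy)
  (divr_gt0 e0 p0).
exists N => // m /hN; rewrite ler_pdivlMr// => hm.
by rewrite /= sub0r normrN ger0_norm ?normc_ge0// E normcM mulrC.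
Qed.

(** Decay of the transform of [chi] at rate lam + kap: the part lam absorbs the exponential, and kap
    leaves [wt], whose sums over the frequencies are bounded uniformly in [xi] and m. *)
Lemma poisson_weight_bound W chi lam : tf om W chi -> 0 < lam ->
  exists2 C : R, 0 < C & forall xi m,
    \sum_(k <- index_enum {ffun 'I_d -> 'I_(2 * m.+1 ^ 2).+1})
      rho k * normc (fourier chi (xi - kpt B k)) *
      expR (lam * om (xi - kpt B k)) <= C.
Proof.
move=> tc l0; have [kap [C [k0 C0 hC]]] := om_decay hom.
have lk : 0 < lam + kap by exact: addr_gt0.
have [C1 C10 h1] := proj2 tc _ lk.
have [S S0 hS] := wt_box_sum Bu.
pose T := (krho B)^-1 ^+ d; have T0 : 0 < T by rewrite exprn_gt0// invr_gt0 krho_gt0.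
exists (T * (C1 * C) * S) => [|xi m]; first by rewrite !mulr_gt0.
apply: (@le_trans _ _ (\sum_k T * (C1 * C) * wt (xi - @kpt R d B (m.+1 ^ 2) k))); last first.
  by rewrite -mulr_sumr ler_pM2l ?hS// !mulr_gt0.
apply: ler_sum => k _; rewrite -[leLHS]mulrA -[leRHS]mulrA; apply: ler_pM.
- exact: rho_ge0.
- by rewrite mulr_ge0 ?normc_ge0 ?expR_ge0.
- exact: kw_kA_le.
set z := xi - _.
apply: (@le_trans _ _ (C1 * expR (- ((lam + kap) * om z)) * expR (lam * om z))).
  by rewrite ler_wpM2r ?expR_ge0.
rewrite -!mulrA ler_pM2l// -expRD; apply: le_trans (hC z).
by rewrite ler_expR; lra.
Qed.

Lemma poisson_sum_ccsupp K phi chi xi m : ccsupp K phi ->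
  ccsupp K (poisson_sum phi chi xi m).
Proof.
move=> sp; apply: ccsupp_sum => k; apply: ccsuppMl; last exact: ccont_cst.
by apply: ccsuppM => //; exact: ccont_fchar.
Qed.

(** For a frequency p, om eta <= om (p + eta) + om (xi - p) + om xi; the weights of the sum absorb
    the exponential of om (xi - p). *)
Lemma fourier_poisson_sum_bound K W phi chi xi lam : compact K ->
  tf om K phi -> tf om W chi -> 0 < lam -> exists2 C : R, 0 < C &
  forall m eta, normc (fourier (poisson_sum phi chi xi m) eta) <=
    C * expR (- (lam * om eta)).
Proof.
move=> cK tp tc l0; have [C1 C10 h1] := proj2 tp _ l0.
have [C2 C20 h2] := poisson_weight_bound tc l0.
exists (C1 * C2 * expR (lam * om xi)) => [|m eta]; first by rewrite !mulr_gt0 ?expR_gt0.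
have cf (p : V) : ccsupp K (fun x => phi x * fchar p x).
  by apply: ccsuppM; [exact: proj1 tp|exact: ccont_fchar].
rewrite /poisson_sum (fourier_sum _ _ cK); last first.
  by move=> k; apply: ccsuppMl; [exact: cf|exact: ccont_cst].
apply: le_trans (normc_sum _ _ _) _.
have -> : C1 * C2 * expR (lam * om xi) * expR (- (lam * om eta)) =
  C1 * expR (lam * om xi) * expR (- (lam * om eta)) * C2 by ring.
apply: le_trans (ler_wpM2l _ (h2 xi m)); last by rewrite !mulr_ge0 ?expR_ge0// ltW.
rewrite mulr_sumr; apply: ler_sum => k _; set p := kpt B k.
rewrite (fourier_scale _ _ cK (cf p)) fourier_modulation !normcM normc_real.
rewrite (ger0_norm (rho_ge0 k)).
have hp : normc (fourier phi (p + eta)) <=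
    C1 * (expR (lam * om xi) * expR (lam * om (xi - p)) * expR (- (lam * om eta))).
  apply: le_trans (h1 _) _; rewrite ler_pM2l//.
  apply: le_trans (om_modulation hom _ _ l0) _.
  rewrite ler_pM2r ?expR_gt0// -expRD ler_expR -mulrDr ler_pM2l//.
  have := om_alpha hom (p - xi) xi; rewrite subrK -(om_even hom (p - xi)) opprB.
  by rewrite addrC.
have q0 : 0 <= rho k * normc (fourier chi (xi - p)).
  by apply: mulr_ge0; [exact: rho_ge0|exact: normc_ge0].
apply: le_trans (ler_wpM2l q0 hp) _.
by rewrite le_eqVlt; apply/orP; left; apply/eqP; ring.
Qed.

Lemma poisson_sum_bounded K W phi chi xi : compact K -> ccsupp K phi ->
  tf om W chi -> exists M : R, forall m x, normc (poisson_sum phi chi xi m x) <= M.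
Proof.
move=> cK sp tc; have [C C0 hC] := poisson_weight_bound tc (@ltr01 R).
have [r [M [r0 M0 _ pM]]] := ccsupp_bound cK sp.
exists (M * C) => m x; apply: le_trans (normc_sum _ _ _) _.
apply: le_trans (ler_wpM2l M0 (hC xi m)).
rewrite mulr_sumr; apply: ler_sum => k _.
rewrite !normcM normc_fchar mulr1 normc_real (ger0_norm (rho_ge0 k)) mulrC.
have q0 : 0 <= rho k * normc (fourier chi (xi - kpt B k)).
  by apply: mulr_ge0; [exact: rho_ge0|exact: normc_ge0].
apply: ler_pM => //; first exact: normc_ge0.
  by apply: le_trans (pM x) _; rewrite ler_piMr// indicE lern1 leq_b1.
by apply: ler_peMr => //; rewrite -[leLHS]expR0 ler_expR mul1r (om_ge0 hom).
Qed.

(** The product is a limit of finite combinations of modulations of [phi], so its decay follows from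
    [tf_limit] without a convolution formula for its transform. *)
Lemma tf_product_separated K W phi chi xi : compact K -> compact W ->
  separated K W -> tf om K phi -> tf om W chi ->
  tf om K (fun x => phi x * (chi x * fchar xi x)).
Proof.
move=> cK cW sep tp tc.
have [M hM] := poisson_sum_bounded xi cK (proj1 tp) tc.
apply: (tf_limit cK _ _ _ hM).
- by move=> m; apply: poisson_sum_ccsupp; exact: proj1 tp.
- apply: ccsuppM; first exact: proj1 tp.
  by apply: ccontM; [exact: proj1 (proj1 tc)|exact: ccont_fchar].
- by move=> lam l0; exact: (fourier_poisson_sum_bound _ cK _ tc l0).
- exact: (poisson_sum_cvg xi cW sep (proj1 tp) (proj1 tc)).
Qed.

(* The shift by [eta] samples the transform of [phi f] on a translate of the
   lattice. *)
Lemma poisson_estimate Om f K W phi chi xi eta M : ultradistribution om Om f ->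
  compact K -> K `<=` Om -> compact W -> separated K W ->
  tf om K phi -> tf om W chi ->
  (forall m, \sum_(k <- index_enum {ffun 'I_d -> 'I_(2 * m.+1 ^ 2).+1})
    rho k * normc (fourier chi (xi - (kpt B k - eta))) *
      normc (fourierD (mulD phi f) (kpt B k - eta)) <= M) ->
  normc (fourierD (mulD (fun x => phi x * chi x) f) xi) <= M.
Proof.
move=> hf cK KOm cW sep tp tc hM.
pose phi' x := phi x * fchar (- eta) x.
have tp' : tf om K phi' by exact: tf_modulation.
have [M' hM'] := poisson_sum_bounded (xi + eta) cK (proj1 tp') tc.
rewrite /fourierD /mulD.
have -> : (fun x => phi x * chi x * fchar xi x) =
    (fun x => phi' x * (chi x * fchar (xi + eta) x)).
  apply/funext => x; rewrite /phi' [xi + eta]addrC fcharD.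
  transitivity (phi x * chi x * fchar xi x * (fchar (- eta) x * fchar eta x)); last by ring.
  by rewrite -fcharD addNr fchar0 mulr1.
have tm k : tf om K (fun x => phi' x * fchar k x) by exact: tf_modulation.
apply: (ultradistribution_limit hf cK KOm _ _ _ hM').
- by move=> m; apply: tf_sum => // k; exact: tfZ.
- exact: (tf_product_separated (xi + eta) cK cW sep tp' tc).
- by move=> lam l0; exact: (fourier_poisson_sum_bound _ cK _ tc l0).
- exact: (poisson_sum_cvg (xi + eta) cW sep (proj1 tp') (proj1 tc)).
move=> m; apply: le_trans (hM m).
rewrite /poisson_sum (ultradistribution_sum hf _ cK KOm); last first.
  by move=> k; exact: tfZ.
apply: le_trans (normc_sum _ _ _) _; apply: ler_sum => k _.
rewrite (ultradistributionZ hf _ cK KOm)// !normcM normc_real (ger0_norm (rho_ge0 k)).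
have -> : (fun x => phi' x * fchar (kpt B k) x) =
    (fun x => phi x * fchar (kpt B k - eta) x).
  by apply/funext => x; rewrite /phi' -mulrA -fcharD [- eta + _]addrC.
by rewrite opprB addrA.
Qed.

End expansion.
End poisson.

(** * Localization *)

Section localization.
Context {R : realType} {d : nat}.
Local Notation V := 'rV[R]_d.
Variable om : V -> R.
Hypothesis hom : weight_assumptions om.
Implicit Types (phi chi : V -> R[i]) (K W Om : set V).

Definition cball (x : V) (s : R) : set V := [set y | `|y - x| <= s].

Lemma cball_compact x s : compact (cball x s).
Proof.
apply: bounded_closed_compact.
  exists (s + `|x|); split; first exact: num_real.
  move=> M hM y ys; apply: ltW; apply: le_lt_trans hM.
  by rewrite -{1}(subrK x y) (le_trans (ler_normD _ _))// lerD2r.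
rewrite -[cball x s]setCK; apply: open_closedC; apply: openP_norm => y /=.
rewrite /cball /= => /negP; rewrite -ltNge => ys.
exists (`|y - x| - s); first by rewrite subr_gt0.
move=> z zy; apply/negP; rewrite -ltNge.
have := ler_normD (z - x) (y - z); rewrite addrC subrKA [`|y - z|]distrC.
by move: zy; move: (`|z - y|) (`|y - x|) (`|z - x|) => a b c; lra.
Qed.

Lemma int_small (s : R) : s \is a Num.int -> `|s| < 1 -> s = 0.
Proof.
move=> /intrP[k ->]; rewrite -intr_norm -[X in _ < X]/(1%:~R) ltr_int => k1.
by apply/eqP; rewrite intr_eq0; lia.
Qed.

(** With the basis r^-1 times the identity the dual lattice has spacing r, larger than any
    coordinate of a difference between the supports, so they are separated. *)
Lemma tfM K W phi chi : compact K -> compact W -> tf om K phi -> tf om W chi ->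
  tf om (K `&` W) (fun x => phi x * chi x).
Proof.
move=> cK cW tp tc.
have [r1 r10 Kr] := compact_norm_bounded cK.
have [r2 r20 Wr] := compact_norm_bounded cW.
pose r := r1 + r2; have r0 : 0 < r by exact: addr_gt0.
pose B : 'M[R]_d := (r^-1)%:M.
have Bu : B \in unitmx.
  by rewrite unitmxE det_scalar unitfE expf_neq0// invr_neq0// gt_eqF.
have sep : separated B K W.
  move=> x y /Kr xr /Wr yr h; apply/rowP => j; apply/eqP; rewrite -subr_eq0.
  have E : dotp (row j B) (x - y) = r^-1 * (x 0 j - y 0 j).
    rewrite /dotp (bigD1 j)//= !mxE eqxx mulr1n big1 ?addr0// => i ij.
    by rewrite !mxE eq_sym (negbTE ij) mulr0n mul0r.
  have := int_small (h j); rewrite E normrM ger0_norm ?invr_ge0 ?(ltW r0)//.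
  rewrite mulrC ltr_pdivrMr// mul1r => /(_ _)/eqP.
  rewrite mulf_eq0 invr_eq0 (gt_eqF r0) /=; apply.
  apply: le_lt_trans (ler_normB _ _) _; apply: ltrD.
    exact: le_lt_trans (rV_norm_coord _ _) xr.
  exact: le_lt_trans (rV_norm_coord _ _) yr.
have := tf_product_separated hom Bu (0 : V) cK cW sep tp tc.
under eq_fun do rewrite fchar0 mulr1.
move=> [[cpc spc] h]; split => //; split => // x pcx; split; first exact: spc.
by move: pcx; rewrite mulf_eq0 negb_or => /andP[_ /(proj2 (proj1 tc))].
Qed.

Lemma dotp_parallelogram (w u : V) :
  dotp (w + u) (w + u) + dotp (w - u) (w - u) = 2 * dotp w w + 2 * dotp u u.
Proof. by rewrite !dotpDl !dotpDr !dotpNl !dotpNr; lra. Qed.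

(* If [w] is almost a longest difference of two points of the support of [phi],
   then by the parallelogram law the support of [phi(z) phi(z - w)] has small
   diameter. *)
Lemma tf_shrink K phi x1 x0 (s : R) : compact K -> tf om K phi ->
  phi x1 != 0 -> 0 < s ->
  exists2 chi, tf om (cball x0 s) chi & chi x0 != 0.
Proof.
move=> cK tp px1 s0; have [r r0 Kr] := compact_norm_bounded cK.
have sr x : phi x != 0 -> `|x| < r by move=> /(proj2 (proj1 tp))/Kr.
pose E := [set t : R | exists x y,
  [/\ phi x != 0, phi y != 0 & t = dotp (x - y) (x - y)]].
have Esup : has_sup E.
  split; first by exists (dotp (x1 - x1) (x1 - x1)), x1, x1.
  exists (d%:R * ((r + r) * (r + r))) => t [x [y [/sr xr /sr yr ->]]].
  apply: le_trans (ler_norm _) _; apply: le_trans (dotp_norm_le _ _) _.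
  have xy : `|x - y| <= r + r.
    by apply: le_trans (ler_normB _ _) _; apply: lerD; exact: ltW.
  by rewrite ler_wpM2l// ler_pM.
have s20 : 0 < s ^+ 2 by exact: exprn_gt0.
have [t [x [y [px py ->]]] wlarge] := sup_adherent s20 Esup.
have Eub a b : phi a != 0 -> phi b != 0 -> dotp (a - b) (a - b) <= sup E.
  by move=> pa pb; apply: sup_upper_bound => //; exists a, b.
pose w := x - y.
pose R1 := r + `|w|.
have tbig : tf om (cball 0 R1) phi.
  apply: tf_sub tp => z /Kr zr; rewrite /cball /= subr0.
  by rewrite (le_trans (ltW zr))// lerDl.
have tshift : tf om (cball 0 R1) (fun z => phi (z + - w)).
  apply: tf_sub (tf_shift (- w) cK tp) => z /= /Kr zr; rewrite /cball /= subr0.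
  by rewrite -(subrK w z) (le_trans (ler_normD _ _))// lerD2r ltW.
have cR1 : compact (cball 0 R1) by exact: cball_compact.
have t0 := tfM cR1 cR1 tbig tshift.
have {t0}t0 : tf om (cball x s) (fun z => phi z * phi (z + - w)).
  case: t0 => [[c0 _] h]; split => //; split => // z.
  rewrite mulf_eq0 negb_or => /andP[pz pzw]; rewrite /cball /=.
  apply: le_trans (norm_le_enorm _) _.
  rewrite -(ger0_norm (ltW s0)) -sqrtr_sqr ler_sqrt ?sqr_ge0//.
  have xw : x - w = y by rewrite /w subKr.
  have h1 := Eub z y pz py; have h2 := Eub x (z + - w) px pzw.
  have := dotp_parallelogram w (z - x).
  have -> : w + (z - x) = z - y by rewrite /w addrC addrA subrK.
  have -> : w - (z - x) = x - (z + - w) by rewrite !opprB addrCA.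
  by move: wlarge h1 h2; rewrite -/w; lra.
have cxs : compact (cball x s) by exact: cball_compact.
exists (fun z => phi (z + (x - x0)) * phi (z + (x - x0) + - w)).
  apply: tf_sub (tf_shift (x - x0) cxs t0) => z; rewrite /cball /=.
  by rewrite addrCA [_ - x]addrC addKr.
have -> : x0 + (x - x0) = x by rewrite addrC subrK.
by rewrite mulf_neq0// /w subKr.
Qed.

End localization.

(** * Lattice bases *)

Section lattice_basis.
Context {R : realType} {d : nat}.
Local Notation V := 'rV[R]_d.
Variable Lam : set V.
Hypothesis hLam : lattice Lam.

Lemma lattice_sub x y : Lam x -> Lam y -> Lam (x - y).
Proof. by have [[_ h] _ _] := hLam; exact: h. Qed.

Lemma lattice0 : Lam 0.
Proof. by have [[h _] _ _] := hLam. Qed.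

Lemma lattice_add x y : Lam x -> Lam y -> Lam (x + y).
Proof.
move=> hx hy; rewrite -(opprK y); apply: lattice_sub => //.
by rewrite -sub0r; apply: lattice_sub => //; exact: lattice0.
Qed.

Lemma lattice_intmul (k : int) x : Lam x -> Lam (k%:~R *: x).
Proof.
move=> hx; have nat_mul (n : nat) : Lam (n%:R *: x).
  elim: n => [|n IH]; first by rewrite scale0r; exact: lattice0.
  by rewrite -natr1 scalerDl scale1r; exact: lattice_add.
case: k => n; first exact: nat_mul.
rewrite NegzE intrN scaleNr -sub0r; apply: lattice_sub; first exact: lattice0.
exact: nat_mul.
Qed.

Lemma lattice_int_comb n (k : 'rV[int]_n) (A : 'M[R]_(n, d)) :
  (forall i, Lam (row i A)) -> Lam (map_mx intr k *m A).
Proof.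
move=> hA; rewrite mulmx_sum_row; elim/big_ind : _ => //; first exact: lattice0.
- exact: lattice_add.
- by move=> i _; rewrite mxE; exact: lattice_intmul.
Qed.

Lemma lattice_discrete : exists2 e : R, 0 < e &
  forall x, Lam x -> `|x| < e -> x = 0.
Proof.
have [_ hiso _] := hLam; have [_ [W W0 WE]] := hiso _ lattice0.
have /nbhs_ballP[e e0 eW] := W0; exists e => // x hx xe.
have : (W `&` Lam) x by split => //; apply: eW; rewrite -ball_normE /= sub0r normrN.
by rewrite WE.
Qed.

(** A free family of fewer than d rows misses some vector x; among the lattice vectors spanning x at
    least one lies outside the row space and extends the family. *)
Lemma lattice_real_basis : exists2 A : 'M[R]_d, A \in unitmx &
  forall i, Lam (row i A).
Proof.
suff h r : (r <= d)%N -> exists2 A : 'M[R]_(r, d), row_free A &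
    forall i, Lam (row i A).
  by have [A fA hA] := h d (leqnn d); exists A => //; rewrite -row_free_unit.
elim: r => [|r IH] rd.
  by exists 0; [rewrite /row_free mxrank0|case].
have [A fA hA] := IH (ltnW rd); have [_ _ hspan] := hLam.
have [x xA] : exists x : V, ~~ (x <= A)%MS.
  apply: contrapT => h.
  have : (1%:M <= A)%MS.
    apply/row_subP => i; apply: contraT => hi; exfalso; apply: h.
    by exists (row i 1%:M).
  move=> /mxrankS; rewrite mxrank1 (eqP fA).
  by rewrite leqNgt rd.
have [m [B [hB xB]]] := hspan x.
have [i iA] : exists i, ~~ (row i B <= A)%MS.
  apply: contrapT => h; move/negP: xA; apply; apply: submx_trans xB _.
  by apply/row_subP => i; apply: contraT => hi; exfalso; apply: h; exists i.
rewrite -addn1; exists (col_mx A (row i B)).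
  rewrite /row_free eqn_leq rank_leq_row /= -addsmxE addn1 -[X in (X < _)%N](eqP fA).
  by apply: rank_ltmx; rewrite ltmxE addsmxSl /=; apply: contra iA => h;
    exact: submx_trans (addsmxSr _ _) h.
move=> k; case: (split_ordP k) => l ->; rewrite ?rowKu ?rowKd; first exact: hA.
by rewrite row_id; exact: hB.
Qed.

Lemma floor_frac (t : R) : 0 <= t - (Num.floor t)%:~R < 1.
Proof.
rewrite subr_ge0 floor_le /= ltrBlDl -[X in _ + X]/(1%:~R) -intrD.
exact: floorD1_gt.
Qed.

(* Pigeonhole: two multiples of [x] fall in the same cell of a fine subdivision
   of the fundamental domain, so their difference is an integral combination
   of the rows of [A]. *)
Lemma lattice_bounded_denominator (A : 'M[R]_d) : A \in unitmx ->
  (forall i, Lam (row i A)) -> exists2 D : nat, (0 < D)%N &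
  forall x, Lam x -> exists k : 'rV[int]_d,
    D%:R *: (x *m invmx A) = map_mx intr k.
Proof.
move=> Au hA; have [e e0 he] := lattice_discrete.
pose c : R := 1 + \sum_i \sum_j `|A i j|.
have c0 : 0 < c.
  by rewrite ltr_pwDl// sumr_ge0// => i _; rewrite sumr_ge0.
have hc (t : V) : `|t *m A| <= c * `|t|.
  apply/rV_norm_ler => [|j]; first by rewrite mulr_ge0// ltW.
  rewrite mxE (le_trans (ler_norm_sum _ _ _))//.
  apply: (@le_trans _ _ (\sum_i `|A i j| * `|t|)).
    apply: ler_sum => i _; rewrite normrM [leRHS]mulrC.
    by apply: ler_wpM2r => //; exact: rV_norm_coord.
  rewrite -mulr_suml ler_wpM2r// (@le_trans _ _ (\sum_i \sum_j `|A i j|))//.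
    by apply: ler_sum => i _; rewrite (bigD1 j)//= lerDl sumr_ge0.
  by rewrite lerDr.
pose N := (Num.truncn (c / e)).+1.
have Ne : c / N%:R < e.
  by rewrite ltr_pdivrMr ?ltr0n// mulrC -ltr_pdivrMr// truncnS_gt.
have N0 : 0 < N%:R :> R by rewrite ltr0n.
(* The pigeonhole yields a multiplier between 1 and N^d that depends on x; the factorial is a common
   multiple of all of them. *)
exists (N ^ d)`!; first exact: fact_gt0.
move=> x hx; move tE : (x *m invmx A) => t.
pose fr (k : nat) j : R := k%:R * t 0 j - (Num.floor (k%:R * t 0 j))%:~R.
have fr01 k j : 0 <= fr k j < 1 by exact: floor_frac.
pose cell (k : 'I_(N ^ d).+1) : {ffun 'I_d -> 'I_N} :=
  [ffun j => inord (Num.truncn (N%:R * fr k j))].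
have [k1 [k2 [k12 ck]]] : exists k1 k2 : 'I_(N ^ d).+1, (k1 < k2)%N /\ cell k1 = cell k2.
  have : ~~ injectiveb cell.
    apply/negP => /injectiveP /leq_card; rewrite card_ffun !card_ord.
    by rewrite ltnn.
  move=> /injectivePn[k1 [k2 k12 ck]].
  have [h|h|h] := ltngtP k1 k2; [by exists k1, k2|by exists k2, k1|].
  by move: k12; rewrite (val_inj h) eqxx.
have frE k j : (cell k j)%:R <= N%:R * fr k j < (cell k j)%:R + 1.
  rewrite ffunE inordK.
    have /truncn_itv : 0 <= N%:R * fr k j.
      by rewrite mulr_ge0//; have /andP[] := fr01 k j.
    by rewrite -natr1.
  rewrite -(ltr_nat R); apply: (@le_lt_trans _ _ (N%:R * fr k j)).
    by rewrite truncn_le mulr_ge0//; have /andP[] := fr01 k j.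
  by rewrite gtr_pMr//; have /andP[] := fr01 k j.
pose fl : 'rV[int]_d :=
  \row_j (Num.floor (k2%:R * t 0 j) - Num.floor (k1%:R * t 0 j)).
have E : (k2 - k1)%:R *: x - map_mx intr fl *m A =
    (\row_j (fr k2 j - fr k1 j)) *m A.
  have -> : x = t *m A by rewrite -tE mulmxKV.
  rewrite scalemxAl -mulmxBl; congr (_ *m A); apply/rowP => j.
  rewrite !mxE natrB; last exact: ltnW.
  by rewrite /fr rmorphB /=; ring.
have Z : (k2 - k1)%:R *: x - map_mx intr fl *m A = 0.
  apply: he.
    apply: lattice_sub; last exact: lattice_int_comb.
    exact: (lattice_intmul (k2 - k1)%N hx).
  rewrite E; apply: le_lt_trans Ne; apply: le_trans (hc _) _.
  rewrite ler_pM2l//; apply/rV_norm_ler => [|j]; first by rewrite invr_ge0.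
  rewrite mxE -[leRHS]mul1r ler_pdivlMr// -[X in _ * X](ger0_norm (ltW N0)) -normrM.
  have /andP[a1 b1] := frE k1 j; have /andP[a2 b2] := frE k2 j.
  rewrite ck in a1 b1; rewrite mulrC mulrBr ler_norml.
  by apply/andP; split; lra.
have /dvdnP[q qE] : (k2 - k1 %| (N ^ d)`!)%N.
  apply: dvdn_fact; rewrite subn_gt0 k12 /=.
  by rewrite (leq_trans (leq_subr _ _))// -ltnS.
exists (q%:Z *: fl); rewrite qE natrM -scalerA.
have -> : (k2 - k1)%:R *: t = map_mx intr fl.
  apply/eqP; rewrite -tE -subr_eq0 -(mulmxK Au (map_mx intr fl)) scalemxAl -mulmxBl.
  by rewrite Z mul0mx.
by apply/rowP => j; rewrite !mxE intrM.
Qed.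

Definition replace_row (A : 'M[R]_d) j (x : V) : 'M[R]_d :=
  \matrix_(i, k) if i == j then x 0 k else A i k.

(** Cramer's rule: the expansion along row j is an entry of the product of [s *m A] with the
    adjugate of [A]. *)
Lemma det_replace_row (A : 'M[R]_d) j (s : V) :
  \det (replace_row A j (s *m A)) = s 0 j * \det A.
Proof.
rewrite (expand_det_row _ j).
transitivity (((s *m A) *m \adj A) 0 j).
  rewrite [RHS]mxE; apply: eq_bigr => k _; rewrite !mxE eqxx; congr (_ * _).
  rewrite /cofactor; congr (_ * \det _); apply/matrixP => a b; rewrite !mxE.
  by rewrite eq_sym (negbTE (neq_lift _ _)).
by rewrite -mulmxA mul_mx_adj mul_mx_scalar mxE mulrC.
Qed.

(* A basis of the lattice vectors of minimal determinant generates the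
   lattice. *)
Lemma lattice_basis : exists2 B : 'M[R]_d, B \in unitmx &
  forall x, Lam x <-> exists k : 'rV[int]_d, x = map_mx intr k *m B.
Proof.
have [A Au hA] := lattice_real_basis.
have [D D0 hD] := lattice_bounded_denominator Au hA.
have Dp : 0 < D%:R :> R by rewrite ltr0n.
have dA : \det A != 0 by rewrite -unitfE -unitmxE.
(* The factor D^d clears the denominators: [q C] is the absolute determinant of an integer matrix,
   so a minimum exists. *)
pose q (C : 'M[R]_d) := `|D%:R ^+ d * (\det C / \det A)|.
pose Q (n : nat) := exists C : 'M[R]_d,
  [/\ forall i, Lam (row i C), C \in unitmx & q C = n%:R].
have qnat (C : 'M[R]_d) : (forall i, Lam (row i C)) -> exists n : nat, q C = n%:R.
  move=> hC.
  have /choice[k hk] i : exists k : 'rV[int]_d, D%:R *: (row i C *m invmx A) = map_mx intr k.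
    exact: hD.
  exists `|\det (\matrix_i k i)|%N.
  have -> : (`|\det (\matrix_i k i)|%N)%:R = `|\det (map_mx intr (\matrix_i k i) : 'M[R]_d)|.
    by rewrite det_map_mx natr_absz intr_norm.
  rewrite /q -det_inv -det_mulmx -detZ.
  congr (`|\det _|); apply/row_matrixP => i.
  by rewrite linearZ /= row_mul hk -map_row rowK.
have [n0 Qn0] : exists n, Q n.
  by have [n hn] := qnat A hA; exists n, A.
have [n [Qn nmin]] : exists n, Q n /\ forall m, Q m -> (n <= m)%N.
  have ex : exists n, `[< Q n >] by exists n0; apply/asboolP.
  case: (ex_minnP ex) => n /asboolP Qn h; exists n; split => // m Qm.
  by apply: h; apply/asboolP.
have [C [hC Cu qC]] := Qn.
have dC : \det C != 0 by rewrite -unitfE -unitmxE.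
exists C => // x; split; last by move=> [k ->]; exact: lattice_int_comb.
move=> hx; move tE : (x *m invmx C) => t.
have tC : t *m C = x by rewrite -tE mulmxKV.
suff tint j : t 0 j = (Num.floor (t 0 j))%:~R.
  exists (\row_j Num.floor (t 0 j)); rewrite -tC.
  by congr (_ *m _); apply/rowP => j; rewrite !mxE -tint.
apply: contrapT => tj; pose fl := Num.floor (t 0 j).
(* Only the fractional part of coordinate j is kept. Exchanging row j of [C] for this lattice vector
   multiplies the determinant by a number strictly between 0 and 1, against minimality. *)
pose s : V := t - fl%:~R *: delta_mx 0 j.
have /andP[s0 s1] : 0 <= s 0 j < 1.
  by rewrite /s !mxE !eqxx mulr1 floor_frac.
have sj0 : s 0 j != 0.
  by apply/eqP; rewrite /s !mxE !eqxx mulr1 => /eqP; rewrite subr_eq0 => /eqP.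
have hs : Lam (s *m C).
  rewrite /s mulmxBl tC -scalemxAl -rowE.
  by apply: lattice_sub => //; exact: lattice_intmul.
pose C' := replace_row C j (s *m C).
have hC' i : Lam (row i C').
  have [->|ij] := eqVneq i j.
    rewrite (_ : row j C' = s *m C)//; apply/rowP => k; rewrite mxE mxE eqxx//.
  rewrite (_ : row i C' = row i C)//; apply/rowP => k.
  by rewrite mxE mxE (negbTE ij) mxE.
have dC' : \det C' = s 0 j * \det C by exact: det_replace_row.
have [m qm] := qnat C' hC'.
have : Q m.
  by exists C'; split => //; rewrite unitmxE unitfE dC' mulf_neq0.
move=> /nmin; apply/negP; rewrite -ltnNge -(ltr_nat R) -qm -qC /q dC'.
rewrite -mulrA mulrCA normrM (ger0_norm s0) gtr_pMl// normr_gt0.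
have D1 : D%:R ^+ d != 0 :> R by rewrite expf_neq0// gt_eqF.
by rewrite mulf_neq0// mulf_neq0// invr_neq0.
Qed.

Lemma lattice_dual_basis (B : 'M[R]_d) :
  (forall x, Lam x <-> exists k : 'rV[int]_d, x = map_mx intr k *m B) ->
  forall y, dual_lattice Lam y <-> forall j, dotp (row j B) y \is a Num.int.
Proof.
move=> hB y; split=> [h j|h x /hB[k ->]].
  apply: h; apply/hB; exists (delta_mx 0 j).
  by rewrite map_delta_mx -rowE.
rewrite dotp_mulmx; apply: rpred_sum => j _; apply: rpredM => //.
by rewrite mxE intr_int.
Qed.

End lattice_basis.

(** * The estimate in a cone *)

Section cone.
Context {R : realType} {d : nat}.
Local Notation V := 'rV[R]_d.

(** The new cone is spanned by the ball of half radius around [xi0]. If t xi lies in that ball, t p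
    lies outside the full ball, so t |xi - p| >= del / 2 while t |xi| <= |xi0| + del / 2. *)
Lemma conic_shrink (xi0 : V) (Gam : set V) : open_conic_nbhd xi0 Gam ->
  exists Gam' (M : R), [/\ open_conic_nbhd xi0 Gam', 0 < M &
    forall xi p, Gam' xi -> ~ Gam p ->
      `|xi| <= M * `|xi - p| /\ `|p| <= M * `|xi - p|].
Proof.
move=> [oG G0 Gxi Gcone]; have [del del0 hdel] := open_ball_norm oG Gxi.
pose Gam' := [set xi : V | exists2 t : R, 0 < t & `|t *: xi - xi0| < del / 2].
have d2 : 0 < del / 2 by rewrite divr_gt0.
pose M1 := (`|xi0| + del / 2) / (del / 2).
have M10 : 0 < M1 by rewrite divr_gt0// ltr_wpDl.
exists Gam', (M1 + 1); split; first last.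
- move=> xi p [t t0 txi] np.
  have tp : del <= `|t *: p - xi0|.
    rewrite leNgt; apply/negP => /hdel/(Gcone t^-1).
    by rewrite invr_gt0 scalerA mulVf ?gt_eqF// scale1r => /(_ t0).
  have h1 : del / 2 <= t * `|xi - p|.
    rewrite -(ger0_norm (ltW t0)) -normrZ scalerBr.
    have := ler_distD (t *: xi) (t *: p) xi0; rewrite [`|t *: p - t *: xi|]distrC.
    by move: tp txi; move: (`|t *: p - xi0|) (`|t *: xi - xi0|) (`|t *: xi - t *: p|) => a b c; lra.
  have h2 : t * `|xi| <= `|xi0| + del / 2.
    rewrite -(ger0_norm (ltW t0)) -normrZ -(subrK xi0 (t *: xi)) addrC.
    by rewrite (le_trans (ler_normD _ _))// lerD2l ltW.
  have h3 : `|xi| <= M1 * `|xi - p|.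
    rewrite -(ler_pM2l t0); apply: le_trans h2 _.
    rewrite mulrCA -[leLHS](mulfVK (lt0r_neq0 d2)) -/M1.
    by rewrite ler_pM2l.
  split; first by rewrite (le_trans h3)// ler_wpM2r// lerDl.
  rewrite -{1}(subKr xi p) (le_trans (ler_normB _ _))//.
  by rewrite mulrDl mul1r lerD.
- by rewrite addr_gt0.
split.
- apply: openP_norm => xi [t t0 txi].
  exists ((del / 2 - `|t *: xi - xi0|) / t); first by rewrite divr_gt0// subr_gt0.
  move=> y; rewrite ltr_pdivlMr// mulrC -{1}(ger0_norm (ltW t0)) -normrZ scalerBr => yx.
  exists t => //; have := ler_distD (t *: xi) (t *: y) xi0.
  by move: yx; move: (`|t *: y - xi0|) (`|t *: y - t *: xi|) (`|t *: xi - xi0|) => a b c; lra.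
- move=> [t t0]; rewrite scaler0 sub0r normrN => h; apply: G0.
  by apply: hdel; rewrite sub0r normrN; lra.
- by exists 1 => //; rewrite scale1r subrr normr0.
- move=> t xi t0 [u u0 h]; exists (u / t); first exact: divr_gt0.
  by rewrite scalerA mulfVK ?gt_eqF.
Qed.

Lemma enormZ (a : R) (x : V) : enorm (a *: x) = `|a| * enorm x.
Proof.
by rewrite /enorm dotpZl dotpZr mulrA -expr2 sqrtrM ?sqr_ge0// sqrtr_sqr.
Qed.

Variable om : V -> R.
Hypothesis hom : weight_assumptions om.

Lemma om_mulrn (n : nat) (x : V) : om (n%:R *: x) <= n%:R * om x.
Proof.
elim: n => [|n IH]; first by rewrite scale0r mul0r (om0 hom).
by rewrite -natr1 scalerDl scale1r mulrDl mul1r (le_trans (om_alpha hom _ _))// lerD.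
Qed.

(** Subadditivity gives om xi <= n om (xi / n). For n > d M, where d pays for passing between sup
    and Euclidean norm, xi / n is no longer than zeta and monotonicity applies. *)
Lemma om_dominated (M : R) : 0 < M -> exists2 n : nat, (0 < n)%N &
  forall xi zeta, `|xi| <= M * `|zeta| -> om xi <= n%:R * om zeta.
Proof.
move=> M0; have [w [w0 wm omw]] := om_alpha0 hom.
pose n := (Num.truncn (d%:R * M)).+1; exists n => // xi zeta h.
have n0 : 0 < n%:R :> R by rewrite ltr0n.
have -> : xi = n%:R *: (n%:R^-1 *: xi) by rewrite scalerA mulfV ?gt_eqF// scale1r.
apply: le_trans (om_mulrn _ _) _; rewrite ler_pM2l// !omw.
apply: wm; first exact: sqrtr_ge0.
rewrite enormZ ger0_norm ?invr_ge0// mulrC ler_pdivrMr//.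
apply: le_trans (enorm_le _) _.
apply: (@le_trans _ _ (d%:R * (M * `|zeta|))); first by rewrite ler_wpM2l.
rewrite mulrA mulrC; apply: ler_pM => //; first by rewrite mulr_ge0// ltW.
  exact: norm_le_enorm.
by rewrite ltW// truncnS_gt.
Qed.

Lemma kpt_int (B : 'M[R]_d) n k : exists z : 'rV[int]_d,
  @kpt R d B n k = map_mx intr z *m B.
Proof.
exists (\row_j (n%:Z - (k j)%:Z)); congr (_ *m _); apply/rowP => j.
by rewrite !mxE rmorphB.
Qed.

(** The samples enter only through a weighted supremum s, since the decay of the transform of [chi]
    already makes the sum over frequencies bounded. One inequality thus serves every q and both
    implications. *)
Lemma cone_estimate (B : 'M[R]_d) Om f K W phi chi eta (v : V -> R)
    (Gam Gam' : set V) (M : R) : B \in unitmx ->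
  ultradistribution om Om f -> compact K -> K `<=` Om -> compact W ->
  separated B K W -> tf om K phi -> tf om W chi -> moderate_weight om v ->
  0 < M ->
  (forall xi p, Gam' xi -> ~ Gam p ->
     `|xi| <= M * `|xi - p| /\ `|p| <= M * `|xi - p|) ->
  exists2 C : R, 0 < C & forall xi s, Gam' xi -> 0 <= s ->
    (forall z : 'rV[int]_d, let p := map_mx intr z *m B - eta in Gam p ->
       wt (xi - p) * (normc (fourierD (mulD phi f) p) * v p) <= s) ->
    normc (fourierD (mulD (fun x => phi x * chi x) f) xi) * v xi <=
      C * (s + wt xi).
Proof.
move=> Bu hf cK KOm cW sep tp tc [_ v0 [c [lv [c0 lv0 hv]]]] M0 hcone.
have [kap [Cw [k0 Cw0 hw]]] := om_decay hom.
have [n n0 hn] := om_dominated M0.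
have [lH [CH [lH0 CH0 hH]]] := fourierD_bound hom hf cK KOm tp.
(* The first summand serves the samples in the cone: lv moves [v] from p to xi, kap pays for
   [wt (xi - p)]. The second serves the others, where the growth lH of the transform, lv and kap are
   charged to om (xi - p) at the price n. *)
pose L := (lv + kap) + (lH + lv + kap) * n%:R.
have L0 : 0 < L by rewrite addr_gt0 ?addr_gt0// mulr_gt0 ?addr_gt0// ltr0n.
have [CL CL0 hL] := poisson_weight_bound hom Bu tc L0.
pose C' := c * Cw + CH * c * (v 0 + 1) * Cw.
have v01 : 0 < v 0 + 1 by rewrite ltr_wpDl.
have C'0 : 0 < C' by rewrite addr_gt0 ?mulr_gt0.
have wtV z : 1 <= wt z * (Cw * expR (kap * om z)).
  have := ler_wpM2r (expR_ge0 (kap * om z)) (hw z).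
  by rewrite expRN mulVf ?gt_eqF ?expR_gt0// mulrAC mulrC.
have L1 : 0 <= (lH + lv + kap) * n%:R.
  exact: (mulr_ge0 (addr_ge0 (addr_ge0 (ltW lH0) (ltW lv0)) (ltW k0)) (ler0n _ _)).
have CC0 : 0 < C' * CL by exact: mulr_gt0.
exists (C' * CL) => //.
move=> xi s Gxi s0 hs; have wxi := wt_gt0 xi.
have [->|vxi] := eqVneq (v xi) 0; first by rewrite mulr0 (mulr_ge0 (ltW CC0))// addr_ge0// ltW.
have {}vxi : 0 < v xi by rewrite lt_neqAle eq_sym vxi v0.
rewrite -ler_pdivlMr//.
apply: (poisson_estimate hom Bu (eta := eta) hf cK KOm cW sep tp tc) => m.
rewrite ler_pdivlMr// mulr_suml.
have := hL (xi + eta) m; have C's0 : 0 <= C' * (s + wt xi).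
  by rewrite (mulr_ge0 (ltW C'0))// addr_ge0// ltW.
move=> /(ler_wpM2l C's0); rewrite [leRHS]mulrAC; apply: le_trans.
rewrite mulr_sumr; apply: ler_sum => k _.
have [z zE] := kpt_int B k; set p := kpt B k - eta.
have -> : xi + eta - kpt B k = xi - p by rewrite /p opprB addrA.
have key : normc (fourierD (mulD phi f) p) * v xi <=
    C' * (s + wt xi) * expR (L * om (xi - p)).
  have o0 := om_ge0 hom (xi - p); have H0 := normc_ge0 (fourierD (mulD phi f) p).
  have [Gp|Gp] := pselect (Gam p).
    have h1 : v xi <= c * v p * expR (lv * om (xi - p)).
      by have := hv p (xi - p); rewrite addrC subrK.
    have h2 : wt (xi - p) * (normc (fourierD (mulD phi f) p) * v p) <= s.
      by move: Gp; rewrite /p zE; exact: hs.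
    have h3 := wtV (xi - p).
    apply: (@le_trans _ _ (c * Cw * s * expR ((lv + kap) * om (xi - p)))); last first.
      apply: ler_pM; rewrite ?expR_ge0 ?mulr_ge0 ?(ltW c0) ?(ltW Cw0)//.
        apply: ler_pM; rewrite ?mulr_ge0 ?(ltW c0) ?(ltW Cw0)//.
          by rewrite lerDl !mulr_ge0 ?ltW.
        by rewrite lerDl ltW.
      by rewrite ler_expR ler_wpM2r// lerDl.
    apply: (@le_trans _ _ (normc (fourierD (mulD phi f) p) * (c * v p * expR (lv * om (xi - p))))).
      by rewrite ler_wpM2l.
    rewrite mulrDl expRD; set E1 := expR (lv * _); set E2 := expR (kap * _) in h3 *.
    have E10 : 0 <= E1 := expR_ge0 _.
    set X := normc _ in H0 h2 *.
    have X0 : 0 <= c * (X * v p) * E1 by rewrite !mulr_ge0// ltW.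
    have := ler_wpM2l X0 h3; rewrite mulr1.
    have : (wt (xi - p) * (X * v p)) * (c * Cw * E1 * E2) <= s * (c * Cw * E1 * E2).
      by rewrite ler_wpM2r// !mulr_ge0 ?ltW ?expR_gt0.
    by lra.
  have [hx hp] := hcone xi p Gxi Gp.
  have h1 : v xi <= c * v 0 * expR (lv * om xi) by have := hv 0 xi; rewrite add0r.
  have h2 := hH p; have h3 := wtV xi.
  have ox := hn _ _ hx; have op := hn _ _ hp.
  apply: (@le_trans _ _ (CH * c * (v 0 + 1) * Cw * wt xi *
      expR ((lH + lv + kap) * n%:R * om (xi - p)))); last first.
    apply: ler_pM; rewrite ?expR_ge0 ?mulr_ge0 ?(ltW wxi) ?(ltW v01) ?(ltW Cw0) ?(ltW c0) ?(ltW CH0)//.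
      apply: ler_pM; rewrite ?mulr_ge0 ?(ltW v01) ?(ltW Cw0) ?(ltW c0) ?(ltW CH0) ?(ltW wxi)//.
        by rewrite lerDr mulr_ge0 ?ltW.
      by rewrite lerDr.
    by rewrite ler_expR ler_wpM2r// lerDr addr_ge0 ?ltW.
  have e1 : expR (lH * om p) * expR (lv * om xi) * expR (kap * om xi) <=
      expR ((lH + lv + kap) * n%:R * om (xi - p)).
    rewrite -!expRD ler_expR -mulrA !mulrDl.
    by rewrite !lerD// ler_wpM2l// ltW.
  apply: (@le_trans _ _ (CH * expR (lH * om p) * (c * (v 0 + 1) * expR (lv * om xi)) *
    (wt xi * (Cw * expR (kap * om xi))))).
    apply: (@le_trans _ _ (CH * expR (lH * om p) * (c * (v 0 + 1) * expR (lv * om xi)))).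
      apply: ler_pM => //; apply: le_trans h1 _.
      by rewrite ler_wpM2r ?expR_ge0// ler_wpM2l ?lerDl// ltW.
    by rewrite ler_peMr// !mulr_ge0 ?expR_ge0 ?(ltW v01) ?(ltW c0) ?(ltW CH0).
  have A0 : 0 <= CH * c * (v 0 + 1) * Cw * wt xi.
    by rewrite !mulr_ge0 ?(ltW v01) ?(ltW c0) ?(ltW CH0) ?(ltW Cw0) ?(ltW wxi).
  by have := ler_wpM2l A0 e1; lra.
have q0 : 0 <= rho B k * normc (fourier chi (xi - p)).
  by apply: mulr_ge0; [exact: rho_ge0|exact: normc_ge0].
by have := ler_wpM2l q0 key; lra.
Qed.

End cone.

(** * Discrete and continuous norms *)

(** A comparison of suprema over simple functions, applicable to integrands whose measurability is
    not known. *)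
Lemma ge0_le_integralT d (T : measurableType d) (R : realType)
    (mu : {measure set T -> \bar R}) (f g : T -> \bar R) :
  (forall x, 0 <= f x)%E -> (forall x, f x <= g x)%E ->
  (\int[mu]_x f x <= \int[mu]_x g x)%E.
Proof.
move=> f0 fg; rewrite !ge0_integralTE//; last by move=> x; exact: le_trans (fg x).
apply: le_ereal_sup => _ [h hf <-]; exists h => // x.
exact: le_trans (hf x) (fg x).
Qed.

Lemma powRD_le (R : realType) (s t r : R) : 0 <= s -> 0 <= t -> 0 <= r ->
  (s + t) `^ r <= 2 `^ r * (s `^ r + t `^ r).
Proof.
move=> s0 t0 r0; apply: (@le_trans _ _ ((2 * Num.max s t) `^ r)).
  apply: ge0_ler_powR => //; rewrite ?nnegrE ?addr_ge0 ?mulr_ge0 ?le_max ?s0//.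
  have : s <= Num.max s t by rewrite le_max lexx.
  have : t <= Num.max s t by rewrite le_max lexx orbT.
  by move: (Num.max s t) => m; lra.
rewrite powRM ?le_max ?s0// ler_wpM2l ?powR_ge0//.
by have [|] := leP s t => _; rewrite ?lerDl ?lerDr powR_ge0.
Qed.

Section transfer.
Context d (T : measurableType d) (R : realType).
Variable mu : {measure set T -> \bar R}.
Variables (F W0 : T -> R) (w : nat -> T -> R) (a : nat -> R) (C S : R).
Hypothesis C0 : 0 < C.
Hypothesis F0 : forall x, 0 <= F x.
Hypothesis a0 : forall n, 0 <= a n.
Hypothesis w01 : forall n x, 0 <= w n x <= 1.
Hypothesis W01 : forall x, 0 <= W0 x <= 1.
Hypothesis hF : forall x s, 0 <= s -> (forall n, w n x * a n <= s) ->
  F x <= C * (s + W0 x).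

Lemma Lnorm_transfer_y (A : R) : (forall n, a n <= A) ->
  (Lnorm mu +oo (EFin \o F) < +oo)%E.
Proof.
move=> aA; rewrite unlock; case: ifPn => // _.
have A0 : 0 <= A by exact: le_trans (a0 0%N) (aA 0%N).
apply: (@le_lt_trans _ _ (C * (A + 1))%:E); last exact: ltry.
apply/ess_supP; apply: aeW => x /=; rewrite lee_fin ger0_norm//.
have /andP[Wx0 Wx1] := W01 x.
apply: le_trans (@hF x A A0 _) _; last by rewrite ler_wpM2l ?(ltW C0)// lerD2l.
by move=> n; have /andP[? ?] := w01 n x; rewrite (le_trans _ (aA n))// ler_piMl.
Qed.

Hypothesis S0 : 0 <= S.
Hypothesis mw : forall n, measurable_fun setT (w n).
Hypothesis mW : measurable_fun setT W0.
Hypothesis iw : forall n, (\int[mu]_x (w n x)%:E <= S%:E)%E.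
Hypothesis iW : (\int[mu]_x (W0 x)%:E <= S%:E)%E.

(** As r >= 1 and the weights lie in [0, 1], (w a)^r <= w a^r <= G. Hence s = G^(1/r) is admissible
    in [hF], so F^r is at most a multiple of G + W0, which is integrated term by term. *)
Lemma Lnorm_transfer_fin (r : R) : 1 <= r ->
  (\sum_(0 <= n <oo) (a n `^ r)%:E < +oo)%E ->
  (Lnorm mu r%:E (EFin \o F) < +oo)%E.
Proof.
move=> r1 ha; have r0 : 0 < r by exact: lt_le_trans r1.
rewrite unlock; apply: poweR_lty.
pose G x : \bar R := (\sum_(0 <= n <oo) (w n x * a n `^ r)%:E)%E.
have wa0 n x : 0 <= w n x * a n `^ r.
  by have /andP[? ?] := w01 n x; rewrite mulr_ge0// powR_ge0.
have G0 x : (0 <= G x)%E by apply: nneseries_ge0 => n _ _; rewrite lee_fin.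
pose k : R := C `^ r * 2 `^ r; have k0 : 0 < k by rewrite mulr_gt0// powR_gt0.
have contr (u : R) : 0 <= u <= 1 -> u `^ r <= u.
  move=> /andP[]; rewrite le_eqVlt => /orP[/eqP <- _|u0 u1].
    by rewrite powR0 ?gt_eqF.
  by apply: ge1r_powR => //; rewrite u0.
apply: (@le_lt_trans _ _ (\int[mu]_x (k%:E * (G x + (W0 x)%:E)))%E).
  apply: ge0_le_integralT => x; first exact: poweR_ge0.
  have /andP[Wx0 Wx1] := W01 x.
  rewrite [(`|_|)%E]abse_EFin poweR_EFin ger0_norm//.
  have [Gy|Gfin] := eqVneq (G x) +oo%E.
    by rewrite Gy addye// gt0_muley ?leey// lte_fin.
  have Gx : G x \is a fin_num by rewrite ge0_fin_numE// lt_neqAle Gfin leey.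
  rewrite -(fineK Gx) -EFinD -EFinM lee_fin.
  set g := fine (G x); have g0 : 0 <= g by exact: fine_ge0.
  have hs n : w n x * a n <= g `^ r^-1.
    have /andP[wn0 wn1] := w01 n x.
    have wag : w n x * a n `^ r <= g.
      rewrite -lee_fin /g fineK//.
      apply: le_trans (nneseries_lim_ge n.+1 _) => [|i _ _]; last by rewrite lee_fin.
      by rewrite big_nat_recr//= leeDr// sume_ge0// => i _; rewrite lee_fin.
    have wr : (w n x * a n) `^ r <= g.
      by apply: le_trans wag; rewrite powRM// ler_wpM2r ?powR_ge0// contr ?w01.
    have -> : w n x * a n = ((w n x * a n) `^ r) `^ r^-1.
      by rewrite -powRrM divff ?gt_eqF// powRr1// mulr_ge0.
    by apply: ge0_ler_powR; rewrite ?invr_ge0 ?(ltW r0) ?nnegrE ?powR_ge0.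
  have gr0 : 0 <= g `^ r^-1 by exact: powR_ge0.
  apply: (@le_trans _ _ ((C * (g `^ r^-1 + W0 x)) `^ r)).
    apply: ge0_ler_powR; rewrite ?nnegrE ?(ltW r0)//; last exact: hF.
    by rewrite mulr_ge0 ?(ltW C0)// addr_ge0.
  rewrite powRM ?(ltW C0) ?addr_ge0// -mulrA ler_wpM2l ?powR_ge0//.
  apply: le_trans (powRD_le _ _ _) _; rewrite ?(ltW r0)//.
  rewrite ler_wpM2l ?powR_ge0// -powRrM mulVf ?gt_eqF// powRr1// lerD2l.
  exact: contr.
have mG : measurable_fun setT G.
  apply: ge0_emeasurable_sum => [n x _ _|n _]; first by rewrite lee_fin.
  by apply/measurable_EFinP; apply: measurable_funM => //; exact: measurable_cst.
have mW' : measurable_fun setT (fun x => (W0 x)%:E) by exact/measurable_EFinP.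
have W0' x : (0 <= (W0 x)%:E)%E by have /andP[] := W01 x; rewrite lee_fin.
rewrite ge0_integralZl_EFin//; last 3 first.
- by move=> x _; rewrite adde_ge0.
- exact: emeasurable_funD.
- exact: ltW.
rewrite ge0_integralD//; apply: lte_mul_pinfty; rewrite ?lee_fin ?(ltW k0)//.
apply: lte_add_pinfty; last exact: le_lt_trans iW (ltry _).
rewrite /G integral_nneseries//; last 2 first.
- move=> n; apply/measurable_EFinP; apply: measurable_funM => //.
- by move=> n x _; rewrite lee_fin.
apply: (@le_lt_trans _ _ (\sum_(0 <= n <oo) (S%:E * (a n `^ r)%:E))%E).
  apply: lee_nneseries => n _.
    by move=> _; apply: integral_ge0 => x _; rewrite lee_fin.
  rewrite [X in (X <= _)%E](_ : _ = \int[mu]_x ((a n `^ r)%:E * (w n x)%:E))%E; last first.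
    by apply: eq_integral => x _; rewrite mulrC EFinM.
  rewrite ge0_integralZl_EFin ?powR_ge0//; last 2 first.
  - by move=> x _; have /andP[] := w01 n x; rewrite lee_fin.
  - exact/measurable_EFinP.
  by rewrite muleC lee_wpmul2r// lee_fin powR_ge0.
rewrite nneseriesZl//; last by move=> n _; rewrite lee_fin powR_ge0.
by apply: lte_mul_pinfty; rewrite ?lee_fin.
Qed.

End transfer.

(* Turns a sum over a countable type into a series over [nat]: the indices that
   encode nothing contribute 0. *)
Definition enumerate (U : nmodType) (I : countType) (g : I -> U) (n : nat) : U :=
  oapp g 0 (pickle_inv n).

Section lattice_measure.
Context {R : realType} {d : nat}.
Local Notation V := 'rV[R]_d.

Lemma enumerate_ge0 (I : countType) (g : I -> R) n : (forall i, 0 <= g i) ->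
  0 <= enumerate g n.
Proof. by move=> g0; rewrite /enumerate; case: (pickle_inv n) => //=. Qed.

Lemma enumerate_pickle (U : nmodType) (I : countType) (g : I -> U) i : enumerate g (pickle i) = g i.
Proof. by rewrite /enumerate pickleK_inv. Qed.

Lemma measurable_rV_set1 (a : V) : measurable ([set a] : set V).
Proof.
rewrite -[X in measurable X]setCK; apply: measurableC.
apply: open_measurable_rV; apply: closed_openC; apply: accessible_closed_set1.
exact: hausdorff_accessible (@norm_hausdorff _ _).
Qed.

Lemma counting_set1 (a : V) : @counting V R [set a] = 1%E.
Proof.
rewrite /counting asboolT; last exact: finite_set1.
by rewrite fset_set1 finmap.cardfs1.
Qed.

(** The counting measure lives on all of [V], so [g] is written as a series of multiples of
    indicators of points and integrated termwise. *)
Lemma integral_counting_countable (I : countType) (p : I -> V) (g : V -> R) :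
  injective p -> (forall x, 0 <= g x) -> (forall x, (forall i, x != p i) -> g x = 0) ->
  (\int[@counting V R]_x (g x)%:E =
   \sum_(0 <= n <oo) (enumerate (g \o p) n)%:E)%E.
Proof.
move=> pI g0 gp.
pose u n (x : V) : R := oapp (fun i => g (p i) * \1_[set p i] x) 0 (pickle_inv n).
have u0 n x : 0 <= u n x.
  by rewrite /u; case: pickle_inv => //= i; rewrite mulr_ge0.
have -> : (\int[@counting V R]_x (g x)%:E =
    \int[@counting V R]_x (\sum_(0 <= n <oo) (u n x)%:E))%E.
  apply: eq_integral => x _; have [[i xi]|npx] := pselect (exists i, x = p i).
    rewrite (@nneseriesD1 R _ (pickle i)) => [|k _|//]; last by rewrite lee_fin.
    rewrite eseries0 ?adde0 => [|k _ /= ki].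
      by rewrite /u pickleK_inv/= xi indicE mem_set// mulr1.
    rewrite /u; case E : (pickle_inv k) => [j|//] /=.
    rewrite indicE memNset ?mulr0//= => xj; move: ki; rewrite xi in xj.
    rewrite (pI _ _ xj); move: (@pickle_invK I k); rewrite /= E /= => ->.
    by rewrite eqxx.
  rewrite gp => [|i]; last by apply/eqP => xi; apply: npx; exists i.
  rewrite eseries0// => n _ _; rewrite /u; case: pickle_inv => [i|//] /=.
  by rewrite indicE memNset ?mulr0//= => xi; apply: npx; exists i.
rewrite integral_nneseries//; last 2 first.
- move=> n; apply/measurable_EFinP; rewrite /u.
  case: pickle_inv => [i|] /=; last exact: measurable_cst.
  apply: measurable_funM; first exact: measurable_cst.
  exact: measurable_indic (measurable_rV_set1 _).
- by move=> n x _; rewrite lee_fin.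
apply: eq_eseriesr => n _; rewrite /u /enumerate.
case: pickle_inv => [i|] /=; last by rewrite integral0.
under eq_integral do rewrite EFinM.
have mi : measurable_fun setT (fun x : V => (\1_[set p i] x)%:E : \bar R).
  by apply/measurable_EFinP; exact: measurable_indic (measurable_rV_set1 _).
rewrite ge0_integralZl_EFin//.
rewrite integral_indic//; last exact: measurable_rV_set1.
by rewrite setIT [X in (_ * X)%E]counting_set1 mule1.
Qed.

Lemma ler_sum_subseq (T : eqType) (s t : seq T) (F : T -> R) : uniq s -> uniq t ->
  {subset s <= t} -> (forall i, 0 <= F i) -> \sum_(i <- s) F i <= \sum_(i <- t) F i.
Proof.
move=> us ut st F0; rewrite [leRHS](bigID (mem s))/=.
have st' : perm_eq [seq i <- t | i \in s] s.
  apply: uniq_perm => // [|x]; first exact: filter_uniq.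
  by rewrite mem_filter; apply/andP/idP => [[]//|xs]; split=> //; exact: st.
by rewrite -(perm_big _ st') big_filter lerDl sumr_ge0.
Qed.

(** Each partial sum runs over finitely many integer vectors; these lie in a centred box, where
    [wt_box_sum] applies. *)
Lemma wt_int_sum (B : 'M[R]_d) : B \in unitmx -> exists2 S : R, 0 < S & forall x : V,
  (\sum_(0 <= n <oo) (enumerate (fun z : 'rV[int]_d =>
     wt (x - map_mx intr z *m B)) n)%:E <= S%:E)%E.
Proof.
move=> Bu; have [S S0 hS] := wt_box_sum Bu; exists S => // x.
set g := fun z : 'rV[int]_d => _.
have g0 z : 0 <= g z by exact: ltW (wt_gt0 _).
apply: lime_le => [|].
  by apply: is_cvg_nneseries => n _ _; rewrite lee_fin enumerate_ge0.
apply: nearW => N; rewrite /= sumEFin lee_fin.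
rewrite (_ : \sum_(0 <= i < N) _ = \sum_(z <- pmap pickle_inv (index_iota 0 N)) g z).
  set s := pmap _ _; have us : uniq s.
    by apply: (pmap_uniq (@pickle_invK _)); exact: iota_uniq.
  pose n := (\max_(z <- s) \max_j `|z 0%R j|)%N.
  pose f (k : {ffun 'I_d -> 'I_(2 * n).+1}) : 'rV[int]_d :=
    \row_j (n%:Z - (k j)%:Z).
  apply: le_trans (hS n x).
  have gf k : wt (x - @kpt R d B n k) = g (f k).
    have fE : \row_j (n%:R - (k j)%:R) = map_mx intr (f k) :> V.
      by apply/rowP => j; rewrite !mxE rmorphB.
    by rewrite /g /kpt fE.
  rewrite (eq_bigr (g \o f) (fun k _ => gf k)).
  rewrite -(big_map f xpredT g).
  apply: ler_sum_subseq => //.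
    rewrite map_inj_uniq ?index_enum_uniq// => k l /rowP kl; apply/ffunP => j.
    by have := kl j; rewrite !mxE => /addrI/oppr_inj[]/val_inj.
  move=> z zs; have zn j : (`|z 0%R j| <= n)%N.
    apply: leq_trans (leq_bigmax_seq _ zs isT).
    exact: (@leq_bigmax _ (fun j => `|z 0%R j|%N)).
  apply/mapP; exists [ffun j => inord `|n%:Z - z 0%R j|%N]; first exact: mem_index_enum.
  apply/rowP => j; rewrite !mxE ffunE inordK; have := zn j; lia.
by rewrite big_pmap.
Qed.

End lattice_measure.

Lemma enumerate_ge0e (R : realType) (I : countType) (g : I -> \bar R) n :
  (forall i, 0 <= g i)%E -> (0 <= enumerate g n)%E.
Proof. by move=> g0; rewrite /enumerate; case: (pickle_inv n) => //=. Qed.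

Lemma EFin_enumerate (R : realType) (I : countType) (g : I -> R) n :
  ((enumerate g n)%:E = enumerate (EFin \o g) n)%E.
Proof. by rewrite /enumerate; case: (pickle_inv n). Qed.

(** * Averaging over translates *)

Section unfolding.
Context d (T : measurableType d) (R : realType).
Variable mu : {measure set T -> \bar R}.
Variables (I : countType) (t t' : I -> T -> T).
Hypothesis tt' : forall i x, t' i (t i x) = x.
Hypothesis mt : forall i, measurable_fun setT (t i).
Hypothesis mt' : forall i, measurable_fun setT (t' i).
Hypothesis int_t : forall i (h : T -> \bar R), measurable_fun setT h ->
  (\int[mu]_x h (t i x) = \int[mu]_x h x)%E.

(* For the translations by a lattice this replaces Fubini when averaging a
   series of samples over the translate. *)
Lemma integral_unfold (f g : T -> \bar R) :
  (forall x, 0 <= f x)%E -> (forall x, 0 <= g x)%E ->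
  measurable_fun setT f -> measurable_fun setT g ->
  (\int[mu]_x \sum_(0 <= n <oo) (g x * enumerate (fun i => f (t i x)) n) =
   \int[mu]_x \sum_(0 <= n <oo) (f x * enumerate (fun i => g (t' i x)) n))%E.
Proof.
move=> f0 g0 mf mg.
rewrite !integral_nneseries//.
- apply: eq_eseriesr => n _; rewrite /enumerate.
  case: (pickle_inv n) => [i|] /=; last by under eq_integral do rewrite mule0;
    under [RHS]eq_integral do rewrite mule0.
  rewrite -(@int_t i (fun x => f x * g (t' i x))%E).
    by apply: eq_integral => x _; rewrite tt' muleC.
  by apply: emeasurable_funM => //; exact: measurableT_comp (mt' i).
- move=> n; rewrite /enumerate; case: (pickle_inv n) => [i|] /=.
    by apply: emeasurable_funM => //; exact: measurableT_comp (mt' i).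
  by under eq_fun do rewrite mule0; exact: measurable_cst.
- by move=> n x _; rewrite mule_ge0// enumerate_ge0e.
- move=> n; rewrite /enumerate; case: (pickle_inv n) => [i|] /=.
    by apply: emeasurable_funM => //; exact: measurableT_comp (mt i).
  by under eq_fun do rewrite mule0; exact: measurable_cst.
- by move=> n x _; rewrite mule_ge0// enumerate_ge0e.
Qed.

(** As [Q] meets every orbit, the indicators of its translates sum to at least 1; unfolding moves
    the sum onto [f] and the integral onto [Q]. *)
Lemma integral_le_translates (f : T -> \bar R) (Q : set T) (S : R) : 0 <= S ->
  (forall x, 0 <= f x)%E -> measurable_fun setT f -> measurable Q ->
  (forall x, \sum_(0 <= n <oo) enumerate (fun i => f (t i x)) n <= S%:E)%E ->
  (forall x, exists i, Q (t' i x)) -> (\int[mu]_x f x <= S%:E * mu Q)%E.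
Proof.
move=> S0 f0 mf mQ hS hQ.
have m1 : measurable_fun setT (fun x => (\1_Q x : R)%:E).
  by apply/measurable_EFinP; exact: measurable_indic.
have i0 x : (0 <= (\1_Q x : R)%:E)%E by rewrite lee_fin.
rewrite -[X in (S%:E * mu X)%E]setIT -integral_indic// -ge0_integralZl_EFin//.
apply: (@le_trans _ _ (\int[mu]_x \sum_(0 <= n <oo)
   (f x * enumerate (fun i => (\1_Q (t' i x) : R)%:E) n))%E).
  apply: ge0_le_integralT => // x; have [i Qi] := hQ x.
  rewrite (@nneseriesD1 R _ (pickle i))//.
    rewrite enumerate_pickle indicE mem_set ?mule1 ?leeDl//.
    by apply: nneseries_ge0 => n _ _; rewrite mule_ge0// enumerate_ge0e.
  by move=> n _; rewrite mule_ge0// enumerate_ge0e.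
have un := integral_unfold f0 i0 mf m1; rewrite -un; apply: ge0_le_integralT => x.
  by apply: nneseries_ge0 => n _ _; rewrite mule_ge0// enumerate_ge0e.
rewrite nneseriesZl; last by move=> n _; rewrite enumerate_ge0e.
by rewrite muleC lee_wpmul2r.
Qed.

(** If the series were infinite everywhere, so would be its integral against the positive weight
    [g]; unfolded, that integral is at most S times the integral of [f]. *)
Lemma translate_series_finite (f : T -> \bar R) (g : T -> R) (S : R) : 0 < S ->
  (forall x, 0 <= f x)%E -> (forall x, 0 < g x) ->
  measurable_fun setT f -> measurable_fun setT g ->
  (forall x, \sum_(0 <= n <oo) (enumerate (fun i => g (t' i x)) n)%:E <= S%:E)%E ->
  (\int[mu]_x f x < +oo)%E -> (0 < mu setT)%E ->
  exists x, (\sum_(0 <= n <oo) enumerate (fun i => f (t i x)) n < +oo)%E.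
Proof.
move=> S0 f0 g0 mf /measurable_EFinP mg hS intf muT; apply: contrapT => nox.
have g0e x : (0 <= (g x)%:E)%E by rewrite lee_fin ltW.
have := integral_unfold f0 g0e mf mg.
rewrite (_ : integral _ _ _ = +oo%E).
  move=> un; suff : (+oo <= \int[mu]_x (S%:E * f x))%E.
    rewrite ge0_integralZl_EFin ?(ltW S0)// => h.
    have : (S%:E * \int[mu]_x f x < +oo)%E by rewrite lte_mul_pinfty ?lee_fin ?(ltW S0).
    by move=> /(le_lt_trans h); rewrite ltxx.
  rewrite un; apply: ge0_le_integralT => x.
    by apply: nneseries_ge0 => n _ _; rewrite mule_ge0// enumerate_ge0e.
  have [->|fy] := eqVneq (f x) +oo%E.
    by rewrite gt0_muley ?leey.
  have fx : f x \is a fin_num by rewrite ge0_fin_numE// lt_neqAle fy leey.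
  rewrite -(fineK fx) nneseriesZl; last by move=> n _; rewrite enumerate_ge0e.
  rewrite [leRHS]muleC lee_wpmul2l ?fineK//.
  apply: le_trans (hS x); rewrite le_eqVlt; apply/orP; left; apply/eqP.
  by apply: eq_eseriesr => n _; rewrite EFin_enumerate.
transitivity (\int[mu]_x (cst +oo%E x))%E.
  apply: eq_integral => x _; rewrite nneseriesZl; last by move=> n _; rewrite enumerate_ge0e.
  rewrite [X in (_ * X)%E](_ : _ = +oo%E) ?gt0_muley ?lte_fin//.
  apply/eqP; apply: contra_notT nox => h; exists x.
  by rewrite lt_neqAle h leey.
by rewrite integral_cst// gt0_mulye.
Qed.

End unfolding.

Section lattice_translates.
Context {R : realType} {d : nat}.
Local Notation V := 'rV[R]_d.

Lemma continuous_wt : continuous (@wt R d).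
Proof.
move=> z; have h : 1 + `|z| != 0 by rewrite gt_eqF// ltr_pwDl.
rewrite /continuous_at.
apply: (@cvgV R V (nbhs z) _ (fun z : V => (1 + `|z|) ^+ (2 * d))); first exact: expf_neq0.
apply: (@continuous_comp _ _ _ (fun z : V => 1 + `|z|) (fun t : R => t ^+ (2 * d))).
  exact: (@cvgD R R^o V (nbhs z) _ (fun=> 1) (fun z : V => `|z|) 1 `|z|
    (cvg_cst _) (@norm_continuous R V z)).
exact: exprn_continuous.
Qed.

Lemma measurable_wt_shift (p : V) :
  measurable_fun [set: lebT R d] (fun x : lebT R d => wt ((x : V) - p)).
Proof.
exact: measurableT_comp (continuous_leb continuous_wt) (measurable_leb_shift (- p)).
Qed.

Lemma wtN (z : V) : wt (- z) = wt z.
Proof. by rewrite /wt normrN. Qed.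

Lemma wt_integral : exists2 S : R, 0 < S & forall p : V,
  (\int[leb R d]_x (wt ((x : V) - p))%:E <= S%:E)%E.
Proof.
have [S S0 hS] := @wt_int_sum R d 1%:M (unitmx1 _ _).
(* This cube contains the fundamental domain [0, 1)^d of the integer lattice. *)
pose Q : set (lebT R d) := [set x : V | `|x| < 1].
have mQ : measurable Q by exact: leb_ball0_measurable.
have LQ : (leb R d Q = ((1 *+ 2) ^+ d)%:E)%E by exact: leb_ball0.
exists (S * (1 *+ 2) ^+ d) => [|p]; first by rewrite mulr_gt0// exprn_gt0.
have mw : measurable_fun setT (fun x : lebT R d => (wt (x : V))%:E).
  by apply/measurable_EFinP; exact: continuous_leb continuous_wt.
have w0 (x : V) : (0 <= (wt x)%:E)%E by rewrite lee_fin ltW ?wt_gt0.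
rewrite (@integral_leb_shift R d (- p) (fun x => (wt (x : V))%:E))// EFinM -LQ.
apply: (@integral_le_translates _ (lebT R d) R (leb R d) 'rV[int]_d
  (fun z x => (x + map_mx intr z)%R) (fun z x => (x - map_mx intr z)%R)
  _ _ _ _ (fun x => (wt (x : V))%:E) Q S (ltW S0) w0 mw mQ).
- by move=> z x; rewrite addrK.
- by move=> z; exact: measurable_leb_shift.
- by move=> z; exact: measurable_leb_shift.
- by move=> z h mh; exact: integral_leb_shift.
- move=> x; apply: le_trans (hS (- (x : V))); rewrite le_eqVlt; apply/orP; left; apply/eqP.
  apply: eq_eseriesr => n _; rewrite EFin_enumerate; congr (enumerate _ n).
  by apply/funext => z /=; rewrite -wtN opprD mulmx1.
move=> x; exists (\row_j Num.floor ((x : V) 0 j)).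
rewrite /Q /=; apply/(rV_norm_ltr _ ltr01) => j.
rewrite !mxE ger0_norm ?subr_ge0 ?floor_le//.
by have := floorD1_gt ((x : V) 0 j); rewrite rmorphD /= ltrBlDl.
Qed.

Lemma leb_translate_series_finite (B : 'M[R]_d) (f : lebT R d -> \bar R) :
  B \in unitmx -> (forall x, 0 <= f x)%E -> measurable_fun setT f ->
  (\int[leb R d]_x f x < +oo)%E -> exists eta : V,
  (\sum_(0 <= n <oo)
     enumerate (fun z : 'rV[int]_d => f (eta + map_mx intr z *m B)%R) n < +oo)%E.
Proof.
move=> Bu f0 mf intf; have [S S0 hS] := wt_int_sum Bu.
apply: (@translate_series_finite _ (lebT R d) R (leb R d) 'rV[int]_d
  (fun z x => (x + map_mx intr z *m B)%R) (fun z x => (x - map_mx intr z *m B)%R)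
  _ _ _ _ f (@wt R d) S S0 f0 (@wt_gt0 R d) mf
  (continuous_leb continuous_wt) hS intf).
- by move=> z x; rewrite addrK.
- by move=> z; exact: measurable_leb_shift.
- by move=> z; exact: measurable_leb_shift.
- by move=> z h mh; exact: integral_leb_shift.
apply: (@lt_le_trans _ _ (leb R d [set x : V | `|x| < 1])).
  by rewrite leb_ball0// lte_fin exprn_gt0.
by apply: le_measure; rewrite ?inE//; exact: leb_ball0_measurable.
Qed.

End lattice_translates.

(** * Separated supports *)

Section separation.
Context {R : realType} {d : nat}.
Local Notation V := 'rV[R]_d.
Variable B : 'M[R]_d.
Hypothesis Bu : B \in unitmx.

Lemma cos_pi_int (s : R) : s \is a Num.int -> cos (pi * s) ^+ 2 = 1.
Proof.
have cn (n : nat) : cos (pi * n%:R) ^+ 2 = 1 :> R.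
  elim: n => [|n IH]; first by rewrite mulr0 cos0 expr1n.
  by rewrite -natr1 mulrDr mulr1 cosDpi sqrrN.
move=> /intrP[[n|n] ->]; first exact: cn.
by rewrite NegzE mulrNz mulrN cosN cn.
Qed.

Lemma kerb_int y : (forall j, dotp (row j B) y \is a Num.int) -> kerb B y = 1.
Proof. by move=> h; rewrite /kerb big1// => j _; exact: cos_pi_int. Qed.

(** Near x0 itself, differences are too short to be nonzero dual vectors. Near any other x of [K]
    the kernel base is below 1 at x - x0, hence also at nearby differences. Compactness of [K] makes
    the radius uniform. *)
Lemma separated_neighborhood (K : set V) (x0 : V) : compact K ->
  (forall x, K x -> (forall j, dotp (row j B) (x - x0) \is a Num.int) -> x = x0) ->
  exists2 s : R, 0 < s & separated B K (cball x0 s).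
Proof.
move=> cK Kx0.
have loc x : K x -> exists2 e : R, 0 < e & forall x' y, `|x' - x| < e -> `|y - x0| < e ->
    (forall j, dotp (row j B) (x' - y) \is a Num.int) -> x' = y.
  move=> Kx; have k0 := krad_gt0 B; have [->|xx0] := eqVneq x x0.
    exists (krad B / 2); first by rewrite divr_gt0.
    move=> x' y h1 h2 hint; apply/eqP; rewrite -subr_eq0; apply/eqP.
    apply: krad_sep hint => //.
    have := ler_normD (x' - x0) (x0 - y); rewrite subrKA [`|x0 - y|]distrC.
    by move: h1 h2; lra.
  have k1 : kerb B (x - x0) < 1.
    rewrite lt_neqAle kerb_le1 andbT; apply: contra_neq xx0 => /kerb_eq1.
    exact: Kx0.
  have := @continuous_kerb R d B 1 (x - x0).
  move=> /(_ [set t | t < 1]) /= h.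
  have /nbhs_ballP[e /= e0 he] : nbhs (x - x0) [set z | kerb B z < 1].
    have -> : [set z | kerb B z < 1] = (fun y => kerb B y ^+ 1) @^-1` [set t | t < 1].
      by apply/seteqP; split => z /=; rewrite expr1.
    apply: h; rewrite expr1; apply: open_nbhs_nbhs; split; [exact: open_lt | exact: k1].
  exists (e / 2); first by rewrite divr_gt0.
  move=> x' y h1 h2 /kerb_int kE; exfalso.
  suff : kerb B (x' - y) < 1 by rewrite kE ltxx.
  apply: he; rewrite -ball_normE /=.
  rewrite (_ : x - x0 - (x' - y) = (x - x') + (y - x0)); last first.
    by apply/rowP => j; rewrite !mxE; ring.
  apply: le_lt_trans (ler_normD _ _) _; rewrite [`|x - x'|]distrC.
  by move: h1 h2; lra.
have /compact_near_coveringP/(_ R 0^'+ (fun s x => forall y, cball x0 s y ->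
   (forall j, dotp (row j B) (x - y) \is a Num.int) -> x = y) _) := cK.
move=> H.
have : \forall s \near 0^'+, K `<=` (fun x => forall y, cball x0 s y ->
   (forall j, dotp (row j B) (x - y) \is a Num.int) -> x = y).
  apply: H => x Kx; have [e e0 he] := loc x Kx.
  exists ([set x' | `|x' - x| < e], [set s | s < e]) => /=.
    split; last by apply: nbhs_right_lt.
    by apply/nbhs_ballP; exists e => // z; rewrite -ball_normE /= distrC.
  move=> [x' s] /= [h1 h2] y ys hint; apply: he hint => //.
  exact: le_lt_trans ys h2.
move=> [e /= e0 he]; exists (e / 2); first by rewrite divr_gt0.
move=> x y Kx Wy; apply: (he (e / 2)) => //=; last by rewrite divr_gt0.
by rewrite sub0r normrN gtr0_norm ?divr_gt0// ltr_pdivrMr// ltr_pMr// ltr1n.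
Qed.

(** Dividing the basis by N dilates its dual lattice by N, beyond the size of any difference between
    the two sets. *)
Lemma separated_refinement (K W : set V) : compact K -> compact W ->
  exists2 N : nat, (0 < N)%N & separated (N%:R^-1 *: B) K W.
Proof.
move=> cK cW.
have [r1 r10 Kr] := compact_norm_bounded cK.
have [r2 r20 Wr] := compact_norm_bounded cW.
pose c := kbeta B * (r1 + r2); pose N := (Num.truncn c).+1.
have N0 : (0 : R) < N%:R by rewrite ltr0n.
exists N => // x y /Kr xr /Wr yr h; apply/eqP; rewrite -subr_eq0; apply/eqP.
apply: (dotp_rows_eq0 Bu) => j.
have E : dotp (row j (N%:R^-1 *: B)) (x - y) = N%:R^-1 * dotp (row j B) (x - y).
  by rewrite linearZ /= dotpZl.
have := int_small (h j); rewrite E normrM ger0_norm ?invr_ge0 ?(ltW N0)//.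
rewrite mulrC ltr_pdivrMr// mul1r => /(_ _)/eqP.
rewrite mulf_eq0 invr_eq0 (gt_eqF N0) /= => H; apply/eqP; apply: H.
apply: le_lt_trans (dotp_row_le B j (x - y)) _.
apply: (@lt_trans _ _ c); last exact: truncnS_gt.
rewrite ltr_pM2l ?kbeta_gt0//; apply: le_lt_trans (ler_normB _ _) _.
exact: ltrD.
Qed.

End separation.

Section sequence_norm.
Context {R : realType}.

(** Only finiteness is recorded, hence no r-th root. Under [1 <= q] the last branch means q =
    +oo. *)
Definition enum_lq (q : \bar R) (I : countType) (a : I -> R) : Prop :=
  if q is r%:E%E then
    (\sum_(0 <= n <oo) (enumerate (fun i => a i `^ r) n)%:E < +oo)%E
  else exists A : R, forall i, a i <= A.

Section abstract_measure.
Context d (T : measurableType d).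
Variable mu : {measure set T -> \bar R}.

Lemma Lnorm_fin_integral (F : T -> R) (r : R) : (forall x, 0 <= F x) -> 1 <= r ->
  (Lnorm mu r%:E (EFin \o F) < +oo)%E -> (\int[mu]_x (F x `^ r)%:E < +oo)%E.
Proof.
move=> F0 r1; rewrite unlock => /lty_poweRy h.
rewrite (_ : integral _ _ _ = \int[mu]_x (`|(EFin \o F) x| `^ r))%E.
  by apply: h; rewrite invr_eq0 gt_eqF// (lt_le_trans ltr01).
by apply: eq_integral => x _; rewrite [(`|_|)%E]abse_EFin poweR_EFin ger0_norm.
Qed.

Lemma Lnorm_y_bound (F : T -> R) : (forall x, 0 <= F x) -> (0 < mu setT)%E ->
  (Lnorm mu +oo (EFin \o F) < +oo)%E ->
  exists A : R, {ae mu, forall x, F x <= A}.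
Proof.
move=> F0 muT; rewrite unlock muT => h.
have [A hA] : exists A : R, (ess_sup mu (abse \o (EFin \o F)) <= A%:E)%E.
  by move: h; case: (ess_sup _ _) => [r _|//|_]; [exists r|exists 0; rewrite leNye].
exists A; move/ess_supP : hA; apply: filterS => x /=.
by rewrite lee_fin ger0_norm.
Qed.

Lemma integral_null_infinite (N : set T) : measurable N -> mu N = 0%E ->
  (\int[mu]_x ((cst +oo%E : T -> \bar R) \_ N) x = 0)%E.
Proof. by move=> mN N0; rewrite -integral_mkcond integral_cst// N0 mule0. Qed.

Lemma Lnorm_transfer (I : countType) (F W0 : T -> R) (w : I -> T -> R)
    (a : I -> R) (C S : R) (q : \bar R) : (1%:E <= q)%E -> 0 < C -> 0 <= S ->
  (forall x, 0 <= F x) -> (forall i, 0 <= a i) ->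
  (forall i x, 0 <= w i x <= 1) -> (forall x, 0 <= W0 x <= 1) ->
  (forall i, measurable_fun setT (w i)) -> measurable_fun setT W0 ->
  (forall i, \int[mu]_x (w i x)%:E <= S%:E)%E ->
  (\int[mu]_x (W0 x)%:E <= S%:E)%E ->
  (forall x s, 0 <= s -> (forall i, w i x * a i <= s) -> F x <= C * (s + W0 x)) ->
  enum_lq q a -> (Lnorm mu q (EFin \o F) < +oo)%E.
Proof.
move=> q1 C0 S0 F0 a0 w01 W01 mw mW iw iW hF.
pose w' n x := enumerate (fun i => w i x) n.
have a0' n : 0 <= enumerate a n by exact: enumerate_ge0.
have w01' n x : 0 <= w' n x <= 1.
  by rewrite /w' /enumerate; case: (pickle_inv n) => //=; rewrite lexx ler01.
have hF' x s : 0 <= s -> (forall n, w' n x * enumerate a n <= s) ->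
    F x <= C * (s + W0 x).
  move=> s0 h; apply: hF => // i; have := h (pickle i).
  by rewrite /w' !enumerate_pickle.
case: q q1 => [r|_ [A hA]|//]; last first.
  apply: (@Lnorm_transfer_y _ T R mu F W0 w' (enumerate a) C C0 F0 a0' w01' W01 hF'
    (Num.max A 0)) => n.
  rewrite /enumerate; case: (pickle_inv n) => [i|] /=; rewrite le_max ?hA//.
  by rewrite lexx orbT.
rewrite lee_fin => r1 ha.
apply: (@Lnorm_transfer_fin _ T R mu F W0 w' (enumerate a) C S) => //.
- move=> n; rewrite /w' /enumerate; case: (pickle_inv n) => [i|] //=.
- move=> n; rewrite /w' /enumerate; case: (pickle_inv n) => [i|] //=.
  by rewrite integral0 lee_fin.
apply: le_lt_trans ha; rewrite le_eqVlt; apply/orP; left; apply/eqP.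
apply: eq_eseriesr => n _; rewrite /enumerate; case: (pickle_inv n) => [i|] //=.
by rewrite powR0// gt_eqF// (lt_le_trans ltr01).
Qed.

End abstract_measure.
End sequence_norm.

Section lattice_norms.
Context {R : realType} {d : nat}.
Local Notation V := 'rV[R]_d.

Lemma enum_lq_counting (I : countType) (p : I -> V) (g : V -> R) (q : \bar R) :
  (1%:E <= q)%E -> injective p -> (forall x, 0 <= g x) ->
  (forall x, (forall i, x != p i) -> g x = 0) ->
  (Lnorm (@counting V R) q (EFin \o g) < +oo)%E -> enum_lq q (g \o p).
Proof.
case: q => [r||//] r1 pI g0 gp.
  move=> /(Lnorm_fin_integral g0 r1).
  rewrite (@integral_counting_countable _ _ I p (fun x => g x `^ r))// => [x|x xp].
    exact: powR_ge0.
  by rewrite gp// powR0// gt_eqF// (lt_le_trans ltr01).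
move=> h; have cT : (0 < @counting V R setT)%E.
  apply: (@lt_le_trans _ _ (@counting V R [set 0])); first by rewrite counting_set1.
  by apply: le_measure; rewrite ?inE//; exact: measurable_rV_set1.
have [A [N [mN N0 hN]]] := Lnorm_y_bound g0 cT h.
(* A point violating the bound would lie in a null set of the counting measure, where every
   singleton has mass 1. *)
exists A => i /=; apply: contrapT => gi.
have : (@counting V R [set p i] <= @counting V R N)%E.
  apply: le_measure; rewrite ?inE//; first exact: measurable_rV_set1.
  by move=> _ ->; exact: hN.
by rewrite [X in (_ <= X)%E]N0 counting_set1 lee_fin ler10.
Qed.

Lemma enum_lq_translate (B : 'M[R]_d) (g : V -> R) (q : \bar R) : B \in unitmx ->
  (1%:E <= q)%E -> (forall x, 0 <= g x) ->
  measurable_fun [set: lebT R d] (g : lebT R d -> R) ->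
  (Lnorm (leb R d) q (EFin \o g) < +oo)%E -> exists eta : V,
  enum_lq q (fun z : 'rV[int]_d => g (eta + map_mx intr z *m B)).
Proof.
move=> Bu; case: q => [r||//] r1 g0 mg.
  move=> h; have intg := @Lnorm_fin_integral R _ (lebT R d) (leb R d) g r g0 r1 h.
  have mgr : measurable_fun [set: lebT R d] (fun x : lebT R d => (g x `^ r)%:E).
    by apply/measurable_EFinP; exact: measurableT_comp (measurable_powR r) mg.
  have gr0 (x : lebT R d) : (0 <= (g x `^ r)%:E)%E by rewrite lee_fin powR_ge0.
  have [eta heta] := leb_translate_series_finite Bu gr0 mgr intg.
  exists eta; rewrite /enum_lq.
  apply: le_lt_trans heta; rewrite le_eqVlt; apply/orP; left; apply/eqP.
  by apply: eq_eseriesr => n _; rewrite EFin_enumerate.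
move=> h; have lT : (0 < leb R d setT)%E.
  apply: (@lt_le_trans _ _ (leb R d [set x : V | `|x| < 1])).
    by rewrite leb_ball0// lte_fin exprn_gt0.
  by apply: le_measure; rewrite ?inE//; exact: leb_ball0_measurable.
have [A [N [mN N0 hN]]] := @Lnorm_y_bound R _ (lebT R d) (leb R d) g g0 lT h.
(* Infinite on the exceptional null set, this function has integral 0; a translate along which its
   series is finite avoids that set altogether. *)
pose f : lebT R d -> \bar R := cst +oo%E \_ N.
have f0 x : (0 <= f x)%E by apply: erestrict_ge0 => y _; rewrite leey.
have mf : measurable_fun setT f by apply/(measurable_restrictT _ mN); exact: measurable_cst.
have intf : (\int[leb R d]_x f x < +oo)%E.
  by rewrite (@integral_null_infinite R _ (lebT R d) (leb R d) N mN N0).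
have [eta heta] := leb_translate_series_finite Bu f0 mf intf.
exists eta, A => z; apply: contrapT => gz.
have fz : f (eta + map_mx intr z *m B) = +oo%E.
  by rewrite /f patchE mem_set//; exact: hN.
move: heta; rewrite (@nneseriesD1 R _ (pickle z))//; last first.
  by move=> n _; exact: enumerate_ge0e.
rewrite enumerate_pickle fz addye ?ltxx// gt_eqF// (@lt_le_trans _ _ 0%E)//.
by apply: nneseries_ge0 => n _ _; exact: enumerate_ge0e.
Qed.

End lattice_norms.

(** * The two implications *)

Section regularity_transfer.
Context {R : realType} {d : nat}.
Local Notation V := 'rV[R]_d.
Variables (om : V -> R) (Om Lam : set V) (f : (V -> R[i]) -> R[i]).
Variables (v : V -> R) (q : \bar R) (x0 xi0 : V) (U : set V).
Hypothesis hom : weight_assumptions om.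
Hypothesis hf : ultradistribution om Om f.
Hypothesis hv : moderate_weight om v.
Hypothesis q1 : (1%:E <= q)%E.

Definition weighted_on (G : set V) (c : V -> R[i]) : V -> R :=
  (fun xi => normc (c xi) * v xi) \_ G.

Lemma weighted_on_ge0 G c x : 0 <= weighted_on G c x.
Proof.
rewrite /weighted_on patchE; case: ifP => // _.
by rewrite mulr_ge0 ?normc_ge0//; case: hv.
Qed.

Lemma weighted_onE G (c : V -> R[i]) x : G x -> weighted_on G c x = normc (c x) * v x.
Proof. by move=> Gx; rewrite /weighted_on patchE mem_set. Qed.

Lemma EFin_weighted_on G c : EFin \o weighted_on G c =
  (fun xi : V => (normc (c xi) * v xi)%:E) \_ G.
Proof.
by apply/funext => x; rewrite /weighted_on /= !patchE; case: ifP.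
Qed.

Lemma lattice_coord_inj (B : 'M[R]_d) : B \in unitmx ->
  injective (fun z : 'rV[int]_d => map_mx intr z *m B : V).
Proof.
move=> Bu z z' /= /(can_inj (mulmxK Bu)) /rowP zz'.
by apply/rowP => j; have := zz' j; rewrite !mxE => /intr_inj.
Qed.

Lemma discrete_regular_microlocal K Gam phi (B : 'M[R]_d) :
  B \in unitmx -> (forall x, Lam x <-> exists k : 'rV[int]_d, x = map_mx intr k *m B) ->
  compact K -> K `<=` Om ->
  (forall x, K x -> (forall j, dotp (row j B) (x - x0) \is a Num.int) -> x = x0) ->
  tf om K phi -> phi x0 != 0 -> open_conic_nbhd xi0 Gam ->
  (lqNorm q v (Gam `&` Lam) (fourierD (mulD phi f)) < +oo)%E ->
  microlocally_regular om Om q v f x0 xi0.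
Proof.
move=> Bu hB cK KOm Kx0 tp px0 hGam hq.
have [s s0 sep] := separated_neighborhood Bu cK Kx0.
have cW : compact (cball x0 s) by exact: cball_compact.
have [chi tc cx0] := tf_shrink hom x0 cK tp px0 s0.
have [Gam' [M [hGam' M0 hcone]]] := conic_shrink hGam.
have [C C0 hC] := cone_estimate hom 0 Bu hf cK KOm cW sep tp tc hv M0 hcone.
exists Gam', (fun x => phi x * chi x); split.
- exact: hGam'.
- apply: (tf_testfun _ _ (tfM hom cK cW tp tc)).
    apply: compact_closedI => //; apply: compact_closed cW.
    exact: norm_hausdorff.
  by move=> x [/KOm].
- by rewrite mulf_neq0.
set H := fourierD (mulD phi f) in hq hC *.
set H2 := fourierD (mulD (fun x => phi x * chi x) f) in hC *.
pose p (z : 'rV[int]_d) : V := map_mx intr z *m B.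
pose a z := weighted_on (Gam `&` Lam) H (p z).
have ha : enum_lq q a.
  apply: (enum_lq_counting (p := p)) => //; first exact: lattice_coord_inj.
  - exact: weighted_on_ge0.
  - move=> x xp; rewrite /weighted_on patchE memNset// => -[_ /hB[k xk]].
    by move: (xp k); rewrite xk eqxx.
  by rewrite EFin_weighted_on.
have [S S0 hS] := @wt_integral R d.
rewrite /LqNorm -EFin_weighted_on.
have w01 (x : V) : 0 <= wt x <= 1 by rewrite (ltW (wt_gt0 x)) wt_le1.
have hS0 : (\int[leb R d]_x (wt (x : V))%:E <= S%:E)%E.
  by have := hS 0; under eq_integral do rewrite subr0.
apply: (@Lnorm_transfer R _ (lebT R d) (leb R d) 'rV[int]_d
  (weighted_on Gam' H2) (@wt R d) (fun z x => wt ((x : V) - p z)) a C S q q1 C0 (ltW S0)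
  (weighted_on_ge0 Gam' H2) (fun z => weighted_on_ge0 (Gam `&` Lam) H (p z))
  (fun z x => w01 _) w01 (fun z => measurable_wt_shift (p z))
  (continuous_leb continuous_wt) (fun z => hS (p z)) hS0 _ ha).
move=> x t t0 ht; have [Gx|nGx] := pselect (Gam' x); last first.
  rewrite {1}/weighted_on patchE memNset// mulr_ge0 ?(ltW C0)// addr_ge0//.
  by have /andP[] := w01 x.
rewrite weighted_onE//; apply: hC => // z /=; rewrite subr0 => Gp.
have := ht z; rewrite /a weighted_onE//; split => //.
by apply/hB; exists z.
Qed.

Lemma measurable_weighted_on Gam (H : V -> R[i]) : open Gam -> ccont H ->
  measurable_fun [set: lebT R d] (weighted_on Gam H : lebT R d -> R).
Proof.
move=> oG cH.
have mG : measurable (Gam : set (lebT R d)) by exact: open_leb_measurable.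
apply/(measurable_restrictT _ mG); apply: measurable_funM.
  exact: measurable_funTS (continuous_leb (ccont_normc cH)).
by apply: measurable_funTS; case: hv.
Qed.

Lemma microlocal_discrete_regular K Gam phi (B : 'M[R]_d) :
  open U -> U 0 ->
  B \in unitmx -> (forall x, Lam x <-> exists k : 'rV[int]_d, x = map_mx intr k *m B) ->
  compact K -> K `<=` Om ->
  tf om K phi -> phi x0 != 0 -> open_conic_nbhd xi0 Gam ->
  (LqNorm q v Gam (fourierD (mulD phi f)) < +oo)%E ->
  exists (Gam : set V) (phi : V -> R[i]),
     [/\ open_conic_nbhd xi0 Gam,
         testfun om [set x0 + u | u in U] phi,
         phi x0 != 0 &
         (lqNorm q v (Gam `&` Lam) (fourierD (mulD phi f)) < +oo)%E].
Proof.
move=> oU U0 Bu hB cK KOm tp px0 hGam hq.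
have [e e0 he] := open_ball_norm oU U0.
pose s := e / 2; have s0 : 0 < s by rewrite divr_gt0.
have cW : compact (cball x0 s) by exact: cball_compact.
have [chi tc cx0] := tf_shrink hom x0 cK tp px0 s0.
have [Gam' [M [hGam' M0 hcone]]] := conic_shrink hGam.
have [N N0 sep] := @separated_refinement R d B Bu K (cball x0 s) cK cW.
set B' := N%:R^-1 *: B in sep.
have Bu' : B' \in unitmx.
  by rewrite unitmxZ// unitfE invr_eq0 pnatr_eq0 -lt0n.
set H := fourierD (mulD phi f) in hq.
have mg : measurable_fun [set: lebT R d] (weighted_on Gam H : lebT R d -> R).
  apply: measurable_weighted_on; first by case: hGam.
  exact: (fourierD_continuous hom hf cK KOm tp).
have hq' : (Lnorm (leb R d) q (EFin \o weighted_on Gam H) < +oo)%E.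
  by rewrite EFin_weighted_on.
have [eta heta] := enum_lq_translate Bu' q1 (weighted_on_ge0 Gam H) mg hq'.
(* The sign is opposite because [cone_estimate] takes its samples at lattice points minus the
   shift. *)
have [C C0 hC] := cone_estimate hom (- eta) Bu' hf cK KOm cW sep tp tc hv M0 hcone.
exists Gam', (fun x => phi x * chi x); split.
- exact: hGam'.
- apply: (tf_testfun _ _ (tfM hom cK cW tp tc)).
    apply: compact_closedI => //; apply: compact_closed cW.
    exact: norm_hausdorff.
  move=> x [_ xW]; exists (x - x0); last by rewrite addrC subrK.
  by apply: he; rewrite subr0 (le_lt_trans xW)// /s ltr_pdivrMr// ltr_pMr// ltr1n.
- by rewrite mulf_neq0.
set H2 := fourierD (mulD (fun x => phi x * chi x) f) in hC *.
pose p (z : 'rV[int]_d) : V := eta + map_mx intr z *m B'.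
pose a z := weighted_on Gam H (p z).
(* The basis is [B], not its refinement: the weights are summed over the points of [Lam] where the
   norm is taken, for a fixed sample point. *)
have [S S0 hS] := wt_int_sum Bu.
rewrite /lqNorm -EFin_weighted_on.
have w01 (x : V) : 0 <= wt x <= 1 by rewrite (ltW (wt_gt0 x)) wt_le1.
(* With the indicator of [Lam], integrals of the weights against the counting measure of [V] become
   bounded lattice sums. *)
pose wL (y x : V) : R := wt (x - y) * \1_Lam x.
have wL01 y x : 0 <= wL y x <= 1.
  have /andP[w0 w1] := w01 (x - y); rewrite mulr_ge0//=.
  by rewrite mulr_ile1// indicE; case: (_ \in _).
have mLam : measurable (Lam : set V).
  have -> : Lam = \bigcup_(z : 'rV[int]_d) [set map_mx intr z *m B].
    by apply/seteqP; split => x => [/hB[k ->]|[k _ ->]]; [exists k|apply/hB; exists k].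
  apply: countable_bigcupT_measurable => // z.
  exact: measurable_rV_set1.
have mwL y : measurable_fun setT (wL y).
  apply: measurable_funM; last exact: measurable_indic.
  apply: continuous_borel => x.
  refine (@continuous_comp V V R (fun z => z - y) (@wt R d) x _ (@continuous_wt R d _)).
  exact: (@cvgB R V V (nbhs x) _ (fun z : V => z) (fun=> y) x y cvg_id (cvg_cst _)).
have iwL y : (\int[@counting V R]_x (wL y x)%:E <= S%:E)%E.
  rewrite (@integral_counting_countable _ _ _ (fun z : 'rV[int]_d => map_mx intr z *m B)).
  - apply: le_trans (hS y); rewrite le_eqVlt; apply/orP; left; apply/eqP.
    apply: eq_eseriesr => n _; congr (enumerate _ n)%:E; apply/funext => z /=.
    rewrite /wL indicE mem_set ?mulr1; last by apply/hB; exists z.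
    by rewrite -wtN opprB.
  - exact: lattice_coord_inj.
  - by move=> x; have /andP[] := wL01 y x.
  move=> x xz; rewrite /wL indicE memNset ?mulr0// => /hB[k xk].
  by move: (xz k); rewrite xk eqxx.
apply: (@Lnorm_transfer R _ V (@counting V R) 'rV[int]_d
  (weighted_on (Gam' `&` Lam) H2) (wL 0) (fun z => wL (p z)) a C S q q1 C0 (ltW S0)
  (weighted_on_ge0 (Gam' `&` Lam) H2) (fun z => weighted_on_ge0 Gam H (p z))
  (fun z => wL01 (p z)) (wL01 0) (fun z => mwL (p z)) (mwL 0)
  (fun z => iwL (p z)) (iwL 0) _ heta).
move=> x t t0 ht; have [[Gx Lx]|nGx] := pselect ((Gam' `&` Lam) x); last first.
  rewrite {1}/weighted_on patchE memNset// mulr_ge0 ?(ltW C0)// addr_ge0//.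
  by have /andP[] := wL01 0 x.
rewrite weighted_onE// /wL subr0 indicE mem_set// mulr1.
apply: hC => // z /=; rewrite opprK addrC => Gp.
by have := ht z; rewrite /a weighted_onE// /wL indicE mem_set// mulr1.
Qed.

End regularity_transfer.

Theorem theorem4p1 (R : realType) (d : nat) (om : 'rV[R]_d -> R)
    (hom : weight_assumptions om)
    (Om : set 'rV[R]_d) (hOm : open Om)
    (Lam : set 'rV[R]_d) (hLam : lattice Lam)
    (f : ('rV[R]_d -> R[i]) -> R[i]) (hf : ultradistribution om Om f)
    (v : 'rV[R]_d -> R) (hv : moderate_weight om v)
    (q : \bar R) (hq : (1%:E <= q)%E)
    (x0 xi0 : 'rV[R]_d) (hx0 : Om x0) (hxi0 : xi0 != 0)
    (U : set 'rV[R]_d) (hU : open U) (hUconvex : convex_set U) (hU0 : U 0)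
    (hULam : U `&` dual_lattice Lam = [set 0])
    (hx0U : [set x0 + u | u in U] `<=` Om) :
  (exists (Gam : set 'rV[R]_d) (phi : 'rV[R]_d -> R[i]),
     [/\ open_conic_nbhd xi0 Gam,
         testfun om [set x0 + u | u in U] phi,
         phi x0 != 0 &
         (lqNorm q v (Gam `&` Lam) (fourierD (mulD phi f)) < +oo)%E])
  <-> microlocally_regular om Om q v f x0 xi0.
Proof.
have [B Bu hB] := lattice_basis hLam.
split=> [] [Gam [phi [hGam [K [cK KO /(DKP _ _ cK) tp]] px0 fin]]].
  have KOm : K `<=` Om by exact: subset_trans KO hx0U.
  apply: (discrete_regular_microlocal hom hf hv hq Bu hB cK KOm _ tp px0 hGam fin).
  move=> x /KO[u Uu <-]; rewrite [x0 + u - x0]addrC addKr => /(lattice_dual_basis hB) hu.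
  suff : [set 0] u by move=> ->; rewrite addr0.
  by rewrite -hULam.
exact: (microlocal_discrete_regular hom hf hv hq hU hU0 Bu hB cK KO tp px0 hGam fin).
Qed.
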